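(* Let $A$ be a separable $C_0(X)$-algebra with base map $\phi$ and let $x\in X_\phi$. Then $H_x$ is strictly closed in $M(A)$ if and only if $J_x$ is locally modular and $\phi$ is locally closed at $x$.
   Context: For a C$^*$-algebra $A$, $\mathrm{Prim}(A)$ is the primitive ideal space with the hull-kernel topology and $M(A)$ is the multiplier algebra. $A$ is a $C_0(X)$-algebra with base map $\phi$ if $X$ is a locally compact Hausdorff space and $\phi:\mathrm{Prim}(A)\to X$ is continuous; $X_\phi$ denotes the image of $\phi$ with the subspace topology. For a closed two-sided ideal $J$ of $A$, $\tilde J=\{b\in M(A): ba,ab\in J \text{ for all } a\in A\}$. If $P\in\mathrm{Prim}(A)$ then $\tilde P\in\mathrm{Prim}(M(A))$, and $P\mapsto\tilde P$ is a homeomorphism onto a dense open subset of $\mathrm{Prim}(M(A))$. The map $\phi$ has a unique extension to a continuous map $\overline\phi:\mathrm{Prim}(M(A))\to\beta X$ (the Stone-Čech compactification) with $\overline\phi(\tilde P)=\phi(P)$ for all $P\in\mathrm{Prim}(A)$. For $x\in X_\phi$ put $J_x=\bigcap\{P\in\mathrm{Prim}(A):\phi(P)=x\}$ and $H_x=\bigcap\{Q\in\mathrm{Prim}(M(A)):\overline\phi(Q)=x\}$. ''Strictly closed'' means closed in the strict topology of $M(A)$. For $x\in X_\phi$ let $H(x)=\phi^{-1}(x)\subseteq\mathrm{Prim}(A)$, with boundary $\partial H(x)$ and interior $U(x)$ in $\mathrm{Prim}(A)$. $J_x$ is locally modular if for each $P\in\partial H(x)$ there is a relatively open neighbourhood $V$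 of $P$ in $\mathrm{Prim}(A)\setminus U(x)$ such that $A/\ker V$ is unital, where $\ker V=\bigcap_{Q\in V}Q$. The map $\phi$ is locally closed at $x$ if whenever $Y$ is a closed subset of $\mathrm{Prim}(A)$ such that $x$ lies in the closure of $\phi(Y)$, then $x\in\phi(Y)$. *)

(* Defs.v *)
From HB Require Import structures.
From mathcomp Require Import all_boot all_order all_algebra.
From mathcomp Require Import all_classical all_reals all_analysis.
From mathcomp Require Import complex.

Set Implicit Arguments.
Unset Strict Implicit.
Unset Printing Implicit Defensive.

Import Order.TTheory GRing.Theory Num.Theory.
Import numFieldNormedType.Exports.

Local Open Scope classical_set_scope.
Local Open Scope ring_scope.

(* Complex algebras are not required to have a unit, so they cannot be based on
   the ring structures of the library. *)

HB.mixin Record isStarAlgebra (R : realType) A of GRing.Lmodule R[i] A := {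
  amul : A -> A -> A;
  astar : A -> A;
  amulA : associative amul;
  amulDl : left_distributive amul +%R;
  amulDr : right_distributive amul +%R;
  amulZl : forall (k : R[i]) a b, amul (k *: a) b = k *: amul a b;
  amulZr : forall (k : R[i]) a b, amul a (k *: b) = k *: amul a b;
  astarK : involutive astar;
  astarD : {morph astar : a b / a + b};
  astarZ : forall (k : R[i]) a, astar (k *: a) = k^* *: astar a;
  astarM : forall a b, astar (amul a b) = amul (astar b) (astar a)
}.

#[short(type="starAlgType")]
HB.structure Definition StarAlgebra (R : realType) :=
  {A of GRing.Lmodule R[i] A & isStarAlgebra R A}.

Notation "a ⋅ b" := (amul a b) (at level 40, left associativity) : ring_scope.

HB.mixin Record isCStarAlgebra (R : realType) A
    of StarAlgebra R A & CompleteNormedModule R[i] A := {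
  ler_normMa : forall a b : A, `|a ⋅ b| <= `|a| * `|b|;
  normCstar : forall a : A, `|astar a ⋅ a| = `|a| ^+ 2
}.

#[short(type="cstarAlgType")]
HB.structure Definition CStarAlgebra (R : realType) :=
  {A of StarAlgebra R A & CompleteNormedModule R[i] A & isCStarAlgebra R A}.

Definition separable (T : topologicalType) :=
  exists D : set T, countable D /\ dense D.

(* The inner product is linear in the first variable; its positivity is a
   consequence of [inner_norm]. *)
HB.mixin Record isHilbert (R : realType) H of CompleteNormedModule R[i] H := {
  inner : H -> H -> R[i];
  innerDl : forall u v w, inner (u + v) w = inner u w + inner v w;
  innerZl : forall (k : R[i]) u v, inner (k *: u) v = k * inner u v;
  innerC : forall u v, inner v u = (inner u v)^*;
  inner_norm : forall u, inner u u = `|u| ^+ 2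
}.

#[short(type="hilbertType")]
HB.structure Definition Hilbert (R : realType) :=
  {H of CompleteNormedModule R[i] H & isHilbert R H}.

(* A *-homomorphism from a C*-algebra to the bounded operators on a Hilbert
   space is automatically bounded, so Prim only depends on the *-algebra
   structure; it is used below for both A and M(A). *)
Section Prim.
Variables (R : realType) (B : starAlgType R).

Record is_representation (H : hilbertType R) (pi : B -> H -> H) : Prop := {
  rep_linearl : forall v, linear (fun b => pi b v);
  rep_linearr : forall b, linear (pi b);
  rep_bounded : forall b, continuous (pi b);
  rep_mul : forall a b v, pi (a ⋅ b) v = pi a (pi b v);
  rep_star : forall b u v, inner (pi b u) v = inner u (pi (astar b) v)
}.

Definition closed_subspace (H : hilbertType R) (W : set H) :=
  [/\ W 0, forall (k : R[i]) u v, W u -> W v -> W (k *: u + v) & closed W].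

(* The zero representation is excluded. *)
Definition is_irreducible (H : hilbertType R) (pi : B -> H -> H) :=
  (exists b v, pi b v <> 0) /\
  forall W : set H, closed_subspace W ->
    (forall b v, W v -> W (pi b v)) -> W = [set 0] \/ W = setT.

Definition rep_ker (H : hilbertType R) (pi : B -> H -> H) : set B :=
  [set b | forall v, pi b v = 0].

Definition is_primitive (P : set B) :=
  exists (H : hilbertType R) (pi : B -> H -> H),
    [/\ is_representation pi, is_irreducible pi & P = rep_ker pi].

Record prim := Prim { prim_ideal : set B; primP : is_primitive prim_ideal }.

HB.instance Definition _ := gen_eqMixin prim.
HB.instance Definition _ := gen_choiceMixin prim.

Definition ker_of (V : set prim) : set B :=
  \bigcap_(Q in V) prim_ideal Q.

Definition hull_kernel_closed (F : set prim) :=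
  forall P : prim, ker_of F `<=` prim_ideal P -> F P.

Definition hull_kernel_open (U : set prim) := hull_kernel_closed (~` U).

Section Primeness.
Variables (H : hilbertType R) (pi : B -> H -> H).
Hypotheses (rpi : is_representation pi) (ipi : is_irreducible pi).

Lemma rep0 b : pi b 0 = 0.
Proof. by have := rep_linearr rpi b (-1) 0 0; rewrite !scaleN1r !addNr. Qed.

Lemma rep_ker_subspace (W : set H) (S : set B) :
  W = [set u | forall a, S a -> pi a u = 0] -> closed_subspace W.
Proof.
move=> ->; split => /=.
- by move=> a _; exact: rep0.
- move=> k u v Wu Wv a Sa.
  by rewrite (rep_linearr rpi) Wu// Wv// scaler0 addr0.
- have -> : [set u | forall a, S a -> pi a u = 0] =
      \bigcap_(a in S) (pi a @^-1` [set 0]) by [].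
  apply: closed_bigI => a _; apply: preimage_closed.
    by move=> x _; exact: (rep_bounded rpi).
  exact/accessible_closed_set1/hausdorff_accessible/norm_hausdorff.
Qed.

Lemma rep_vanish a :
  (forall b v, pi a (pi b v) = 0) -> forall v, pi a v = 0.
Proof.
move=> h; pose W := [set u | forall c, [set a] c -> pi c u = 0].
have sW : closed_subspace W by exact: rep_ker_subspace.
have hW b v : W (pi b v) by move=> _ ->; exact: h.
have [||W0|WT] := ipi.2 W => //; last first.
  by move=> v; have /(_ a erefl) : W v by rewrite WT.
by case: ipi.1 => b [w]; have := hW b w; rewrite W0 /= => ->.
Qed.

Lemma rep_prime a b : (forall c v, pi a (pi c (pi b v)) = 0) ->
  (forall v, pi a v = 0) \/ (forall v, pi b v = 0).
Proof.
move=> h; have [|/existsNP[v0 nz]] := pselect (forall v, pi b v = 0).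
  by right.
left; apply: rep_vanish => c v.
pose S := [set d | exists c, d = a ⋅ c].
pose W := [set u | forall d, S d -> pi d u = 0].
have sW : closed_subspace W by exact: rep_ker_subspace.
have [|W0|WT] := ipi.2 _ sW.
- move=> d u Wu _ [e ->]; rewrite -(rep_mul rpi) -amulA.
  by apply: Wu; exists (e ⋅ d).
- suff : W (pi b v0) by rewrite W0.
  by move=> _ [e ->]; rewrite (rep_mul rpi).
- have : W v by rewrite WT.
  by move=> /(_ (a ⋅ c)); rewrite (rep_mul rpi); apply; exists c.
Qed.

End Primeness.

Lemma prim_ideall (P : prim) a b :
  prim_ideal P b -> prim_ideal P (a ⋅ b).
Proof.
case: P => P /= [H [pi [rpi _ ->]]] /= Pb v.
by rewrite (rep_mul rpi) Pb (rep0 rpi).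
Qed.

Lemma prim_idealr (P : prim) a b :
  prim_ideal P a -> prim_ideal P (a ⋅ b).
Proof.
by case: P => P /= [H [pi [rpi _ ->]]] /= Pa v; rewrite (rep_mul rpi) Pa.
Qed.

Lemma prim_prime (P : prim) a b : (forall c, prim_ideal P (a ⋅ c ⋅ b)) ->
  prim_ideal P a \/ prim_ideal P b.
Proof.
case: P => P /= [H [pi [rpi ipi ->]]] /= Pab.
apply: (rep_prime rpi ipi) => c v.
by rewrite -!(rep_mul rpi) Pab.
Qed.

Lemma prim_proper (P : prim) : exists b, ~ prim_ideal P b.
Proof.
case: P => P /= [H [pi [rpi [[b [v bv]] _] ->]]] /=.
by exists b => /(_ v).
Qed.

Lemma hull_kernel_openT : hull_kernel_open setT.
Proof.
move=> P h; have [b Pb] := prim_proper P; exfalso; apply/Pb/h.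
by move=> Q nT; exfalso; apply: nT.
Qed.

Lemma hull_kernel_openI : setI_closed hull_kernel_open.
Proof.
move=> U V oU oV; rewrite /hull_kernel_open setCI => P h.
apply: contrapT => /not_orP[nU nV].
have /existsNP[a /not_implyP[ka Pa]] : ~ (ker_of (~` U) `<=` prim_ideal P).
  by move/oU.
have /existsNP[b /not_implyP[kb Pb]] : ~ (ker_of (~` V) `<=` prim_ideal P).
  by move/oV.
have [|//|//] := @prim_prime P a b; move=> c; apply: h => Q [] nQ.
- exact/prim_idealr/prim_idealr/ka.
- exact/prim_ideall/kb.
Qed.

Lemma hull_kernel_open_bigU (I : Type) (f : I -> set prim) :
  (forall i, hull_kernel_open (f i)) -> hull_kernel_open (\bigcup_i f i).
Proof.
move=> of_ P h [i _ fP]; apply: (of_ i P) => // b kb; apply: h => Q nQ.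
by apply: kb => fQ; apply: nQ; exists i.
Qed.

HB.instance Definition _ := isOpenTopological.Build prim
  hull_kernel_openT hull_kernel_openI hull_kernel_open_bigU.

End Prim.

(* M(A) is the algebra of double centralizers of A. *)
Section Multiplier.
Variables (R : realType) (A : cstarAlgType R).

(* [lmul b a] and [rmul b a] stand for the products [b a] and [a b] *)
Record multiplier := Multiplier {
  lmul : A -> A;
  rmul : A -> A;
  lmul_linear : linear lmul;
  rmul_linear : linear rmul;
  lmul_continuous : continuous lmul;
  rmul_continuous : continuous rmul;
  lmulM : forall a c, lmul (a ⋅ c) = lmul a ⋅ c;
  rmulM : forall a c, rmul (a ⋅ c) = a ⋅ rmul c;
  rlmul : forall a c, rmul a ⋅ c = a ⋅ lmul c
}.

HB.instance Definition _ := gen_eqMixin multiplier.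
HB.instance Definition _ := gen_choiceMixin multiplier.

Lemma multiplierP (b c : multiplier) :
  lmul b =1 lmul c -> rmul b =1 rmul c -> b = c.
Proof.
case: b => l1 r1 ? ? ? ? ? ? ?; case: c => l2 r2 ? ? ? ? ? ? ? /=.
by move=> /funext e1 /funext e2; subst; congr Multiplier; exact: Prop_irrelevance.
Qed.

Lemma amul0r (a : A) : a ⋅ 0 = 0.
Proof. by rewrite -(scale0r 0) amulZr !scale0r. Qed.

Lemma amul0l (a : A) : 0 ⋅ a = 0.
Proof. by rewrite -(scale0r 0) amulZl !scale0r. Qed.

Lemma amulNr (a c : A) : a ⋅ (- c) = - (a ⋅ c).
Proof. by rewrite -scaleN1r amulZr scaleN1r. Qed.

Lemma amulNl (a c : A) : (- a) ⋅ c = - (a ⋅ c).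
Proof. by rewrite -scaleN1r amulZl scaleN1r. Qed.

Lemma norm_astar (a : A) : `|astar a| = `|a|.
Proof.
suff h (c : A) : `|c| <= `|astar c|.
  by apply/eqP; rewrite eq_le -{2}[a]astarK !h.
have [->|c0] := eqVneq `|c| 0; first exact: normr_ge0.
have : `|c| ^+ 2 <= `|astar c| * `|c| by rewrite -normCstar ler_normMa.
by rewrite expr2 ler_pM2r// lt_def c0 normr_ge0.
Qed.

Lemma astarN (a : A) : astar (- a) = - astar a.
Proof. by rewrite -scaleN1r astarZ rmorphN rmorph1 scaleN1r. Qed.

Lemma astar_continuous : continuous (@astar R A).
Proof.
move=> a; apply/cvgrPdist_lt => e e0.
near=> c; rewrite -astarN -astarD norm_astar; near: c.
exact: cvgr_dist_lt.
Unshelve. all: by end_near. Qed.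

Program Definition mult0 : multiplier := @Multiplier (fun=> 0) (fun=> 0) _ _ _ _ _ _ _.
Next Obligation. by move=> k u v; rewrite scaler0 addr0. Qed.
Next Obligation. by move=> k u v; rewrite scaler0 addr0. Qed.
Next Obligation. exact: cst_continuous. Qed.
Next Obligation. exact: cst_continuous. Qed.
Next Obligation. by move=> a c /=; rewrite amul0l. Qed.
Next Obligation. by move=> a c /=; rewrite amul0r. Qed.
Next Obligation. by move=> a c /=; rewrite amul0l amul0r. Qed.

Program Definition mult_opp (b : multiplier) : multiplier :=
  @Multiplier (fun a => - lmul b a) (fun a => - rmul b a) _ _ _ _ _ _ _.
Next Obligation. by move=> b k u v /=; rewrite lmul_linear opprD scalerN. Qed.
Next Obligation. by move=> b k u v /=; rewrite rmul_linear opprD scalerN. Qed.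
Next Obligation. by move=> b x; apply: cvgN; exact: lmul_continuous. Qed.
Next Obligation. by move=> b x; apply: cvgN; exact: rmul_continuous. Qed.
Next Obligation. by move=> b a c /=; rewrite lmulM amulNl. Qed.
Next Obligation. by move=> b a c /=; rewrite rmulM amulNr. Qed.
Next Obligation. by move=> b a c /=; rewrite amulNl rlmul amulNr. Qed.

Program Definition mult_add (b d : multiplier) : multiplier :=
  @Multiplier (fun a => lmul b a + lmul d a) (fun a => rmul b a + rmul d a)
    _ _ _ _ _ _ _.
Next Obligation. by move=> b d k u v /=; rewrite !lmul_linear scalerDr addrACA. Qed.
Next Obligation. by move=> b d k u v /=; rewrite !rmul_linear scalerDr addrACA. Qed.
Next Obligation. by move=> b d x; apply: cvgD; exact: lmul_continuous. Qed.
Next Obligation. by move=> b d x; apply: cvgD; exact: rmul_continuous. Qed.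
Next Obligation. by move=> b d a c /=; rewrite !lmulM amulDl. Qed.
Next Obligation. by move=> b d a c /=; rewrite !rmulM amulDr. Qed.
Next Obligation. by move=> b d a c /=; rewrite amulDl !rlmul amulDr. Qed.

Program Definition mult_scale (k : R[i]) (b : multiplier) : multiplier :=
  @Multiplier (fun a => k *: lmul b a) (fun a => k *: rmul b a) _ _ _ _ _ _ _.
Next Obligation.
by move=> k b l u v /=; rewrite lmul_linear scalerDr !scalerA mulrC.
Qed.
Next Obligation.
by move=> k b l u v /=; rewrite rmul_linear scalerDr !scalerA mulrC.
Qed.
Next Obligation. by move=> k b x; apply: cvgZr; exact: lmul_continuous. Qed.
Next Obligation. by move=> k b x; apply: cvgZr; exact: rmul_continuous. Qed.
Next Obligation. by move=> k b a c /=; rewrite lmulM amulZl. Qed.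
Next Obligation. by move=> k b a c /=; rewrite rmulM amulZr. Qed.
Next Obligation. by move=> k b a c /=; rewrite amulZl rlmul amulZr. Qed.

Program Definition mult_mul (b d : multiplier) : multiplier :=
  @Multiplier (lmul b \o lmul d) (rmul d \o rmul b) _ _ _ _ _ _ _.
Next Obligation. by move=> b d k u v /=; rewrite !lmul_linear. Qed.
Next Obligation. by move=> b d k u v /=; rewrite !rmul_linear. Qed.
Next Obligation.
by move=> b d x; apply: continuous_comp; exact: lmul_continuous.
Qed.
Next Obligation.
by move=> b d x; apply: continuous_comp; exact: rmul_continuous.
Qed.
Next Obligation. by move=> b d a c /=; rewrite !lmulM. Qed.
Next Obligation. by move=> b d a c /=; rewrite !rmulM. Qed.
Next Obligation. by move=> b d a c /=; rewrite !rlmul. Qed.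

Lemma astar_conj_continuous (f : A -> A) :
  continuous f -> continuous (fun a => astar (f (astar a))).
Proof.
move=> cf a; have c1 : {for a, continuous (f \o @astar R A)}.
  by apply: continuous_comp; [exact: astar_continuous | exact: cf].
by apply: (continuous_comp c1); exact: astar_continuous.
Qed.

Program Definition mult_star (b : multiplier) : multiplier :=
  @Multiplier (fun a => astar (rmul b (astar a)))
    (fun a => astar (lmul b (astar a))) _ _ _ _ _ _ _.
Next Obligation.
by move=> b k u v /=; rewrite astarD astarZ rmul_linear astarD astarZ conjCK.
Qed.
Next Obligation.
by move=> b k u v /=; rewrite astarD astarZ lmul_linear astarD astarZ conjCK.
Qed.
Next Obligation.
by move=> b; apply: astar_conj_continuous; exact: rmul_continuous.
Qed.
Next Obligation.
by move=> b; apply: astar_conj_continuous; exact: lmul_continuous.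
Qed.
Next Obligation. by move=> b a c /=; rewrite astarM rmulM astarM astarK. Qed.
Next Obligation. by move=> b a c /=; rewrite astarM lmulM astarM astarK. Qed.
Next Obligation.
by move=> b a c /=; rewrite -{1}[c]astarK -astarM -rlmul astarM astarK.
Qed.

Lemma mult_addA : associative mult_add.
Proof. by move=> b c d; apply: multiplierP => a /=; rewrite addrA. Qed.

Lemma mult_addC : commutative mult_add.
Proof. by move=> b c; apply: multiplierP => a /=; rewrite addrC. Qed.

Lemma mult_add0 : left_id mult0 mult_add.
Proof. by move=> b; apply: multiplierP => a /=; rewrite add0r. Qed.

Lemma mult_addN : left_inverse mult0 mult_opp mult_add.
Proof. by move=> b; apply: multiplierP => a /=; rewrite addNr. Qed.

HB.instance Definition _ := GRing.isZmodule.Build multiplier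
  mult_addA mult_addC mult_add0 mult_addN.

Lemma mult_scaleA (k l : R[i]) b :
  mult_scale k (mult_scale l b) = mult_scale (k * l) b.
Proof. by apply: multiplierP => a /=; rewrite scalerA. Qed.

Lemma mult_scale1 : left_id 1 mult_scale.
Proof. by move=> b; apply: multiplierP => a /=; rewrite scale1r. Qed.

Lemma mult_scaleDr : right_distributive mult_scale +%R.
Proof. by move=> k b c; apply: multiplierP => a /=; rewrite scalerDr. Qed.

Lemma mult_scaleDl b : {morph mult_scale^~ b : k l / k + l}.
Proof. by move=> k l; apply: multiplierP => a /=; rewrite scalerDl. Qed.

HB.instance Definition _ := GRing.Zmodule_isLmodule.Build R[i] multiplier
  mult_scaleA mult_scale1 mult_scaleDr mult_scaleDl.

Lemma lmulD (b : multiplier) : {morph lmul b : u v / u + v}.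
Proof.
by move=> u v; have := lmul_linear b 1 u v; rewrite !scale1r.
Qed.

Lemma rmulD (b : multiplier) : {morph rmul b : u v / u + v}.
Proof.
by move=> u v; have := rmul_linear b 1 u v; rewrite !scale1r.
Qed.

Lemma lmul0 (b : multiplier) : lmul b 0 = 0.
Proof. by apply: (addrI (lmul b 0)); rewrite -lmulD !addr0. Qed.

Lemma rmul0 (b : multiplier) : rmul b 0 = 0.
Proof. by apply: (addrI (rmul b 0)); rewrite -rmulD !addr0. Qed.

Lemma lmulZ (b : multiplier) (k : R[i]) u : lmul b (k *: u) = k *: lmul b u.
Proof. by have := lmul_linear b k u 0; rewrite lmul0 !addr0. Qed.

Lemma rmulZ (b : multiplier) (k : R[i]) u : rmul b (k *: u) = k *: rmul b u.
Proof. by have := rmul_linear b k u 0; rewrite rmul0 !addr0. Qed.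

Lemma mult_mulA : associative mult_mul.
Proof. by move=> b c d; exact: multiplierP. Qed.

Lemma mult_mulDl : left_distributive mult_mul +%R.
Proof. by move=> b c d; apply: multiplierP => a //=; rewrite rmulD. Qed.

Lemma mult_mulDr : right_distributive mult_mul +%R.
Proof. by move=> b c d; apply: multiplierP => a //=; rewrite lmulD. Qed.

Lemma mult_mulZl (k : R[i]) (b c : multiplier) :
  mult_mul (k *: b) c = k *: mult_mul b c.
Proof. by apply: multiplierP => a //=; rewrite rmulZ. Qed.

Lemma mult_mulZr (k : R[i]) (b c : multiplier) :
  mult_mul b (k *: c) = k *: mult_mul b c.
Proof. by apply: multiplierP => a //=; rewrite lmulZ. Qed.

Lemma mult_starK : involutive mult_star.
Proof. by move=> b; apply: multiplierP => a /=; rewrite !astarK. Qed.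

Lemma mult_starD : {morph mult_star : b c / b + c}.
Proof. by move=> b c; apply: multiplierP => a /=; rewrite astarD. Qed.

Lemma mult_starZ (k : R[i]) (b : multiplier) :
  mult_star (k *: b) = k^* *: mult_star b.
Proof. by apply: multiplierP => a /=; rewrite astarZ. Qed.

Lemma mult_starM (b c : multiplier) :
  mult_star (mult_mul b c) = mult_mul (mult_star c) (mult_star b).
Proof. by apply: multiplierP => a /=; rewrite !astarK. Qed.

HB.instance Definition _ := isStarAlgebra.Build R multiplier
  mult_mulA mult_mulDl mult_mulDr mult_mulZl mult_mulZr
  mult_starK mult_starD mult_starZ mult_starM.

(* An alias of M(A) carrying the strict topology, which is generated by the
   seminorms [`|b a|] and [`|a b|] in [b], for [a] in A. *)

Definition strict : Type := multiplier.

HB.instance Definition _ := Choice.on strict.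

Definition strict_ball (b : strict) (s : seq A) (e : R) : set strict :=
  [set c : strict | forall a, a \in s ->
    `|lmul c a - lmul b a| < e%:C%C /\ `|rmul c a - rmul b a| < e%:C%C].

Definition strict_open (U : set strict) :=
  forall b, U b -> exists s (e : R), 0 < e /\ strict_ball b s e `<=` U.

Lemma strict_openT : strict_open setT.
Proof. by move=> b _; exists [::], 1; split. Qed.

Lemma strict_openI : setI_closed strict_open.
Proof.
move=> U V oU oV b [/oU[s [e [e0 sU]]] /oV[t [f [f0 tV]]]].
exists (s ++ t), (Num.min e f); split; first by rewrite lt_min e0.
move=> c st; split; [apply: sU | apply: tV] => a ain.
- have [|l r] := st a; first by rewrite mem_cat ain.
  by split; [apply: (lt_le_trans l) | apply: (lt_le_trans r)];
    rewrite lecR ge_min lexx.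
- have [|l r] := st a; first by rewrite mem_cat ain orbT.
  by split; [apply: (lt_le_trans l) | apply: (lt_le_trans r)];
    rewrite lecR ge_min lexx orbT.
Qed.

Lemma strict_open_bigU (I : Type) (f : I -> set strict) :
  (forall i, strict_open (f i)) -> strict_open (\bigcup_i f i).
Proof.
move=> of_ b [i _ /of_[s [e [e0 sf]]]]; exists s, e; split=> // c /sf fc.
by exists i.
Qed.

HB.instance Definition _ := isOpenTopological.Build strict
  strict_openT strict_openI strict_open_bigU.

End Multiplier.

Definition strictly_closed (R : realType) (A : cstarAlgType R)
    (S : set (multiplier A)) := closed (S : set (strict A)).

Definition ideal_tilde (R : realType) (A : cstarAlgType R) (J : set A) :
    set (multiplier A) :=
  [set b | forall a, J (lmul b a) /\ J (rmul b a)].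

Definition is_C0_algebra (R : realType) (A : cstarAlgType R)
    (X : topologicalType) (phi : prim A -> X) :=
  [/\ locally_compact [set: X], hausdorff_space X & continuous phi].

(* The Stone-Cech compactification, by its universal property. *)
Definition is_stone_cech (X bX : topologicalType) (iota : X -> bX) :=
  [/\ compact [set: bX], hausdorff_space bX, continuous iota &
    forall (K : topologicalType) (f : X -> K),
      compact [set: K] -> hausdorff_space K -> continuous f ->
      exists! g : bX -> K, continuous g /\ g \o iota = f].

(* [iota] is the map from X to beta X. For P in Prim(A), the ideal
   [ideal_tilde P] is primitive, hence equal to [prim_ideal Q] for exactly one
   Q; the set of these Q is dense, so that [phibar] is determined by [phi]. *)
Definition is_base_extension (R : realType) (A : cstarAlgType R)
    (X bX : topologicalType) (iota : X -> bX)
    (phi : prim A -> X) (phibar : prim (multiplier A) -> bX) :=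
  continuous phibar /\
  forall (P : prim A) (Q : prim (multiplier A)),
    prim_ideal Q = ideal_tilde (prim_ideal P) -> phibar Q = iota (phi P).

Section Conditions.
Variables (R : realType) (A : cstarAlgType R) (X : topologicalType).
Variables (phi : prim A -> X) (x : X).

Definition H_ideal (bX : topologicalType) (iota : X -> bX)
    (phibar : prim (multiplier A) -> bX) : set (multiplier A) :=
  ker_of (phibar @^-1` [set iota x]).

Definition fibre : set (prim A) := phi @^-1` [set x].

(* the quotient of A by the ideal I has an identity, namely the class of e *)
Definition unital_quotient (I : set A) :=
  exists e : A, forall a, I (e ⋅ a - a) /\ I (a ⋅ e - a).

(* Local modularity of the ideal J_x, the intersection of [fibre]. *)
Definition J_locally_modular :=
  forall P, (closure fibre `\` interior fibre) P ->
    exists V : set (prim A),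
      [/\ exists2 W, open W & V = W `\` interior fibre,
          V P & unital_quotient (ker_of V)].

Definition locally_closed_at :=
  forall Y : set (prim A), closed Y -> closure (phi @` Y) x -> (phi @` Y) x.

End Conditions.

(* Main.v *)
(* For P in Prim(A) let [tilde P] be the primitive ideal of M(A) lying over P. An
   approximate unit (e_n) of A shows that H_x is strictly closed if and only if it
   contains every b that lies in [tilde P] for all P over x.

   Suppose both conditions hold and such a b is not in some Q over x. Then
   b^* b <= t fails on an open set Y of primitive ideals of A whose image
   accumulates at x. As phi is locally closed at x, the closure of Y meets the fibre
   of x, and near such a point A has an identity modulo the relevant ideals, so
   that b may be replaced there by an element of J_x, whose norms are upper
   semicontinuous: b^* b <= t near x, a contradiction.

   If one of the conditions fails, put r_i = (e_{n(i+1)} - e_{n(i)})^(1/2). The strictly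
   convergent sum b of the r_i k_i r_i, with 0 <= k_i <= 1 in M(A) vanishing on the
   fibre of x, is bounded below at primitive ideals P whose images accumulate at x,
   and hence at some Q over x.

   Primitive ideals of M(A) come from a separation argument: if b^* b <= t + k for no k
   in a *-ideal K, then a functional that is extreme among those dominated by a
   suitable sublinear gauge gives an irreducible representation that kills K but
   not b. *)

Require Import Defs.
From HB Require Import structures.
From mathcomp Require Import all_boot all_order all_algebra.
From mathcomp Require Import all_classical all_reals all_analysis.
From mathcomp Require Import complex ring lra.

Set Implicit Arguments.
Unset Strict Implicit.
Unset Printing Implicit Defensive.

Import Order.TTheory GRing.Theory Num.Theory.
Import numFieldNormedType.Exports.

Local Open Scope classical_set_scope.
Local Open Scope ring_scope.

(** * Identities between sums of noncommutative monomials *)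

(** Norms in the quotients M(A)/[tilde P] are never formed. They are replaced by [small P b t], that
    is, b^* b <= t modulo [tilde P], and [small_excess] turns this into membership of the positive
    part of b^* b - t in [tilde P], so that semicontinuity becomes openness in the hull-kernel
    topology. The order on M(A) is defined by a norm inequality instead of spectra; roots, inverses
    and positive parts then come from norm-convergent iterations.

    The obstacle lies in the Q over x that contain A, about which nothing is known beforehand. They
    are reached through [germ_ideal], the multipliers that vanish over some neighbourhood of x:
    every primitive ideal containing it lies over x, and if b^* b <= t fails at points P whose
    images accumulate at x, the separation argument applies to this ideal. Since Prim(A) need be
    neither Hausdorff nor compact, continuous functions on it may fail to separate closed sets;
    [closed_separation] uses multipliers 1 - q instead, with q = (1 + l^2 / t^4)^-1 for a
    self-adjoint l that vanishes on one of the sets. *)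

Inductive zexpr := ZVar of nat | ZAdd of zexpr & zexpr | ZOpp of zexpr | ZZero.

Fixpoint zeval (V : zmodType) (env : seq V) e : V :=
  match e with
  | ZVar i => nth 0 env i
  | ZAdd a b => zeval env a + zeval env b
  | ZOpp a => - zeval env a
  | ZZero => 0
  end.

Fixpoint zcoef e i : int :=
  match e with
  | ZVar j => (i == j)%:Z
  | ZAdd a b => zcoef a i + zcoef b i
  | ZOpp a => - zcoef a i
  | ZZero => 0
  end.

(** Normal form: every expression is an integer combination of the atoms, and an index past the end
    of [env] contributes nothing. [zmodP] then decides an equality by comparing coefficients. *)
Lemma zevalE (V : zmodType) (env : seq V) e :
  zeval env e = \sum_(i < size env) nth 0 env i *~ zcoef e i.
Proof.
elim: e => [j|a IHa b IHb|a IH|] /=.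
- have [js|js] := ltnP j (size env).
    rewrite (bigD1 (Ordinal js))//= eqxx mulr1z big1 ?addr0// => i /negbTE.
    by rewrite -val_eqE /= => ->; rewrite mulr0z.
  rewrite nth_default// big1// => i _.
  by rewrite (ltn_eqF (leq_trans (ltn_ord i) js)) mulr0z.
- by rewrite IHa IHb -big_split/=; apply: eq_bigr => i _; rewrite mulrzDr.
- by rewrite IH -sumrN; apply: eq_bigr => i _; rewrite mulrNz.
- by rewrite big1// => i _; rewrite mulr0z.
Qed.

Lemma zmodP (V : zmodType) (env : seq V) a b :
  all (fun i => zcoef a i == zcoef b i) (iota 0 (size env)) ->
  zeval env a = zeval env b.
Proof.
move=> /allP ab; rewrite !zevalE; apply: eq_bigr => i _; congr (_ *~ _).
by apply/eqP/ab; rewrite mem_iota /= add0n.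
Qed.

(* The same product may be elaborated through different structures: compare operands. *)
Ltac zmod_same x y :=
  lazymatch constr:((x, y)) with
  | (?a, ?a) => constr:(true)
  | (@GRing.scale _ _ ?k ?u, @GRing.scale _ _ ?l ?v) =>
      lazymatch zmod_same k l with true => zmod_same u v | false => constr:(false) end
  | (@GRing.mul _ ?a ?b, @GRing.mul _ ?c ?d) =>
      lazymatch zmod_same a c with true => zmod_same b d | false => constr:(false) end
  | (@amul _ _ ?a ?b, @amul _ _ ?c ?d) =>
      lazymatch zmod_same a c with true => zmod_same b d | false => constr:(false) end
  | (@GRing.one _, @GRing.one _) => constr:(true)
  | _ => constr:(false)
  end.

Ltac zmod_index x env :=
  lazymatch env with
  | nil => constr:(@None nat)
  | ?y :: ?env' =>
      lazymatch zmod_same x y with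
      | true => constr:(Some O)
      | false => lazymatch zmod_index x env' with
                 | Some ?n => constr:(Some (S n))
                 | None => constr:(@None nat)
                 end
      end
  end.

Ltac zmod_env env t :=
  lazymatch t with
  | @GRing.add _ ?a ?b => let env1 := zmod_env env a in zmod_env env1 b
  | @GRing.opp _ ?a => zmod_env env a
  | @GRing.zero _ => env
  | _ => lazymatch zmod_index t env with
         | Some _ => env
         | None => constr:(t :: env)
         end
  end.

Ltac zmod_quote env t :=
  lazymatch t with
  | @GRing.add _ ?a ?b =>
      let a' := zmod_quote env a in let b' := zmod_quote env b in constr:(ZAdd a' b')
  | @GRing.opp _ ?a => let a' := zmod_quote env a in constr:(ZOpp a')
  | @GRing.zero _ => constr:(ZZero)
  | _ => lazymatch zmod_index t env with Some ?n => constr:(ZVar n) end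
  end.

Ltac zmod :=
  lazymatch goal with
  | |- @eq ?T ?a ?b =>
      let env0 := zmod_env (@nil T) a in
      let env := zmod_env env0 b in
      let a' := zmod_quote env a in
      let b' := zmod_quote env b in
      exact: (@zmodP _ env a' b' isT)
  end.

(** Once products are expanded, the monomials are opaque atoms, so no commutation is ever
    assumed. *)
Ltac ncring :=
  rewrite ?(mulrDl, mulrDr, mulrN, mulNr, mulrA, mul1r, mulr1, mul0r, mulr0); zmod.

(** * Bounded linear maps over the complex numbers *)

Section Modulus.
Variable R : realType.
Implicit Types k l : R[i].

(** Norms of complex spaces take values in [R[i]]. Their real parts [cm] and [nm] live in the
    ordered field [R], where suprema, [lra] and [nra] are available. *)
Definition cm k : R := complex.Re `|k|.

Lemma cmE k : ((cm k)%:C)%C = `|k|.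
Proof. exact: RRe_real (normr_real k). Qed.

Lemma cm_ge0 k : 0 <= cm k.
Proof. by rewrite -ler0c cmE. Qed.

Lemma cmM k l : cm (k * l) = cm k * cm l.
Proof. by apply: complexI; rewrite rmorphM/= !cmE normrM. Qed.

Lemma cmD k l : cm (k + l) <= cm k + cm l.
Proof. by rewrite -lecR rmorphD/= !cmE ler_normD. Qed.

Lemma cmN k : cm (- k) = cm k.
Proof. by rewrite /cm normrN. Qed.

Lemma cm_real (t : R) : cm (t%:C)%C = `|t|.
Proof. by rewrite /cm normc_def/= expr0n/= addr0 sqrtr_sqr. Qed.

Lemma cm_sqr k : cm k ^+ 2 = complex.Re k ^+ 2 + complex.Im k ^+ 2.
Proof. by rewrite /cm normc_def/= sqr_sqrtr// addr_ge0 ?sqr_ge0. Qed.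

Lemma cm0_eq0 k : cm k = 0 -> k = 0.
Proof. by move=> k0; apply/normr0_eq0; rewrite -cmE k0. Qed.

Lemma Re_cm k : complex.Re k <= cm k.
Proof.
rewrite (le_trans (ler_norm _))// -(ler_pXn2r (n := 2))// ?nnegrE ?cm_ge0//.
by rewrite cm_sqr real_normK ?num_real// lerDl sqr_ge0.
Qed.

End Modulus.

Section RealNorm.
Variables (R : realType) (V : normedModType R[i]).
Implicit Types (u v : V) (t : R).

Definition nm v : R := complex.Re `|v|.

Lemma nmE v : ((nm v)%:C)%C = `|v|.
Proof. by rewrite /nm RRe_real. Qed.

Lemma nm_ge0 v : 0 <= nm v.
Proof. by rewrite -ler0c nmE. Qed.

Lemma nm0 : nm 0 = 0.
Proof. by rewrite /nm normr0. Qed.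

Lemma nm0_eq0 v : nm v = 0 -> v = 0.
Proof. by move=> v0; apply/normr0_eq0; rewrite -nmE v0. Qed.

Lemma nm_gt0 v : v != 0 -> 0 < nm v.
Proof. by move=> v0; rewrite lt_def nm_ge0 andbT; apply: contra v0 => /eqP/nm0_eq0/eqP. Qed.

Lemma nmD u v : nm (u + v) <= nm u + nm v.
Proof. by rewrite -lecR rmorphD/= !nmE ler_normD. Qed.

Lemma nmN v : nm (- v) = nm v.
Proof. by rewrite /nm normrN. Qed.

Lemma nmB u v : nm (u - v) = nm (v - u).
Proof. by rewrite -nmN opprB. Qed.

Lemma nm_dist_tri w u v : nm (u - v) <= nm (u - w) + nm (w - v).
Proof. by rewrite (le_trans _ (nmD _ _))// addrA subrK. Qed.

Lemma nmZ (k : R[i]) v : nm (k *: v) = cm k * nm v.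
Proof.
by apply: complexI; rewrite nmE normrZ -cmE -nmE -rmorphM.
Qed.

Lemma nmZr t v : nm ((t%:C)%C *: v) = `|t| * nm v.
Proof.
by rewrite nmZ cm_real.
Qed.

Lemma nm_lt v (e : R) : (nm v < e) = (`|v| < (e%:C)%C).
Proof. by rewrite -nmE ltcR. Qed.

End RealNorm.

Section Vanish.
Variable R : realType.

(** Only an upper bound is asked for: the terms may be negative, and the property passes to any
    smaller sequence without a sign condition. *)
Definition vanish (eps : nat -> R) :=
  forall e : R, 0 < e -> exists n0, forall n, (n0 <= n)%N -> eps n < e.

Lemma vanish_le (f g : nat -> R) : (forall n, f n <= g n) -> vanish g -> vanish f.
Proof. by move=> fg vg e /vg[n0 h]; exists n0 => n /h; exact/le_lt_trans/fg. Qed.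

Lemma vanishD (f g : nat -> R) : vanish f -> vanish g -> vanish (fun n => f n + g n).
Proof.
move=> vf vg e e0; have e2 : 0 < e / 2 by lra.
have [n1 h1] := vf _ e2; have [n2 h2] := vg _ e2.
exists (maxn n1 n2) => n; rewrite geq_max => /andP[/h1 ? /h2 ?]; lra.
Qed.

Lemma vanishZ (c : R) (f : nat -> R) : 0 <= c -> vanish f -> vanish (fun n => c * f n).
Proof.
move=> c0 vf e e0; have [n0 h] := vf (e / (c + 1)) ltac:(apply: divr_gt0; lra).
exists n0 => n /h; rewrite ltr_pdivlMr ?ltr_wpDl// => fe.
have [f0|f0] := leP (f n) 0; nra.
Qed.

Lemma vanishZr (c : R) (f : nat -> R) : 0 <= c -> vanish f -> vanish (fun n => f n * c).
Proof.
by move=> c0 /(vanishZ c0); apply: vanish_le => n; rewrite mulrC.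
Qed.

(** The way in which exact statements are drawn from approximations below: the norm of a defect is a
    constant dominated by a vanishing sequence. *)
Lemma vanish_ge0 (c : R) (f : nat -> R) : vanish f -> (forall n, c <= f n) -> c <= 0.
Proof.
move=> vf cf; rewrite leNgt; apply/negP => /vf[n0 /(_ n0 (leqnn _))].
by rewrite ltNge cf.
Qed.

Lemma vanish_cvg (u : nat -> R) (l : R) :
  (u n @[n --> \oo] --> l)%classic -> vanish (fun n => `|l - u n|).
Proof.
move=> /cvgrPdist_lt ul e e0; have [n0 _ h] := ul e e0.
by exists n0 => n n0n; exact: h.
Qed.

Lemma vanish_invn : vanish (fun n => n.+1%:R^-1).
Proof.
move=> e e0; have [n0 _ h] := near_infty_natSinv_lt (PosNum e0).
by exists n0 => n n0n; exact: h.
Qed.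

End Vanish.

Lemma banach_complete (R : realType) (V : completeNormedModType R[i])
    (u : nat -> V) (eps : nat -> R) : vanish eps ->
    (forall n m, (n <= m)%N -> nm (u m - u n) <= eps n) ->
  exists l, forall n, nm (l - u n) <= eps n.
Proof.
move=> v_eps ueps.
have : cauchy (u n @[n --> \oo]).
  apply: cauchy_exP => e e0.
  have Ee : (((complex.Re e))%:C)%C = e by rewrite RRe_real ?gtr0_real.
  have [|n0 h] := v_eps (complex.Re e); first by rewrite -ltcR Ee.
  exists (u n0); exists n0 => // n n0n /=; rewrite -ball_normE /ball_/= -Ee -nm_lt nmB.
  exact: le_lt_trans (ueps _ _ n0n) (h _ (leqnn _)).
move=> /cauchy_cvg/cvg_ex[l /cvgrPdist_lt ul]; exists l => n.
apply/ler_addgt0Pr => e e0.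
have [|n1 _ h] := ul (e%:C)%C; first by rewrite ltcR.
have := h (maxn n1 n) (leq_maxl _ _); rewrite -nm_lt => h1.
rewrite (le_trans (nm_dist_tri (u (maxn n1 n)) _ _))// addrC lerD//.
  exact/ueps/leq_maxr.
exact: ltW.
Qed.

Section LinearFunctions.
Variables (K : pzRingType) (V W : lmodType K) (F : V -> W).
Hypothesis Flin : linear F.

Lemma linD u v : F (u + v) = F u + F v.
Proof. by have := Flin 1 u v; rewrite !scale1r. Qed.

Lemma lin0 : F 0 = 0.
Proof. by apply: (addrI (F 0)); rewrite -linD !addr0. Qed.

Lemma linZ k u : F (k *: u) = k *: F u.
Proof. by have := Flin k u 0; rewrite lin0 !addr0. Qed.

Lemma linN u : F (- u) = - F u.
Proof. by rewrite -scaleN1r linZ scaleN1r. Qed.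

Lemma linB u v : F (u - v) = F u - F v.
Proof. by rewrite linD linN. Qed.

End LinearFunctions.

Lemma bounded_linear_cont (R : realType) (V W : normedModType R[i]) (F : V -> W) (C : R) :
  linear F -> (forall v, nm (F v) <= C * nm v) -> continuous F.
Proof.
move=> Flin FC x; apply/cvgrPdist_lt => e e0.
have C1 : (0 : R[i]) < ((`|C| + 1)%:C)%C by rewrite ltcR ltr_wpDl.
near=> y; rewrite -(linB Flin) -nmE (@le_lt_trans _ _ ((`|C| + 1)%:C * `|x - y|)%C)//.
  rewrite -nmE -rmorphM lecR (le_trans (FC _))// ler_wpM2r ?nm_ge0//.
  by rewrite (le_trans (ler_norm C))// lerDl.
rewrite mulrC -ltr_pdivlMr//; near: y.
by apply: cvgr_dist_lt; rewrite ?divr_gt0.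
Unshelve. all: by end_near. Qed.

Lemma linear_cont_bounded (R : realType) (V W : normedModType R[i]) (F : V -> W) :
  linear F -> continuous F -> exists2 C : R, 0 <= C & forall v, nm (F v) <= C * nm v.
Proof.
move=> Flin Fcont; have F0 := lin0 Flin.
have /cvgrPdist_lt/(_ 1 ltr01) := Fcont 0.
move=> /nbhs_normP[e /= e0 h].
have Ee : (((complex.Re e))%:C)%C = e by rewrite RRe_real ?gtr0_real.
have re0 : 0 < complex.Re e by rewrite -ltcR Ee.
exists (2 / complex.Re e); first by rewrite divr_ge0// ltW.
move=> a; have [->|a0] := eqVneq a 0; first by rewrite F0 !nm0 mulr0.
have na : 0 < nm a by exact: nm_gt0.
pose s : R := complex.Re e / (2 * nm a).
have s0 : 0 < s by rewrite divr_gt0// mulr_gt0.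
have : nm (F ((s%:C)%C *: a)) < 1.
  rewrite nm_lt -[X in _ < X]/((1 : R)%:C)%C.
  have := h ((s%:C)%C *: a); rewrite F0 sub0r normrN; apply.
  rewrite /ball_/= sub0r normrN -Ee -nm_lt nmZr gtr0_norm//.
  rewrite /s invfM mulrA mulfVK ?gt_eqF//; lra.
rewrite (linZ Flin) nmZr gtr0_norm// => h1.
have -> : 2 / complex.Re e * nm a = s^-1.
  by rewrite /s invf_div mulrAC.
by rewrite -[s^-1]mulr1 -ler_pdivrMl ?invr_gt0// invrK; exact: ltW.
Qed.

(** * The multiplier algebra as a normed ring *)

Section MultiplierRing.
Variables (R : realType) (A : cstarAlgType R).

Lemma nmMa (a c : A) : nm (a ⋅ c) <= nm a * nm c.
Proof. by rewrite -lecR rmorphM /= !nmE ler_normMa. Qed.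

Program Definition mult1 : multiplier A := @Multiplier _ A id id _ _ _ _ _ _ _.
Next Obligation. by []. Qed.
Next Obligation. by []. Qed.
Next Obligation. by move=> a U. Qed.
Next Obligation. by move=> a U. Qed.
Next Obligation. by []. Qed.
Next Obligation. by []. Qed.
Next Obligation. by []. Qed.

Lemma mult_mul1 : left_id mult1 (@mult_mul R A).
Proof. by move=> b; exact: multiplierP. Qed.

Lemma mult_mulr1 : right_id mult1 (@mult_mul R A).
Proof. by move=> b; exact: multiplierP. Qed.

HB.instance Definition _ := GRing.Zmodule_isPzRing.Build (multiplier A)
  (@mult_mulA R A) mult_mul1 mult_mulr1 (@mult_mulDl R A) (@mult_mulDr R A).

(** The canonical embedding of A as an ideal of M(A). *)
Program Definition mult_in (a : A) : multiplier A :=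
  @Multiplier _ A (fun c => a ⋅ c) (fun c => c ⋅ a) _ _ _ _ _ _ _.
Next Obligation. by move=> a k u v /=; rewrite amulDr amulZr. Qed.
Next Obligation. by move=> a k u v /=; rewrite amulDl amulZl. Qed.
Next Obligation.
move=> a; apply: (@bounded_linear_cont _ _ _ _ (nm a)) => [k u v|v].
  by rewrite amulDr amulZr.
exact: nmMa.
Qed.
Next Obligation.
move=> a; apply: (@bounded_linear_cont _ _ _ _ (nm a)) => [k u v|v].
  by rewrite amulDl amulZl.
by rewrite mulrC nmMa.
Qed.
Next Obligation. by move=> a c d /=; rewrite amulA. Qed.
Next Obligation. by move=> a c d /=; rewrite amulA. Qed.
Next Obligation. by move=> a c d /=; rewrite amulA. Qed.

End MultiplierRing.

Notation "b ^*s" := (astar b) (at level 2, format "b ^*s") : ring_scope.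

(** * The C^*-norm of the multiplier algebra and pointwise limits of multipliers *)

Section MultiplierNorm.
Variables (R : realType) (A : cstarAlgType R).
Notation MA := (multiplier A).
Implicit Types (a : A) (b c : MA) (s : R).

Lemma nm_star (a : A) : nm a^*s = nm a.
Proof. by rewrite /nm norm_astar. Qed.

Lemma nm_Cstar (a : A) : nm (a^*s ⋅ a) = nm a ^+ 2.
Proof. by apply: complexI; rewrite nmE normCstar rmorphXn/= nmE. Qed.

Lemma lmul_bounded b : exists2 C : R, 0 <= C & forall a, nm (lmul b a) <= C * nm a.
Proof.
exact: linear_cont_bounded (@lmul_linear _ _ b) (@lmul_continuous _ _ b).
Qed.

Definition mbounds b : set R := [set C | 0 <= C /\ forall a, nm (lmul b a) <= C * nm a].
(** The C^*-norm of M(A), taken from the left action alone; [nm_rmul] shows that the right action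
    obeys the same bound. *)
Definition N b : R := inf (mbounds b).

Lemma N_has_inf b : has_inf (mbounds b).
Proof.
split; first by have [C C0 h] := lmul_bounded b; exists C.
by exists 0 => C [].
Qed.

Lemma N_ge0 b : 0 <= N b.
Proof. by apply: lb_le_inf => [|C []//]; exact: (N_has_inf b).1. Qed.

Lemma N_le b (C : R) : 0 <= C -> (forall a, nm (lmul b a) <= C * nm a) -> N b <= C.
Proof. by move=> C0 h; apply: ge_inf => //; exact: (N_has_inf b).2. Qed.

Lemma N_lmul b a : nm (lmul b a) <= N b * nm a.
Proof.
have [->|a0] := eqVneq a 0; first by rewrite lmul0 !nm0 mulr0.
have na : 0 < nm a by exact: nm_gt0.
rewrite -ler_pdivrMr//; apply: lb_le_inf; first exact: (N_has_inf b).1.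
by move=> C [C0 h]; rewrite ler_pdivrMr.
Qed.

Lemma N0 : N 0 = 0.
Proof.
by apply/eqP; rewrite eq_le N_ge0 N_le// => a; rewrite mul0r nm0.
Qed.

(** The right action vanishes with the left one: c = [rmul b a] satisfies c c^* = a [lmul b] c^* =
    0. *)
Lemma N0_eq0 b : N b = 0 -> b = 0.
Proof.
move=> b0; have l0 a : lmul b a = 0.
  by apply/nm0_eq0/eqP; rewrite eq_le nm_ge0 (le_trans (N_lmul _ _))// b0 mul0r.
apply: multiplierP => a /=; first exact: l0.
apply/nm0_eq0/eqP; rewrite eq_le nm_ge0 andbT -(ler_pXn2r (n := 2))// ?nnegrE ?nm_ge0//.
by rewrite expr0n -nm_star -nm_Cstar astarK rlmul l0 amul0r nm0.
Qed.

Lemma ND b c : N (b + c) <= N b + N c.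
Proof.
apply: N_le => [|a]; first by rewrite addr_ge0 ?N_ge0.
by rewrite mulrDl (le_trans (nmD _ _))// lerD ?N_lmul.
Qed.

Lemma NN b : N (- b) = N b.
Proof.
by congr inf; apply/funext => C; congr (_ /\ _); apply: propext; split => h a; have := h a; rewrite nmN.
Qed.

Lemma NB b c : N (b - c) = N (c - b).
Proof. by rewrite -NN opprB. Qed.

Lemma N_dist_tri d b c : N (b - c) <= N (b - d) + N (d - c).
Proof. by rewrite (le_trans _ (ND _ _))// addrA subrK. Qed.

Lemma NM b c : N (b * c) <= N b * N c.
Proof.
apply: N_le => [|a]; first by rewrite mulr_ge0 ?N_ge0.
by rewrite (le_trans (N_lmul b _))// -mulrA ler_wpM2l ?N_ge0// N_lmul.
Qed.

Lemma N1 : N 1 <= 1.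
Proof. by apply: N_le => // a; rewrite mul1r. Qed.

Lemma mul_star_lmul b a : (lmul b a)^*s ⋅ lmul b a = a^*s ⋅ lmul (b^*s * b) a.
Proof.
have -> : (lmul b a)^*s = rmul b^*s a^*s by rewrite /= astarK.
by rewrite rlmul.
Qed.

(** The C^*-identity is inherited from A: the square of the norm of [lmul b a] is the norm of a^*
    (b^* b a), hence at most N (b^* b) times the square of the norm of a. *)
Lemma N_sqr_le b : N b ^+ 2 <= N (b^*s * b).
Proof.
rewrite -[leRHS]sqr_sqrtr ?N_ge0// ler_pXn2r ?nnegrE ?N_ge0 ?sqrtr_ge0//.
apply: N_le => [|a]; first exact: sqrtr_ge0.
rewrite -(ler_pXn2r (n := 2))// ?nnegrE ?mulr_ge0 ?nm_ge0 ?sqrtr_ge0//.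
rewrite exprMn sqr_sqrtr ?N_ge0// -nm_Cstar mul_star_lmul (le_trans (nmMa _ _))//.
by rewrite nm_star expr2 mulrCA ler_wpM2l ?nm_ge0// N_lmul.
Qed.

Lemma N_star b : N b^*s = N b.
Proof.
have h c : N c <= N c^*s.
  have [c0|c0] := eqVneq (N c) 0; first by rewrite c0 N_ge0.
  have := le_trans (N_sqr_le c) (NM _ _); rewrite expr2 ler_pM2r//.
  by rewrite lt_def c0 N_ge0.
by apply/eqP; rewrite eq_le -{2}[b]astarK !h.
Qed.

Lemma N_Cstar b : N (b^*s * b) = N b ^+ 2.
Proof. by apply/eqP; rewrite eq_le N_sqr_le andbT (le_trans (NM _ _))// N_star. Qed.

Lemma nm_rmul b a : nm (rmul b a) <= N b * nm a.
Proof.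
rewrite -nm_star -N_star -[nm a]nm_star.
by have := N_lmul b^*s a^*s; rewrite /= astarK.
Qed.

Lemma mult_inE a : N (mult_in a) = nm a.
Proof.
apply/eqP; rewrite eq_le N_le ?nm_ge0//=; last by move=> c; exact: nmMa.
have [->|a0] := eqVneq a 0; first by rewrite nm0 N_ge0.
have na : 0 < nm a by exact: nm_gt0.
have := N_lmul (mult_in a) a^*s; rewrite /= -{1}[a]astarK nm_Cstar nm_star.
by rewrite expr2 ler_pM2r.
Qed.

Lemma astar0 (B : starAlgType R) : (0 : B)^*s = 0.
Proof. by rewrite -(scale0r 0) astarZ rmorph0 !scale0r. Qed.

(** Completeness of M(A) under pointwise convergence of both actions, with a rate [eps a] for each
    a. Every identity required of a multiplier passes to the limit because its defect is dominated
    by a vanishing sequence; the uniform bound C gives continuity. Norm completeness and the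
    strictly convergent series both come from here. *)
Lemma mult_lim (S : nat -> MA) (C : R) (eps : A -> nat -> R) :
    (forall n, N (S n) <= C) -> (forall a, vanish (eps a)) ->
    (forall a n m, (n <= m)%N -> nm (lmul (S m) a - lmul (S n) a) <= eps a n /\
                             nm (rmul (S m) a - rmul (S n) a) <= eps a n) ->
  exists b, forall a n, nm (lmul b a - lmul (S n) a) <= eps a n /\
                    nm (rmul b a - rmul (S n) a) <= eps a n.
Proof.
move=> SC veps Seps.
have /choice[l lP] a : exists l, forall n, nm (l - lmul (S n) a) <= eps a n.
  by apply: (@banach_complete R A (fun n => lmul (S n) a) (eps a) (veps a)) => n m nm; have [] := Seps a n m nm.
have /choice[r rP] a : exists l, forall n, nm (l - rmul (S n) a) <= eps a n.
  by apply: (@banach_complete R A (fun n => rmul (S n) a) (eps a) (veps a)) => n m nm; have [] := Seps a n m nm.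
have null (u : A) (f : nat -> R) : vanish f -> (forall n, nm u <= f n) -> u = 0.
  move=> vf uf; apply: nm0_eq0; apply/eqP; rewrite eq_le nm_ge0 andbT.
  exact: vanish_ge0 uf.
have C0 : 0 <= C by rewrite (le_trans _ (SC 0)) ?N_ge0.
have klin (F : A -> A) (G : nat -> A -> A) : (forall n, linear (G n)) ->
    (forall a n, nm (F a - G n a) <= eps a n) -> linear F.
  move=> Glin FG k u v; apply/eqP; rewrite -subr_eq0; apply/eqP.
  apply: (null _ (fun n => eps (k *: u + v) n + cm k * eps u n + eps v n)).
    by apply/vanishD/veps/vanishD/vanishZ/veps; [exact: veps|exact: cm_ge0].
  move=> n; have -> : F (k *: u + v) - (k *: F u + F v) =
     (F (k *: u + v) - G n (k *: u + v)) + (- (k *: (F u - G n u))) + - (F v - G n v).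
    have -> : G n (k *: u + v) = k *: G n u + G n v := Glin n k u v.
    by rewrite scalerBr; zmod.
  rewrite (le_trans (nmD _ _))// lerD ?nmN// (le_trans (nmD _ _))// lerD// nmN nmZ.
  by rewrite ler_wpM2l// cm_ge0.
have klip (F : A -> A) (G : nat -> A -> A) : (forall a n, nm (G n a) <= C * nm a) ->
    (forall a n, nm (F a - G n a) <= eps a n) -> linear F -> continuous F.
  move=> GC FG Flin.
  have FC a : nm (F a) <= C * nm a.
    rewrite -subr_le0; apply: vanish_ge0 (veps a) _ => n.
    rewrite lerBlDr (le_trans _ (lerD (FG a n) (GC a n)))//.
    by rewrite (le_trans _ (nmD _ _))// subrK.
  exact: bounded_linear_cont FC.
have llin : linear l by apply: (klin l (fun n => lmul (S n))) => // n; exact: lmul_linear.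
have rlin : linear r by apply: (klin r (fun n => rmul (S n))) => // n; exact: rmul_linear.
have lcont : continuous l.
  apply: (klip l (fun n => lmul (S n))) => // a n.
  by rewrite (le_trans (N_lmul _ _))// ler_wpM2r ?nm_ge0.
have rcont : continuous r.
  apply: (klip r (fun n => rmul (S n))) => // a n.
  by rewrite (le_trans (nm_rmul _ _))// ler_wpM2r ?nm_ge0.
have lM (a c : A) : l (a ⋅ c) = l a ⋅ c.
  apply/eqP; rewrite -subr_eq0; apply/eqP.
  apply: (null _ (fun n => eps (a ⋅ c) n + eps a n * nm c)).
    by apply: vanishD; [exact: veps|apply: vanishZr; rewrite ?nm_ge0].
  move=> n; rewrite (le_trans (nm_dist_tri (lmul (S n) (a ⋅ c)) _ _))// lerD//.
  rewrite lmulM -amulNl -amulDl (le_trans (nmMa _ _))// ler_wpM2r ?nm_ge0//.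
  by rewrite nmB.
have rM (a c : A) : r (a ⋅ c) = a ⋅ r c.
  apply/eqP; rewrite -subr_eq0; apply/eqP.
  apply: (null _ (fun n => eps (a ⋅ c) n + nm a * eps c n)).
    by apply: vanishD; [exact: veps|apply: vanishZ; rewrite ?nm_ge0].
  move=> n; rewrite (le_trans (nm_dist_tri (rmul (S n) (a ⋅ c)) _ _))// lerD//.
  rewrite rmulM -amulNr -amulDr (le_trans (nmMa _ _))// ler_wpM2l ?nm_ge0//.
  by rewrite nmB.
have rl (a c : A) : r a ⋅ c = a ⋅ l c.
  apply/eqP; rewrite -subr_eq0; apply/eqP.
  apply: (null _ (fun n => eps a n * nm c + nm a * eps c n)).
    by apply: vanishD; [apply: vanishZr|apply: vanishZ]; rewrite ?nm_ge0.
  move=> n; rewrite (le_trans (nm_dist_tri (rmul (S n) a ⋅ c) _ _))// lerD//.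
    by rewrite -amulNl -amulDl (le_trans (nmMa _ _))// ler_wpM2r ?nm_ge0.
  rewrite rlmul -amulNr -amulDr (le_trans (nmMa _ _))// ler_wpM2l ?nm_ge0//.
  by rewrite nmB.
by exists (Multiplier llin rlin lcont rcont lM rM rl) => a n; split=> /=.
Qed.

End MultiplierNorm.

(** * Positive multipliers *)

Section MultiplierOrder.
Variables (R : realType) (A : cstarAlgType R).
Notation MA := (multiplier A).
Implicit Types (a b c d h k v : MA) (s t : R).

Definition rs t : MA := (t%:C)%C *: (1 : MA).

Lemma rsE t b : rs t * b = (t%:C)%C *: b.
Proof. by apply: multiplierP => u /=; rewrite ?rmulZ. Qed.

Lemma rsC t b : rs t * b = b * rs t.
Proof. by rewrite rsE; apply: multiplierP => u /=; rewrite ?lmulZ. Qed.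

Lemma rsD s t : rs (s + t) = rs s + rs t.
Proof. by rewrite /rs rmorphD scalerDl. Qed.

Lemma rsN t : rs (- t) = - rs t.
Proof. by rewrite /rs rmorphN scaleNr. Qed.

Lemma rsB s t : rs (s - t) = rs s - rs t.
Proof. by rewrite rsD rsN. Qed.

Lemma rsM s t : rs (s * t) = rs s * rs t.
Proof. by rewrite rsE /rs rmorphM scalerA. Qed.

Lemma rs1 : rs 1 = 1.
Proof. by rewrite /rs scale1r. Qed.

Lemma rs0 : rs 0 = 0.
Proof. by rewrite /rs scale0r. Qed.

Lemma rsK t b : t != 0 -> rs t * (rs t^-1 * b) = b.
Proof. by move=> t0; rewrite mulrA -rsM divff// rs1 mul1r. Qed.

Lemma rsVK t b : t != 0 -> rs t^-1 * (rs t * b) = b.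
Proof. by move=> t0; rewrite mulrA -rsM mulVf// rs1 mul1r. Qed.

Lemma rsCA t b c : b * (rs t * c) = rs t * (b * c).
Proof. by rewrite mulrA -rsC mulrA. Qed.

Definition iu : MA := ('i%C : R[i]) *: (1 : MA).

Lemma iuE b : iu * b = ('i%C : R[i]) *: b.
Proof. by apply: multiplierP => u /=; rewrite ?rmulZ. Qed.

Lemma iuC b : iu * b = b * iu.
Proof. by rewrite iuE; apply: multiplierP => u /=; rewrite ?lmulZ. Qed.

Lemma iu2 : iu * iu = -1.
Proof. by rewrite iuE /iu scalerA -expr2 sqr_i scaleN1r. Qed.

Lemma rsMM s t b c : (rs s * b) * (rs t * c) = rs (s * t) * (b * c).
Proof. by rewrite -mulrA rsCA mulrA -rsM. Qed.

Lemma iuMM b c : (iu * b) * (iu * c) = - (b * c).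
Proof. by rewrite -mulrA [b * _]mulrA -iuC -mulrA mulrA iu2 mulN1r. Qed.

Lemma mstarD b c : (b + c)^*s = b^*s + c^*s.
Proof. exact: astarD. Qed.

Lemma mstarM b c : (b * c)^*s = c^*s * b^*s.
Proof. exact: astarM. Qed.

Lemma mstarN b : (- b)^*s = - b^*s.
Proof. by rewrite -scaleN1r astarZ rmorphN rmorph1 scaleN1r. Qed.

Lemma mstarB b c : (b - c)^*s = b^*s - c^*s.
Proof. by rewrite mstarD mstarN. Qed.

Lemma mstar1 : (1 : MA)^*s = 1.
Proof. by rewrite -[LHS]mul1r -{1}[1]astarK -mstarM mul1r astarK. Qed.

Lemma mstar_rs t : (rs t)^*s = rs t.
Proof. by rewrite astarZ mstar1; congr (_ *: _); exact: conjc_real. Qed.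

Lemma mstar_iu : iu^*s = - iu.
Proof.
by rewrite astarZ mstar1 /iu -scaleNr; congr (_ *: _); apply/eqP; rewrite eq_complex/= oppr0 !eqxx.
Qed.

Lemma mstarZ t b : (rs t * b)^*s = rs t * b^*s.
Proof. by rewrite mstarM mstar_rs -rsC. Qed.

Lemma N_rs t : N (rs t) <= `|t|.
Proof.
by apply: N_le => // u /=; rewrite nmZr.
Qed.

Lemma N_rsM t b : N (rs t * b) <= `|t| * N b.
Proof. by rewrite (le_trans (NM _ _))// ler_wpM2r ?N_ge0// N_rs. Qed.

Lemma N_complete (S : nat -> MA) (eps : nat -> R) : vanish eps ->
    (forall n m, (n <= m)%N -> N (S m - S n) <= eps n) ->
  exists b, forall n, N (b - S n) <= eps n.
Proof.
move=> veps Seps.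
have [n||u n m nlem|b bP] := @mult_lim R A S (N (S 0%N) + eps 0%N) (fun u n => eps n * nm u).
- by rewrite -[S n](subrK (S 0%N)) (le_trans (ND _ _))// addrC lerD// Seps.
- by move=> u; apply: vanishZr => //; exact: nm_ge0.
- have h : forall c, N c <= eps n -> nm (lmul c u) <= eps n * nm u /\ nm (rmul c u) <= eps n * nm u.
    move=> c cn; split; [apply: le_trans (N_lmul _ _) _|apply: le_trans (nm_rmul _ _) _];
      by rewrite ler_wpM2r// nm_ge0.
  exact: h (Seps _ _ nlem).
exists b => n; apply: N_le.
  by rewrite (le_trans (N_ge0 _) (Seps n n (leqnn n))).
by move=> u; have [] := bP u n.
Qed.

Lemma N_vanish b (f : nat -> R) : vanish f -> (forall n, N b <= f n) -> b = 0.
Proof.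
move=> vf bf; apply: N0_eq0; apply/eqP; rewrite eq_le N_ge0 andbT.
exact: vanish_ge0 bf.
Qed.

(** A fixed point y = (a + y^2) / 2 satisfies (1 - y)^2 = 1 - a. The same iteration at the number 1,
    [sqrt_bound], majorizes it and covers the boundary case N a = 1. *)
Fixpoint sqrt_iter a n : MA :=
  if n is n'.+1 then rs 2^-1 * (a + sqrt_iter a n' * sqrt_iter a n') else 0.

Fixpoint sqrt_bound n : R :=
  if n is n'.+1 then 2^-1 * (1 + sqrt_bound n' * sqrt_bound n') else 0.

Lemma sqrt_bound01 n : 0 <= sqrt_bound n <= 1.
Proof. by elim: n => [|n /andP[? ?]] /=; rewrite ?lexx ?ler01//; apply/andP; split; nra. Qed.

Lemma sqrt_bound_mono n : sqrt_bound n <= sqrt_bound n.+1.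
Proof. by have /andP[? ?] := sqrt_bound01 n; rewrite /=; nra. Qed.

(** For d = 1 - [sqrt_bound n] the recursion reads d' = d - d^2 / 2, and (n + 2) d <= 2 is preserved
    by it. *)
Lemma sqrt_bound_cvg n : 1 - sqrt_bound n <= 2 * n.+1%:R^-1.
Proof.
suff h : (1 - sqrt_bound n) * n.+2%:R <= 2.
  rewrite -ler_pdivlMr// in h; rewrite (le_trans h)// ler_wpM2l// lef_pV2 ?posrE//.
  by rewrite ler_nat.
elim: n => [|n IH] /=; first by lra.
have /andP[p0 p1] := sqrt_bound01 n.
rewrite -[n.+3%:R]natr1; rewrite -[n.+2%:R]natr1 in IH *.
have n0 : 0 <= n%:R :> R by [].
rewrite -[n.+1%:R]natr1 in IH *.
move: (n%:R) (sqrt_bound n) IH p0 p1 n0 => x p IH p0 p1 x0.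
have : (1 - p) * (1 + p) * (x + 1 + 1 + 1) <= 4; last by nra.
have e1 : (1 + p) * (x + 1 + 1 ) <= 2 * (x + 1 + 1) - (1 - p) * (x + 1 + 1) by nra.
nra.
Qed.

Lemma sqrt_iter_comm a c n : c * a = a * c -> c * sqrt_iter a n = sqrt_iter a n * c.
Proof.
move=> ca; elim: n => [|n IH] /=; first by rewrite mulr0 mul0r.
by rewrite rsCA -mulrA mulrDr mulrDl ca mulrA IH -mulrA IH mulrA.
Qed.

Lemma sqrt_iter_herm a n : a^*s = a -> (sqrt_iter a n)^*s = sqrt_iter a n.
Proof.
move=> ha; elim: n => [|n IH] /=; first by rewrite astar0.
by rewrite mstarZ mstarD mstarM IH ha.
Qed.

Lemma sqrt_iter_N a n : N a <= 1 -> N (sqrt_iter a n) <= sqrt_bound n.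
Proof.
move=> a1; elim: n => [|n IH] /=; first by rewrite N0.
rewrite (le_trans (N_rsM _ _))// ger0_norm// ler_wpM2l// (le_trans (ND _ _))// lerD//.
by rewrite (le_trans (NM _ _))// ler_pM// N_ge0.
Qed.

(** The iterates commute, so the increment y'' - y' factors as (y' - y) (y' + y) / 2. The scalar
    majorant obeys the same recursion, and the bounds telescope. *)
Lemma sqrt_iter_step a n : N a <= 1 ->
  N (sqrt_iter a n.+1 - sqrt_iter a n) <= sqrt_bound n.+1 - sqrt_bound n.
Proof.
move=> a1; elim: n => [|n IH].
  by rewrite /= !mulr0 !addr0 !subr0 mulr1 (le_trans (N_rsM _ _))// ger0_norm// ler_piMr.
have yy : sqrt_iter a n * sqrt_iter a n.+1 = sqrt_iter a n.+1 * sqrt_iter a n.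
  by apply: sqrt_iter_comm; apply/esym/sqrt_iter_comm.
have -> : sqrt_iter a n.+2 - sqrt_iter a n.+1 = rs 2^-1 *
    ((sqrt_iter a n.+1 - sqrt_iter a n) * (sqrt_iter a n.+1 + sqrt_iter a n)).
  have -> : (sqrt_iter a n.+1 - sqrt_iter a n) * (sqrt_iter a n.+1 + sqrt_iter a n) =
    (a + sqrt_iter a n.+1 * sqrt_iter a n.+1) - (a + sqrt_iter a n * sqrt_iter a n).
    by rewrite mulrDr !mulrBl yy; zmod.
  by rewrite mulrBr.
rewrite (le_trans (N_rsM _ _))// ger0_norm//.
have -> : sqrt_bound n.+2 - sqrt_bound n.+1 = 2^-1 *
    ((sqrt_bound n.+1 - sqrt_bound n) * (sqrt_bound n.+1 + sqrt_bound n)).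
  by move=> /=; ring.
rewrite ler_wpM2l// (le_trans (NM _ _))// ler_pM ?N_ge0// (le_trans (ND _ _))//.
by rewrite lerD// sqrt_iter_N.
Qed.

Lemma sqrt_iter_dist a n m : N a <= 1 -> (n <= m)%N ->
  N (sqrt_iter a m - sqrt_iter a n) <= sqrt_bound m - sqrt_bound n.
Proof.
move=> a1; elim: m => [|m IH]; first by rewrite leqn0 => /eqP->; rewrite !subrr N0.
rewrite leq_eqVlt => /orP[/eqP->|/IH nm]; first by rewrite !subrr N0.
rewrite (le_trans (N_dist_tri (sqrt_iter a m) _ _))//.
rewrite (le_trans (lerD (sqrt_iter_step m a1) nm))//.
by rewrite addrA subrK.
Qed.

Lemma sqrt_exists a : N a <= 1 -> exists y,
  [/\ N y <= 1, (1 - y) * (1 - y) = 1 - a,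
      a^*s = a -> y^*s = y & forall c, c * a = a * c -> c * y = y * c].
Proof.
move=> a1.
have veps : vanish (fun n => 1 - sqrt_bound n).
  apply: (@vanish_le _ _ _ sqrt_bound_cvg); apply: vanishZ => //; exact: vanish_invn.
have [n m nm|y yP] := @N_complete (sqrt_iter a) _ veps.
  rewrite (le_trans (sqrt_iter_dist a1 nm))// lerD2r.
  by have /andP[] := sqrt_bound01 m.
have y1 : N y <= 1.
  have := le_trans (ND (y - sqrt_iter a 0) (sqrt_iter a 0)) (lerD (yP 0%N) (sqrt_iter_N 0 a1)).
  by rewrite !subrK.
exists y; split=> //.
- apply/eqP; rewrite -subr_eq0; apply/eqP.
  apply: (@N_vanish _ (fun n => 2 * ((1 - sqrt_bound n) + (1 - sqrt_bound n)))).
    by apply: vanishZ => //; exact: vanishD.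
  move=> n; set z := sqrt_iter a n.
  have -> : (1 - y) * (1 - y) - (1 - a) =
      - (rs 2 * (y - sqrt_iter a n.+1)) + (y * (y - z) + (y - z) * z).
    rewrite /= -/z [rs 2 * (_ - _)]mulrBr rsK ?pnatr_eq0//.
    have -> : rs 2 * y = y + y by rewrite -[2]/(1 + 1) rsD rs1 mulrDl mul1r.
    by ncring.
  have N1y : N (y - sqrt_iter a n.+1) <= 1 - sqrt_bound n.
    rewrite (le_trans (yP n.+1))// lerB//; exact: sqrt_bound_mono.
  have z1 : N z <= 1.
    rewrite (le_trans (sqrt_iter_N n a1))//; by have /andP[] := sqrt_bound01 n.
  rewrite [leRHS]mulrDr (le_trans (ND _ _))// lerD//.
    by rewrite NN (le_trans (N_rsM _ _))// ger0_norm// ler_wpM2l.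
  have b0 : 0 <= 1 - sqrt_bound n by rewrite (le_trans (N_ge0 _) (yP n)).
  have := yP n; rewrite -/z => yz.
  rewrite (le_trans (ND _ _))// mulr_natl mulr2n lerD// (le_trans (NM _ _))//.
    by rewrite -[leRHS]mul1r ler_pM ?N_ge0.
  by rewrite -[leRHS]mulr1 ler_pM ?N_ge0.
- move=> ha; apply/eqP; rewrite -subr_eq0; apply/eqP.
  apply: (@N_vanish _ (fun n => (1 - sqrt_bound n) + (1 - sqrt_bound n))).
    exact: vanishD.
  move=> n; rewrite (le_trans (N_dist_tri (sqrt_iter a n) _ _))// lerD//.
    by rewrite -{1}(sqrt_iter_herm n ha) -mstarB N_star.
  by rewrite NB.
- move=> c ca; apply/eqP; rewrite -subr_eq0; apply/eqP.
  apply: (@N_vanish _ (fun n => N c * (1 - sqrt_bound n) + (1 - sqrt_bound n) * N c)).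
    by apply: vanishD; [apply: vanishZ|apply: vanishZr]; rewrite ?N_ge0.
  move=> n; have -> : c * y - y * c = c * (y - sqrt_iter a n) + (sqrt_iter a n - y) * c.
    by rewrite mulrBr mulrBl (sqrt_iter_comm n ca); zmod.
  rewrite (le_trans (ND _ _))// lerD// (le_trans (NM _ _))//.
    by rewrite ler_wpM2l ?N_ge0.
  by rewrite ler_wpM2r ?N_ge0// NB.
Qed.

Lemma N_sqr_herm h : h^*s = h -> N (h * h) = N h ^+ 2.
Proof. by move=> hh; rewrite -{1}hh N_Cstar. Qed.

(** For self-adjoint b the inequality says that the spectrum lies in [0, 2t]. In this form sums are
    handled by the triangle inequality and roots by [sqrt_exists]; the price is that positivity of
    v^* v becomes a theorem, [pos_sqr]. *)
Definition pos b := b^*s = b /\ exists2 t, 0 <= t & N (rs t - b) <= t.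

Lemma pos_herm b : pos b -> b^*s = b.
Proof. by case. Qed.

Lemma posD b c : pos b -> pos c -> pos (b + c).
Proof.
move=> [hb [s s0 bs]] [hc [t t0 ct]]; split; first by rewrite mstarD hb hc.
exists (s + t); first exact: addr_ge0.
have -> : rs (s + t) - (b + c) = (rs s - b) + (rs t - c) by rewrite rsD; zmod.
by rewrite (le_trans (ND _ _))// lerD.
Qed.

Lemma pos_bound b s t : N (rs s - b) <= s -> s <= t -> N (rs t - b) <= t.
Proof.
move=> bs st; have -> : rs t - b = rs (t - s) + (rs s - b) by rewrite rsB; zmod.
rewrite (le_trans (ND _ _))// -[leRHS](subrK s) lerD//.
by rewrite (le_trans (N_rs _))// ger0_norm// subr_ge0.
Qed.

Lemma N_pos_sub b t : b^*s = b -> N b <= t -> pos (rs t - b).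
Proof.
move=> hb bt; split; first by rewrite mstarB mstar_rs hb.
exists t; first exact: le_trans (N_ge0 b) bt.
by rewrite opprB addrC subrK.
Qed.

Lemma pos_rs t : 0 <= t -> pos (rs t).
Proof.
by move=> t0; rewrite -[rs t]subr0; apply: N_pos_sub; rewrite ?astar0 ?N0.
Qed.

Lemma pos0 : pos 0.
Proof. by rewrite -rs0; exact: pos_rs. Qed.

Lemma pos1 : pos 1.
Proof. by rewrite -rs1; exact: pos_rs. Qed.

Lemma pos_sqrt b : pos b -> exists k,
  [/\ pos k, k * k = b & forall c, c * b = b * c -> c * k = k * c].
Proof.
(* Adding 1 makes t positive, so that a' = (t - b) / t makes sense; the iteration then yields (1 -
   y)^2 = b / t. *)
move=> [hb [s s0 bs]]; pose t := s + 1; have t0 : 0 < t by rewrite ltr_wpDl.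
have st : s <= t by rewrite lerDl.
have := pos_bound bs st; set a := rs t - b => at1.
pose a' := rs t^-1 * a.
have a1 : N a' <= 1.
  by rewrite (le_trans (N_rsM _ _))// gtr0_norm ?invr_gt0// ler_pdivrMl// mulr1.
have [y [y1 yy yh yc]] := sqrt_exists a1.
have ha : a'^*s = a' by rewrite mstarZ mstarB mstar_rs hb.
exists (rs (Num.sqrt t) * (1 - y)); split.
- split; first by rewrite mstarZ mstarB mstar1 yh.
  exists (Num.sqrt t); first exact: sqrtr_ge0.
  rewrite mulrBr mulr1 opprB addrC subrK (le_trans (N_rsM _ _))//.
  by rewrite ger0_norm ?sqrtr_ge0// ler_piMr ?sqrtr_ge0.
- rewrite rsMM yy -expr2 sqr_sqrtr ?ltW// mulrBr mulr1.
  by rewrite /a' rsK ?gt_eqF// /a; zmod.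
- move=> c cb; rewrite rsCA -mulrA mulrBr mulrBl mulr1 mul1r yc//.
  by rewrite /a' rsCA /a mulrBr -rsC cb -mulrBl mulrA.
Qed.

Lemma unitary_pair t k l : 0 <= t -> k^*s = k -> l^*s = l -> k * l = l * k ->
  k * k + l * l = rs t -> N (k * k) <= t.
Proof.
move=> t0 hk hl kl klt; pose u := k + iu * l.
have us : u^*s = k - iu * l by rewrite mstarD mstarM hk hl mstar_iu mulrN iuC.
have uu : u^*s * u = rs t.
  have wk : iu * l * k = k * (iu * l) by rewrite -mulrA -kl mulrA iuC mulrA.
  have ww : iu * l * (iu * l) = - (l * l).
    by rewrite {1}iuC mulrA -[l * iu * iu]mulrA iu2 mulrN1 mulNr.
  by rewrite us /u mulrDr !mulrBl wk ww -klt; zmod.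
have Nu : N u ^+ 2 <= t by rewrite -N_Cstar uu (le_trans (N_rs _))// ger0_norm.
have kE : k = rs 2^-1 * (u^*s + u).
  have -> : u^*s + u = rs 2 * k.
    by rewrite us /u -[2]/(1 + 1) rsD rs1 mulrDl mul1r; zmod.
  by rewrite rsVK.
rewrite N_sqr_herm// (le_trans _ Nu)// ler_pXn2r ?nnegrE ?N_ge0//.
rewrite [in leLHS]kE (le_trans (N_rsM _ _))// ger0_norm// ler_pdivrMl//.
by rewrite (le_trans (ND _ _))// N_star -mulr2n mulr_natl.
Qed.

(** As N (h^2) < t, the iteration gives a root k of t - h^2 that commutes with h, and [unitary_pair]
    bounds N (t - h^2) = N (k^2) by t. *)
Lemma pos_herm_sqr h : h^*s = h -> pos (h * h).
Proof.
move=> hh; split; first by rewrite mstarM hh.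
pose t := N h ^+ 2 + 1; have t0 : 0 < t by rewrite ltr_wpDl ?sqr_ge0.
exists t; first exact: ltW.
pose a := rs t^-1 * (h * h).
have a1 : N a <= 1.
  rewrite (le_trans (N_rsM _ _))// gtr0_norm ?invr_gt0// ler_pdivrMl// mulr1.
  by rewrite N_sqr_herm// lerDl.
have [y [y1 yy yh yc]] := sqrt_exists a1.
have ha : a^*s = a by rewrite mstarZ mstarM hh.
pose k := rs (Num.sqrt t) * (1 - y).
have kk : k * k + h * h = rs t.
  rewrite rsMM yy -expr2 sqr_sqrtr ?ltW// mulrBr mulr1.
  by rewrite /a rsK ?gt_eqF//; zmod.
have -> : rs t - h * h = k * k by rewrite -kk; zmod.
apply: (unitary_pair (l := h)) => //; first exact: ltW.
  by rewrite mstarZ mstarB mstar1 yh.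
rewrite rsCA -mulrA mulrBr mulrBl mulr1 mul1r (yc h)//.
by rewrite /a rsCA !mulrA.
Qed.

(** The roots of b and of t - b commute and their squares add up to t, so [unitary_pair] applies. *)
Lemma pos_le_N b t : 0 <= t -> pos b -> pos (rs t - b) -> N b <= t.
Proof.
move=> t0 pb pt; have [k [pk kk kc]] := pos_sqrt pb; have [l [pl ll lc]] := pos_sqrt pt.
rewrite -kk; apply: (unitary_pair (l := l)) => //; rewrite ?pos_herm//.
  by apply: lc; rewrite mulrBr mulrBl rsC -kk mulrA.
by rewrite kk ll; zmod.
Qed.

Lemma pos_anti b : pos b -> pos (- b) -> b = 0.
Proof.
move=> pb pnb; apply: N0_eq0; apply/eqP; rewrite eq_le N_ge0 andbT.
by apply: pos_le_N; rewrite ?rs0 ?sub0r.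
Qed.

Lemma pos_rsM t b : 0 <= t -> pos b -> pos (rs t * b).
Proof.
move=> t0 pb; have [k [pk <- _]] := pos_sqrt pb.
have -> : rs t * (k * k) = (rs (Num.sqrt t) * k) * (rs (Num.sqrt t) * k).
  by rewrite rsMM -(expr2 (Num.sqrt t)) sqr_sqrtr.
by apply: pos_herm_sqr; rewrite mstarZ pos_herm.
Qed.

Lemma N_herm_pow2 h n : h^*s = h -> N (h ^+ (2 ^ n)) = N h ^+ (2 ^ n).
Proof.
move=> hh; elim: n => [|n IH]; first by rewrite !expr1.
have hX m : (h ^+ m)^*s = h ^+ m.
  by elim: m => [|m IHm]; rewrite ?expr0 ?mstar1// exprS mstarM IHm hh -exprSr exprS.
by rewrite expnSr !exprM !expr2 N_sqr_herm// IH expr2.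
Qed.

(** If r = 1 + e with e > 0, Bernoulli's inequality at the exponent 2^n, squared, gives growth of
    order 4^n e^2 at the exponent 2^(n+1), beyond any multiple of 2^n. *)
Lemma root_growth (r q : R) : 0 <= r -> (forall n, r ^+ (2 ^ n) <= 1 + (2 ^ n)%:R * q) -> r <= 1.
Proof.
move=> r0 h; rewrite leNgt; apply/negP => r1.
pose e := r - 1; have e0 : 0 < e by rewrite subr_gt0.
have bern n : 1 + n%:R * e <= r ^+ n.
  elim: n => [|n IH]; first by rewrite mul0r addr0.
  rewrite exprS (@le_trans _ _ (r * (1 + n%:R * e)))// ?ler_wpM2l//.
  have -> : r = 1 + e by rewrite /e; ring.
  rewrite -natr1; have n0 : 0 <= n%:R :> R by []; nra.
have [n nq] : exists n, (2 * `|q| / (e * e) < (2 ^ n)%:R)%R.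
  have x0 : 0 <= 2 * `|q| / (e * e) by rewrite divr_ge0// mulr_ge0// ltW.
  exists (Num.bound (2 * `|q| / (e * e))); apply: lt_le_trans (archi_boundP x0) _.
  by rewrite ler_nat ltnW// ltn_expl.
have := h n.+1; rewrite leNgt => /negP; apply.
rewrite expnSr exprM.
have n1 : 0 < (2 ^ n)%:R :> R by rewrite ltr0n expn_gt0.
rewrite natrM; move: nq n1 (bern (2 ^ n)%N).
move: ((2 ^ n)%:R) (r ^+ (2 ^ n)) => x y; rewrite ltr_pdivrMr ?mulr_gt0// => nq x0 xy.
have q' := ler_norm q.
rewrite (@lt_le_trans _ _ ((1 + x * e) ^+ 2))//; last by rewrite ler_pXn2r ?nnegrE//; nra.
rewrite expr2.
have : x * (2 * q) <= x * (2 * `|q|) by rewrite ler_pM2l// ler_wpM2l.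
have : x * (2 * `|q|) < x * (x * (e * e)) by rewrite ltr_pM2l.
nra.
Qed.

(** Stands in for the fact that v^* v and v v^* have the same nonzero spectrum. As N (t + v^* v) <=
    t, the n-th power of k = t + v v^* is t^n + v x v^* with N x <= n t^(n-1). Applied at the
    exponents 2^n, where N k^(2^n) is the norm of the power, [root_growth] gives N k <= t. *)
Lemma pos_opp_flip v : pos (- (v^*s * v)) -> pos (- (v * v^*s)).
Proof.
move=> [_ [s s0 vs]].
split; first by rewrite mstarN mstarM astarK.
pose t := s + 1; have t0 : 0 < t by rewrite ltr_wpDl.
exists t; first exact: ltW.
have st : s <= t by rewrite lerDl.
have {vs} := pos_bound vs st; rewrite !opprK => vt.
pose k := rs t + v * v^*s; rewrite -/k.
have hk : k^*s = k by rewrite mstarD mstar_rs mstarM astarK.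
have X n : exists2 x, k ^+ n = rs (t ^+ n) + v * x * v^*s & N x <= n%:R * (t ^+ n / t).
  elim: n => [|n [x kx Nx]].
    by exists 0; rewrite ?expr0 ?rs1 ?mulr0 ?mul0r ?addr0// N0.
  exists (rs (t ^+ n) + (rs t + v^*s * v) * x).
    rewrite exprS kx /k exprS rsM !mulrDl !mulrDr !mulrDl !mulrA.
    have -> : v * v^*s * rs (t ^+ n) = v * rs (t ^+ n) * v^*s by rewrite -!mulrA rsC.
    by rewrite -[v * rs t]rsC; zmod.
  have tE : t ^+ n.+1 / t = t ^+ n by rewrite exprSr mulfK// gt_eqF.
  rewrite tE (le_trans (ND _ _))// -natr1 [leRHS]mulrDl mul1r addrC lerD//.
    rewrite (le_trans (NM _ _))// (@le_trans _ _ (t * (n%:R * (t ^+ n / t))))//.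
      by rewrite ler_pM ?N_ge0.
    by rewrite mulrCA ler_wpM2l// mulrCA divff ?mulr1// gt_eqF.
  by rewrite (le_trans (N_rs _))// ger0_norm// exprn_ge0// ltW.
suff : N k / t <= 1 by rewrite ler_pdivrMr// mul1r.
apply: (@root_growth _ (N v ^+ 2 / t)); first by rewrite divr_ge0 ?N_ge0// ltW.
move=> n; rewrite exprMn -N_herm_pow2// exprVn.
have [x -> Nx] := X (2 ^ n)%N.
rewrite ler_pdivrMr ?exprn_gt0// (le_trans (ND _ _))// mulrDl mul1r lerD//.
  by rewrite (le_trans (N_rs _))// ger0_norm// exprn_ge0// ltW.
rewrite (le_trans (NM _ _))// N_star (le_trans (ler_wpM2r (N_ge0 _) (NM _ _)))//.
rewrite (@le_trans _ _ (N v * ((2 ^ n)%:R * (t ^+ (2 ^ n) / t)) * N v))//.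
  by rewrite ler_wpM2r ?N_ge0// ler_wpM2l ?N_ge0.
by rewrite le_eqVlt; apply/orP; left; apply/eqP; ring.
Qed.

(** The self-adjoint p = v + v^* and q = i v - i v^* satisfy p^2 + q^2 = 2 v v^* + 2 v^* v. Hence v
    v^* is positive, and so is its negative by [pos_opp_flip]. *)
Lemma pos_opp_sqr_eq0 v : pos (- (v^*s * v)) -> v = 0.
Proof.
move=> pv; have pv' := pos_opp_flip pv.
pose p := v + v^*s; pose q := iu * (v - v^*s).
have hp : p^*s = p by rewrite mstarD astarK addrC.
have hq : q^*s = q.
  by rewrite mstarM mstar_iu mstarB astarK mulrN -iuC -mulrN opprB.
have pq : p * p + q * q = rs 2 * (v * v^*s) + rs 2 * (v^*s * v).
  have -> : q * q = - ((v - v^*s) * (v - v^*s)).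
    exact: iuMM.
  by rewrite -[2]/(1 + 1) rsD rs1 !mulrDl !mul1r /p; ncring.
have p2 : pos (rs 2 * (v * v^*s)).
  have -> : rs 2 * (v * v^*s) = (p * p + q * q) + rs 2 * (- (v^*s * v)).
    by rewrite pq mulrN; zmod.
  apply: posD; first by apply: posD; exact: pos_herm_sqr.
  exact: pos_rsM.
have /(pos_anti p2) : pos (- (rs 2 * (v * v^*s))) by rewrite -mulrN; exact: pos_rsM.
move=> /(congr1 ( *%R (rs 2^-1))); rewrite rsVK// mulr0 => vv.
apply: N0_eq0; apply/eqP; rewrite -N_star -sqrf_eq0 -N_Cstar astarK vv.
by apply/eqP; exact: N0.
Qed.

Lemma herm_sqr_eq0 h : h^*s = h -> h * h = 0 -> h = 0.
Proof.
move=> hh h0; apply: N0_eq0; apply/eqP; rewrite -sqrf_eq0 -N_sqr_herm// h0.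
by apply/eqP; exact: N0.
Qed.

(** With h = v^* v, k = |h| and l the root of k, the element m = k - h is twice the negative part of
    h. Then -(v m)^* (v m) = -m h m = m k m = (l m)^2 is positive, so v m = 0; hence h m = 0, m^2 =
    0 and h = |h|. *)
Lemma pos_sqr v : pos (v^*s * v).
Proof.
set h := v^*s * v; have hh : h^*s = h by rewrite mstarM astarK.
have [k [pk kk kc]] := pos_sqrt (pos_herm_sqr hh).
have [l [pl ll lc]] := pos_sqrt pk.
have hk : h * k = k * h by rewrite kc// mulrA.
have hl : h * l = l * h by exact: lc.
have kl : k * l = l * k by rewrite lc// ll.
pose m := k - h.
have hm : m^*s = m by rewrite mstarB hh pos_herm.
have ml : m * l = l * m by rewrite mulrBl mulrBr hl kl.
have vm : v * m = 0.
  apply: pos_opp_sqr_eq0.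
  have -> : - ((v * m)^*s * (v * m)) = (l * m) * (l * m).
    have -> : (v * m)^*s * (v * m) = m * (h * m) by rewrite mstarM hm !mulrA.
    have -> : h * m = - (k * m) by rewrite /m !mulrBr kk hk; zmod.
    by rewrite mulrN opprK -{1}ll !mulrA ml.
  by apply: pos_herm_sqr; rewrite mstarM hm (pos_herm pl) ml.
have hm0 : h * m = 0 by rewrite /h -mulrA vm mulr0.
have : m = 0.
  apply: herm_sqr_eq0 => //.
  rewrite {1}/m mulrBl hm0 subr0.
  have -> : k * m = - (h * m) by rewrite /m !mulrBr kk hk; zmod.
  by rewrite hm0 oppr0.
by move=> /eqP; rewrite subr_eq0 => /eqP <-.
Qed.

Lemma pos_conj c b : pos b -> pos (c^*s * b * c).
Proof.
move=> pb; have [k [pk <- _]] := pos_sqrt pb.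
have -> : c^*s * (k * k) * c = (k * c)^*s * (k * c) by rewrite mstarM (pos_herm pk) !mulrA.
exact: pos_sqr.
Qed.

Lemma pos_conj_herm c b : c^*s = c -> pos b -> pos (c * b * c).
Proof. by move=> hc; rewrite -{1}hc; exact: pos_conj. Qed.

Lemma pos_mul b c : pos b -> pos c -> b * c = c * b -> pos (b * c).
Proof.
move=> pb pc bc; have [k [pk kk kc]] := pos_sqrt pb.
have -> : b * c = k * c * k by rewrite -[RHS]mulrA (kc c) ?mulrA ?kk.
exact: pos_conj_herm (pos_herm pk) pc.
Qed.

Lemma pos_mono_N b c : pos b -> pos (c - b) -> N b <= N c.
Proof.
move=> pb cb; apply: pos_le_N => //; first exact: N_ge0.
have -> : rs (N c) - b = (rs (N c) - c) + (c - b) by zmod.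
apply: posD => //; apply: N_pos_sub => //.
by have := posD pb cb; rewrite addrC subrK => /pos_herm.
Qed.

Lemma geom_vanish (q K : R) : 0 <= q -> q < 1 -> 0 <= K -> vanish (fun n => K * q ^+ n).
Proof.
move=> q0 q1 K0; apply: vanishZ => //.
have /vanish_cvg : (q ^+ n @[n --> \oo] --> (0 : R))%classic.
  by apply: cvg_expr; rewrite ger0_norm.
by apply: vanish_le => n; rewrite sub0r normrN ler_norm.
Qed.

Lemma neumann a (q : R) : N a <= q -> q < 1 -> exists d,
  (1 - a) * d = 1 /\ forall c, c * a = a * c -> c * d = d * c.
Proof.
move=> aq q1; have q0 : 0 <= q by rewrite (le_trans (N_ge0 _) aq).
pose S := fix S n := if n is n'.+1 then 1 + a * S n' else 0 : MA.
have Sc n c : c * a = a * c -> c * S n = S n * c.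
  move=> ca; elim: n => [|n IH] /=; first by rewrite mulr0 mul0r.
  by rewrite mulrDr mulrDl mulr1 mul1r mulrA ca -mulrA IH mulrA.
have Sstep n : N (S n.+1 - S n) <= q ^+ n.
  elim: n => [|n IH]; first by rewrite /= mulr0 addr0 subr0 N1.
  have -> : S n.+2 - S n.+1 = a * (S n.+1 - S n) by rewrite mulrBr /=; zmod.
  by rewrite exprS (le_trans (NM _ _))// ler_pM// N_ge0.
pose K : R := (1 - q)^-1; have K0 : 0 <= K by rewrite invr_ge0 subr_ge0 ltW.
have SK n m : (n <= m)%N -> N (S m - S n) <= K * q ^+ n.
  suff h : (n <= m)%N -> N (S m - S n) <= K * q ^+ n - K * q ^+ m.
    by move=> /h /le_trans; apply; rewrite lerBlDr lerDl mulr_ge0// exprn_ge0.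
  elim: m => [|m IH]; first by rewrite leqn0 => /eqP->; rewrite !subrr N0.
  rewrite leq_eqVlt => /orP[/eqP->|/IH nm]; first by rewrite !subrr N0.
  rewrite (le_trans (N_dist_tri (S m) _ _))// (le_trans (lerD (Sstep m) nm))//.
  rewrite exprS le_eqVlt; apply/orP; left; apply/eqP; rewrite /K.
  by field; rewrite subr_eq0 gt_eqF.
have vS := geom_vanish q0 q1 K0.
have [d dP] := N_complete vS SK; exists d; split.
  apply/eqP; rewrite -subr_eq0; apply/eqP.
  apply: (@N_vanish _ (fun n => K * q ^+ n + q * (K * q ^+ n))).
    by apply: vanishD => //; exact: vanishZ.
  move=> n; have -> : (1 - a) * d - 1 = (d - S n.+1) + (- (a * (d - S n))).
    by rewrite /=; ncring.
  rewrite (le_trans (ND _ _))// lerD//.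
    rewrite (le_trans (dP _))// exprS ler_wpM2l// ler_piMl// ?exprn_ge0//; exact: ltW.
  by rewrite NN (le_trans (NM _ _))// ler_pM ?N_ge0.
move=> c ca; apply/eqP; rewrite -subr_eq0; apply/eqP.
apply: (@N_vanish _ (fun n => N c * (K * q ^+ n) + (K * q ^+ n) * N c)).
  by apply: vanishD; [apply: vanishZ|apply: vanishZr]; rewrite ?N_ge0.
move=> n; have -> : c * d - d * c = c * (d - S n) + (S n - d) * c.
  by rewrite mulrBr mulrBl (Sc n c ca); zmod.
rewrite (le_trans (ND _ _))// lerD// (le_trans (NM _ _))//.
  by rewrite ler_wpM2l ?N_ge0.
by rewrite ler_wpM2r ?N_ge0// NB.
Qed.

(** Here 1 + c = (1 + t) (1 - a) with a = (t - c) / (1 + t) of norm at most t / (1 + t) < 1, so the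
    Neumann series applies. Positivity is read off from d = d^2 + d c d and 1 - d = d c d + d c^2
    d. *)
Lemma pos_inv c : pos c -> exists d,
  [/\ (1 + c) * d = 1, d * (1 + c) = 1, pos d & pos (1 - d)].
Proof.
move=> pc; have [hc [t t0 ct]] := pc.
have t1 : 0 < 1 + t by rewrite ltr_pwDl.
pose a := rs (1 + t)^-1 * (rs t - c).
have aq : N a <= t / (1 + t).
  by rewrite (le_trans (N_rsM _ _))// gtr0_norm ?invr_gt0// mulrC ler_wpM2r// invr_ge0 ltW.
have q1 : t / (1 + t) < 1 by rewrite ltr_pdivrMr// mul1r ltrDr.
have [d0 [ad dc]] := neumann aq q1.
have aE : rs (1 + t) * (1 - a) = 1 + c.
  by rewrite mulrBr mulr1 /a rsK ?gt_eqF// rsD rs1; zmod.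
pose d := rs (1 + t)^-1 * d0.
have cd : (1 + c) * d = 1.
  by rewrite -aE /d rsMM divff ?gt_eqF// rs1 mul1r.
have dcc : d * (1 + c) = 1.
  have ca : (1 + c) * a = a * (1 + c).
    rewrite /a rsCA -mulrA; congr (_ * _).
    by rewrite mulrDl mulrDr mulrBr mulrBl rsC; ncring.
  by rewrite -[RHS]cd /d rsCA -mulrA (dc _ ca).
have hd : d^*s = d.
  rewrite -[d^*s]mulr1 -cd mulrA.
  have -> : d^*s * (1 + c) = ((1 + c) * d)^*s by rewrite mstarM mstarD mstar1 hc.
  by rewrite cd mstar1 mul1r.
exists d; split=> //.
- have -> : d = d * d + d * c * d.
    by rewrite -{1}[d]mul1r -{1}dcc mulrDr mulr1 mulrDl.
  by apply: posD; [exact: pos_herm_sqr|exact: pos_conj_herm].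
- have -> : 1 - d = c * d by rewrite -{1}cd mulrDl mul1r; zmod.
  have -> : c * d = d * c * d + (c * d)^*s * (c * d).
    rewrite mstarM hd hc -{1}[c * d]mul1r -{1}dcc mulrDr mulr1 mulrDl !mulrA.
    by [].
  by apply: posD; [exact: pos_conj_herm|exact: pos_sqr].
Qed.

(** Rests on the identity d - d' = (d - d') (1 + c) (d - d') + d' (c' - c) d', which requires
    neither roots nor commutation. *)
Lemma pos_inv_anti c c' d d' : pos c -> pos d -> pos d' -> pos (c' - c) ->
    d * (1 + c) = 1 -> (1 + c) * d = 1 ->
    d' * (1 + c') = 1 -> (1 + c') * d' = 1 ->
  pos (d - d').
Proof.
move=> pc pd pd' cc' d1 d2 d'1 d'2.
have -> : d - d' = (d - d') * (1 + c) * (d - d') + d' * (c' - c) * d'.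
  have -> : c' - c = (1 + c') - (1 + c) by zmod.
  rewrite [d' * (_ - _)]mulrBr d'1 [(d - d') * (1 + c)]mulrBl d1.
  rewrite !mulrBl !mulrBr !mul1r -[d' * (1 + c) * d]mulrA d2 mulr1; zmod.
apply: posD; last by apply: pos_conj_herm; rewrite ?pos_herm.
apply: pos_conj_herm; first by rewrite mstarB !pos_herm.
by apply: posD => //; exact: pos1.
Qed.

(** Let r = |m| and w = r - m. Then m w = - r w, and k m = m^2 gives (k r + m^2) w = 0. Both w k r w
    and w m^2 w are positive with sum 0, so r w = 0, whence w^2 = 0. *)
Lemma pos_dominated k m : pos k -> m^*s = m -> k * m = m * k -> k * m = m * m -> pos m.
Proof.
move=> pk hm km kmm.
have [r [pr rr rc]] := pos_sqrt (pos_herm_sqr hm).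
have mr : m * r = r * m by apply: rc; rewrite mulrA.
have kr : k * r = r * k by apply: rc; rewrite mulrA km -mulrA km mulrA.
pose w := r - m.
have hw : w^*s = w by rewrite mstarB hm pos_herm.
have rw : r * w = w * r by rewrite mulrBr mulrBl mr.
have mw : m * w = - (r * w) by rewrite /w !mulrBr rr mr; zmod.
have krw : w * (k * r + m * m) * w = 0.
  have e : (k * r + m * m) * w = 0.
    by rewrite mulrDl -kmm -[k * m * w]mulrA mw mulrN -mulrA subrr.
  by rewrite -mulrA e mulr0.
have p1 : pos (w * (k * r) * w) by apply: pos_conj_herm => //; exact: pos_mul.
have p2 : pos (w * (m * m) * w) by apply: pos_conj_herm => //; exact: pos_herm_sqr.
have wmm : w * (m * m) * w = 0.
  apply: pos_anti => //; have -> // : - (w * (m * m) * w) = w * (k * r) * w.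
  by apply/eqP; rewrite eq_sym -addr_eq0 -mulrDl -mulrDr krw.
have rw0 : r * w = 0.
  apply: herm_sqr_eq0; first by rewrite mstarM hw (pos_herm pr) rw.
  by rewrite {1}rw -rr in wmm * => //; rewrite -wmm !mulrA.
have : w = 0.
  apply: herm_sqr_eq0 => //; rewrite {1}/w mulrBl mw rw0 oppr0 subr0.
  by [].
by move=> /eqP; rewrite subr_eq0 => /eqP <-.
Qed.

(** The parts are (|h| + h) / 2 and (|h| - h) / 2; their positivity comes from [pos_dominated],
    since 2 |h| times |h| + h is the square of |h| + h, and likewise for |h| - h. *)
Lemma pos_parts h : h^*s = h -> exists p n,
  [/\ pos p, pos n, h = p - n, p * n = 0 /\ n * p = 0 &
      forall c, c * h = h * c -> c * p = p * c /\ c * n = n * c].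
Proof.
move=> hh; have [k [pk kk kc]] := pos_sqrt (pos_herm_sqr hh).
have hk : h * k = k * h by apply: kc; rewrite mulrA.
have pp : pos (k + h).
  apply: (@pos_dominated (k + k)); first exact: posD.
  - by rewrite mstarD hh pos_herm.
  - by rewrite !mulrDl !mulrDr hk; zmod.
  - by rewrite !mulrDl !mulrDr hk kk; zmod.
have pn : pos (k - h).
  apply: (@pos_dominated (k + k)); first exact: posD.
  - by rewrite mstarB hh pos_herm.
  - by rewrite !(mulrDl, mulrDr, mulrN, mulNr) hk; zmod.
  - by rewrite !(mulrDl, mulrDr, mulrN, mulNr) hk kk; zmod.
exists (rs 2^-1 * (k + h)), (rs 2^-1 * (k - h)); split.
- by apply: pos_rsM.
- by apply: pos_rsM.
- rewrite -mulrBr; have -> : k + h - (k - h) = rs 2 * h.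
    by rewrite -[2]/(1 + 1) rsD rs1 mulrDl mul1r; zmod.
  by rewrite rsVK.
- split; rewrite rsMM; last first.
    have -> : (k - h) * (k + h) = 0; last by rewrite mulr0.
    by rewrite !(mulrDl, mulrDr, mulrN, mulNr) hk kk; zmod.
  have -> : (k + h) * (k - h) = 0; last by rewrite mulr0.
  by rewrite !(mulrDl, mulrDr, mulrN, mulNr) hk kk; zmod.
- move=> c ch.
  have ck : c * k = k * c by apply: kc; rewrite mulrA ch -mulrA ch mulrA.
  split; rewrite rsCA -mulrA; congr (_ * _); first by rewrite mulrDl mulrDr ck ch.
  by rewrite mulrBl mulrBr ck ch.
Qed.

End MultiplierOrder.

(** * Hilbert spaces and representations *)

Section SemiInner.
Variables (R : realType) (V : lmodType R[i]) (s : V -> V -> R[i]).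
Hypotheses (sDl : forall u v w, s (u + v) w = s u w + s v w)
  (sZl : forall (k : R[i]) u v, s (k *: u) v = k * s u v)
  (sC : forall u v, s v u = (s u v)^*)
  (s_ge0 : forall u, 0 <= complex.Re (s u u)).

Lemma sDr u v w : s u (v + w) = s u v + s u w.
Proof. by rewrite sC sDl rmorphD/= -!sC. Qed.

Lemma sZr (k : R[i]) u v : s u (k *: v) = k^* * s u v.
Proof. by rewrite sC sZl rmorphM/= -sC. Qed.

Lemma sNl u v : s (- u) v = - s u v.
Proof. by rewrite -scaleN1r sZl mulN1r. Qed.

Lemma sNr u v : s u (- v) = - s u v.
Proof. by rewrite sC sNl rmorphN/= -sC. Qed.

Lemma sBl u v w : s (u - v) w = s u w - s v w.
Proof. by rewrite sDl sNl. Qed.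

Lemma sBr u v w : s u (v - w) = s u v - s u w.
Proof. by rewrite sDr sNr. Qed.

Lemma s0l v : s 0 v = 0.
Proof. by rewrite -(scale0r 0) sZl mul0r. Qed.

Lemma s0r v : s v 0 = 0.
Proof. by rewrite sC s0l rmorph0. Qed.

Lemma ReC (k : R[i]) : complex.Re k^* = complex.Re k.
Proof. by case: k. Qed.

Lemma s_real u : s u u = ((complex.Re (s u u))%:C)%C.
Proof.
have := sC u u; case: (s u u) => a b /eqP; rewrite eq_complex/= eqxx/= => /eqP bb.
by congr (Complex _ _); lra.
Qed.

(** The form may be degenerate: the same facts serve a Hilbert space and the form given by a
    positive functional before completion. *)
Definition sn u : R := Num.sqrt (complex.Re (s u u)).

Lemma sn_ge0 u : 0 <= sn u.
Proof. exact: sqrtr_ge0. Qed.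

Lemma sn_sqr u : sn u ^+ 2 = complex.Re (s u u).
Proof. exact: sqr_sqrtr. Qed.

Lemma sn_sqrD u v : sn (u + v) ^+ 2 = sn u ^+ 2 + 2 * complex.Re (s u v) + sn v ^+ 2.
Proof.
rewrite !sn_sqr sDl !sDr !raddfD/= [s v u]sC ReC; ring.
Qed.

Lemma cauchy_schwarz u v : cm (s u v) <= sn u * sn v.
Proof.
rewrite -(ler_pXn2r (n := 2))// ?nnegrE ?cm_ge0 ?mulr_ge0 ?sn_ge0//.
rewrite exprMn !sn_sqr; set z := s u v.
set a := complex.Re (s u u); set b := complex.Re (s v v); set m := cm z ^+ 2.
have q (t : R) : 0 <= a - 2 * t * m + t ^+ 2 * m * b.
  have := s_ge0 (u - ((t%:C)%C * z) *: v).
  rewrite sBl !sBr !sZl !sZr -/z [s v u]sC -/z [s v v]s_real [s u u]s_real -/a -/b.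
  rewrite /m cm_sqr => h; apply: le_trans h _; rewrite le_eqVlt; apply/orP; left; apply/eqP.
  by move: (z) => [x y] /=; ring.
have m0 : 0 <= m by rewrite sqr_ge0.
have b0 : 0 <= b by exact: s_ge0.
have a0 : 0 <= a by exact: s_ge0.
have [b00|bn] := eqVneq b 0.
  rewrite b00 mulr0; rewrite leNgt; apply/negP => mp.
  (* For b = 0 the quadratic in t is affine, and this value makes it -1. Otherwise its minimum, at 1
     / b, gives the inequality. *)
  have := q ((a + 1) / (2 * m)); rewrite b00 mulr0 addr0.
  have -> : 2 * ((a + 1) / (2 * m)) * m = a + 1 by field; rewrite gt_eqF.
  lra.
have bp : 0 < b by rewrite lt_def bn.
have := q b^-1; rewrite -(pmulr_lge0 _ bp).
have -> : (a - 2 * b^-1 * m + b^-1 ^+ 2 * m * b) * b = a * b - m by field.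
by rewrite subr_ge0.
Qed.

Lemma Re_cauchy_schwarz u v : complex.Re (s u v) <= sn u * sn v.
Proof. exact: le_trans (Re_cm _) (cauchy_schwarz u v). Qed.

Lemma snD u v : sn (u + v) <= sn u + sn v.
Proof.
rewrite -(ler_pXn2r (n := 2))// ?nnegrE ?addr_ge0 ?sn_ge0//.
rewrite sn_sqrD; have := Re_cauchy_schwarz u v; nra.
Qed.

Lemma snZ (k : R[i]) u : sn (k *: u) = cm k * sn u.
Proof.
apply/eqP; rewrite -(eqrXn2 (n := 2))// ?mulr_ge0 ?cm_ge0 ?sn_ge0//.
rewrite exprMn !sn_sqr sZl sZr cm_sqr [s u u]s_real; apply/eqP.
by case: k => x y /=; ring.
Qed.

Lemma s_eq0 (z : R[i]) : complex.Re z = 0 -> complex.Re ('i%C * z) = 0 -> z = 0.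
Proof. by case: z => x y /= -> h; congr (Complex _ _); lra. Qed.

End SemiInner.

Section HilbertFacts.
Variables (R : realType) (H : hilbertType R).
Implicit Types u v w : H.

Let iDl := @innerDl R H.
Let iZl := @innerZl R H.
Let iC := @innerC R H.

Lemma inner_real u : inner u u = ((nm u ^+ 2)%:C)%C.
Proof. by rewrite inner_norm -nmE rmorphXn. Qed.

Lemma inner_ge0 u : 0 <= complex.Re (inner u u).
Proof. by rewrite inner_real/= sqr_ge0. Qed.

Lemma innerDr u v w : inner u (v + w) = inner u v + inner u w.
Proof. exact: (sDr iDl iC). Qed.

Lemma innerZr (k : R[i]) u v : inner u (k *: v) = k^* * inner u v.
Proof. exact: (sZr iZl iC). Qed.

Lemma innerNl u v : inner (- u) v = - inner u v.
Proof. exact: (sNl iZl). Qed.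

Lemma innerNr u v : inner u (- v) = - inner u v.
Proof. exact: (sNr iZl iC). Qed.

Lemma innerBl u v w : inner (u - v) w = inner u w - inner v w.
Proof. exact: (sBl iDl iZl). Qed.

Lemma innerBr u v w : inner u (v - w) = inner u v - inner u w.
Proof. exact: (sBr iDl iZl iC). Qed.

Lemma inner0l v : inner 0 v = 0 :> R[i].
Proof. exact: (s0l iZl). Qed.

Lemma inner0r v : inner v 0 = 0 :> R[i].
Proof. exact: (s0r iZl iC). Qed.

Lemma sn_inner u : sn (@inner R H) u = nm u.
Proof. by rewrite /sn inner_real/= sqrtr_sqr ger0_norm// nm_ge0. Qed.

Lemma inner_cs u v : cm (inner u v) <= nm u * nm v.
Proof. by rewrite -!sn_inner; exact: (cauchy_schwarz iDl iZl iC inner_ge0). Qed.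

Definition rin u v : R := complex.Re (inner u v).

Lemma rin_cs u v : rin u v <= nm u * nm v.
Proof. exact: le_trans (Re_cm _) (inner_cs _ _). Qed.

Lemma rinDl u v w : rin (u + v) w = rin u w + rin v w.
Proof. by rewrite /rin innerDl raddfD. Qed.

Lemma rinDr u v w : rin u (v + w) = rin u v + rin u w.
Proof. by rewrite /rin innerDr raddfD. Qed.

Lemma rinNl u v : rin (- u) v = - rin u v.
Proof. by rewrite /rin innerNl raddfN. Qed.

Lemma rinNr u v : rin u (- v) = - rin u v.
Proof. by rewrite /rin innerNr raddfN. Qed.

Lemma rinZl (t : R) u v : rin ((t%:C)%C *: u) v = t * rin u v.
Proof. by rewrite /rin innerZl; case: (inner u v) => x y /=; ring. Qed.

Lemma rinC u v : rin u v = rin v u.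
Proof. by rewrite /rin [inner u v]iC ReC. Qed.

Lemma rinZr (t : R) u v : rin u ((t%:C)%C *: v) = t * rin u v.
Proof. by rewrite rinC rinZl rinC. Qed.

Lemma rin_sqr u : rin u u = nm u ^+ 2.
Proof. by rewrite /rin inner_real. Qed.

Lemma nm_sqrD u v : nm (u + v) ^+ 2 = nm u ^+ 2 + 2 * rin u v + nm v ^+ 2.
Proof. by rewrite -!sn_inner; exact: (sn_sqrD iDl iC inner_ge0). Qed.

Lemma inner_eq u v : (forall w, inner u w = inner v w) -> u = v.
Proof.
move=> uv; apply/eqP; rewrite -subr_eq0; apply/eqP/nm0_eq0/eqP.
by rewrite -sqrf_eq0 -rin_sqr /rin innerBl uv subrr.
Qed.

Definition inv_seq (n : nat) : R := n.+1%:R^-1.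

Lemma nm_null (u : H) (K : R) : (forall n, nm u <= K * inv_seq n) -> u = 0.
Proof.
move=> h; apply: nm0_eq0; apply/eqP; rewrite eq_le nm_ge0 andbT.
apply: vanish_ge0 (fun n => `|K| * inv_seq n) _ _ => //.
  by apply: vanishZ => //; exact: vanish_invn.
by move=> n; rewrite (le_trans (h n))// ler_wpM2r ?ler_norm// invr_ge0.
Qed.

Lemma cm_null (z : R[i]) (K : R) : (forall n, cm z <= K * inv_seq n) -> z = 0.
Proof.
move=> h; apply: cm0_eq0; apply/eqP; rewrite eq_le cm_ge0 andbT.
apply: vanish_ge0 (fun n => `|K| * inv_seq n) _ _ => //.
  by apply: vanishZ => //; exact: vanish_invn.
by move=> n; rewrite (le_trans (h n))// ler_wpM2r ?ler_norm// invr_ge0.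
Qed.

End HilbertFacts.

Section RepFacts.
Variables (R : realType) (B : starAlgType R) (H : hilbertType R) (pi : B -> H -> H).
Hypothesis rpi : is_representation pi.

Lemma repDl a b v : pi (a + b) v = pi a v + pi b v.
Proof. exact: (linD (rep_linearl rpi v)). Qed.

Lemma repZl (k : R[i]) b v : pi (k *: b) v = k *: pi b v.
Proof. exact: (linZ (rep_linearl rpi v)). Qed.

Lemma repNl b v : pi (- b) v = - pi b v.
Proof. exact: (linN (rep_linearl rpi v)). Qed.

Lemma repBl a b v : pi (a - b) v = pi a v - pi b v.
Proof. exact: (linB (rep_linearl rpi v)). Qed.

Lemma rep0l v : pi 0 v = 0.
Proof. exact: (lin0 (rep_linearl rpi v)). Qed.

Lemma repDr b u v : pi b (u + v) = pi b u + pi b v.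
Proof. exact: (linD (rep_linearr rpi b)). Qed.

Lemma repBr b u v : pi b (u - v) = pi b u - pi b v.
Proof. exact: (linB (rep_linearr rpi b)). Qed.

Lemma rep_starr b u v : inner u (pi b v) = inner (pi b^*s u) v.
Proof. by rewrite (rep_star rpi) astarK. Qed.

Lemma rep_nm_sqr b v : nm (pi b v) ^+ 2 = rin (pi (b^*s ⋅ b) v) v.
Proof. by rewrite (rep_mul rpi) /rin (rep_star rpi) astarK inner_real. Qed.

Lemma rep_lipschitz b : exists2 C : R, 0 <= C & forall v, nm (pi b v) <= C * nm v.
Proof. exact: (linear_cont_bounded (rep_linearr rpi b) (@rep_bounded _ _ _ _ rpi b)). Qed.

End RepFacts.

Lemma closure_subspace (R : realType) (H : hilbertType R) (S : set H) :
    S 0 -> (forall (k : R[i]) u v, S u -> S v -> S (k *: u + v)) ->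
  closed_subspace [set h | forall e : R, 0 < e -> exists2 u, S u & nm (h - u) < e].
Proof.
move=> S0 SD; split.
- by move=> e e0; exists 0; rewrite // subrr nm0.
- move=> k u v Wu Wv e e0.
  have k1 : 0 < cm k + 1 by rewrite ltr_wpDl ?cm_ge0.
  have [|u' Su' uu'] := Wu (e / 2 / (cm k + 1)); first by rewrite !divr_gt0.
  have [|v' Sv' vv'] := Wv (e / 2); first by rewrite divr_gt0.
  exists (k *: u' + v'); first exact: SD.
  have -> : k *: u + v - (k *: u' + v') = k *: (u - u') + (v - v') by rewrite scalerBr; zmod.
  rewrite (le_lt_trans (nmD _ _))// nmZ [e]splitr ler_ltD//.
  rewrite (@le_trans _ _ ((cm k + 1) * nm (u - u')))//.
    by rewrite ler_wpM2r ?nm_ge0// lerDl.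
  by rewrite mulrC -ler_pdivlMr// ltW.
- move=> h clh e e0.
  have e2 : 0 < e / 2 by rewrite divr_gt0.
  have [u []] : [set h | forall e : R, 0 < e -> exists2 u, S u & nm (h - u) < e] `&`
      ball h (((e / 2)%:C)%C) !=set0.
    by apply: clh; apply: nbhsx_ballx; rewrite ltcR.
  move=> /(_ _ e2)[v Sv uv]; rewrite -ball_normE /ball_/= -nm_lt => hu.
  exists v => //; rewrite (le_lt_trans (nm_dist_tri u _ _))// [e]splitr.
  exact: ltrD.
Qed.

(** * Extending operators from a dense subspace *)

Section DenseExtension.
Variables (R : realType) (V : lmodType R[i]) (H : hilbertType R) (j : V -> H).
Hypotheses (jlin : linear j) (jdense : forall h (e : R), 0 < e -> exists v, nm (h - j v) < e).

Lemma dense_seq h : exists v : nat -> V, forall n, nm (h - j (v n)) <= inv_seq R n.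
Proof.
have /choice[v vP] n : exists v, nm (h - j v) <= inv_seq R n.
  by have [|v /ltW hv] := jdense h (e := inv_seq R n); [rewrite invr_gt0|exists v].
by exists v.
Qed.

Lemma dense_eq (W : normedModType R[i]) (F G : H -> W) (C : R) :
    (forall u v, nm (F u - F v) <= C * nm (u - v)) ->
    (forall u v, nm (G u - G v) <= C * nm (u - v)) ->
  (forall v, F (j v) = G (j v)) -> forall h, F h = G h.
Proof.
move=> FC GC FG h; apply/eqP; rewrite -subr_eq0; apply/eqP; apply: nm0_eq0.
apply/eqP; rewrite eq_le nm_ge0 andbT; apply/ler_addgt0Pr => e e0; rewrite add0r.
have C1 : 0 < 2 * `|C| + 1 by rewrite ltr_wpDl// mulr_ge0.
have [|v hv] := jdense h (e := e / (2 * `|C| + 1)); first by rewrite divr_gt0.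
rewrite (le_trans (nm_dist_tri (F (j v)) _ _))// {2}FG.
rewrite (le_trans (lerD (FC _ _) (GC _ _)))// [nm (j v - h)]nmB.
rewrite ltr_pdivlMr// in hv; have := nm_ge0 (h - j v); have := ler_norm C.
move: (nm _) hv => x hv C' x0; nra.
Qed.

Variables (B : starAlgType R) (T : B -> V -> V) (C : B -> R).
Hypotheses (Tlinl : forall v, linear (fun b => T b v)) (Tlinr : forall b, linear (T b))
  (Tmul : forall a b v, T (a ⋅ b) v = T a (T b v))
  (Tstar : forall b u v, inner (j (T b u)) (j v) = inner (j u) (j (T b^*s v)))
  (Tbounded : forall b v, nm (j (T b v)) <= C b * nm (j v)).

(** The estimate is demanded against every v and not along one sequence, which makes the value at h
    independent of how h is approximated. *)
Lemma dense_op b : exists P : H -> H, forall h v, nm (P h - j (T b v)) <= `|C b| * nm (h - j v).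
Proof.
have Tb u v : nm (j (T b u) - j (T b v)) <= `|C b| * nm (j u - j v).
  rewrite -(linB jlin) -(linB (Tlinr b)) -(linB jlin) (le_trans (Tbounded _ _))//.
  by rewrite ler_wpM2r ?nm_ge0// ler_norm.
suff /choice[P PP] h : exists w, forall v, nm (w - j (T b v)) <= `|C b| * nm (h - j v).
  by exists P.
have [v vP] := dense_seq h.
pose eps n := `|C b| * (inv_seq R n + inv_seq R n).
have veps : vanish eps.
  by apply: vanishZ => //; apply: vanishD; exact: vanish_invn.
have [n m nm_|w wP] := @banach_complete _ _ (fun n => j (T b (v n))) eps veps.
  rewrite (le_trans (Tb _ _))// ler_wpM2l// (le_trans (nm_dist_tri h _ _))// lerD//.
  rewrite nmB (le_trans (vP _))// lef_pV2 ?posrE// ler_nat//.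
exists w => u; rewrite -subr_le0.
apply: (vanish_ge0 (f := fun n => eps n + `|C b| * inv_seq R n)).
  by apply: vanishD => //; apply: vanishZ => //; exact: vanish_invn.
move=> n; rewrite lerBlDr (le_trans (nm_dist_tri (j (T b (v n))) _ _))// -addrA lerD//.
rewrite (le_trans (Tb _ _))// -mulrDr ler_wpM2l// (le_trans (nm_dist_tri h _ _))// lerD//.
by rewrite nmB.
Qed.

(** Used for the GNS representation and for extending a representation of A to M(A). Vectors of V
    are measured only through j, which need not be injective. *)
Lemma dense_representation : exists2 pi : B -> H -> H,
  is_representation pi & forall b v, pi b (j v) = j (T b v).
Proof.
have /choice[pi piP] := dense_op.
have near (b : B) h v n : nm (h - j v) <= inv_seq R n ->
    nm (pi b h - j (T b v)) <= `|C b| * inv_seq R n.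
  by move=> hv; rewrite (le_trans (piP _ _ _))// ler_wpM2l.
have piB b h : nm (pi b h) <= `|C b| * nm h.
  by have := piP b h 0; rewrite (lin0 (Tlinr b)) (lin0 jlin) !subr0.
have pilinr b : linear (pi b).
  move=> k u v; apply/eqP; rewrite -subr_eq0; apply/eqP.
  have [u_ uP] := dense_seq u; have [v_ vP] := dense_seq v.
  apply: (@nm_null _ _ _ (`|C b| * (cm k + 1) + cm k * `|C b| + `|C b|)) => n.
  have -> : pi b (k *: u + v) - (k *: pi b u + pi b v) =
      (pi b (k *: u + v) - j (T b (k *: u_ n + v_ n))) +
      (- (k *: (pi b u - j (T b (u_ n)))) + - (pi b v - j (T b (v_ n)))).
    have -> : j (T b (k *: u_ n + v_ n)) = k *: j (T b (u_ n)) + j (T b (v_ n)).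
      by rewrite (linD (Tlinr b)) (linZ (Tlinr b)) (linD jlin) (linZ jlin).
    by rewrite scalerBr; zmod.
  rewrite -[in leRHS]addrA [leRHS]mulrDl (le_trans (nmD _ _))// lerD//.
    rewrite (le_trans (piP _ _ _))// -mulrA ler_wpM2l//.
    have -> : k *: u + v - j (k *: u_ n + v_ n) = k *: (u - j (u_ n)) + (v - j (v_ n)).
      by rewrite (linD jlin) (linZ jlin) scalerBr; zmod.
    rewrite (le_trans (nmD _ _))// mulrDl mul1r lerD// nmZ ler_wpM2l ?cm_ge0//.
  rewrite [leRHS]mulrDl (le_trans (nmD _ _))// lerD// nmN; last exact: near.
  by rewrite nmZ -mulrA ler_wpM2l ?cm_ge0// near.
exists pi; last first.
  move=> b v; apply/eqP; rewrite -subr_eq0; apply/eqP; apply: nm0_eq0; apply/eqP.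
  by rewrite eq_le nm_ge0 andbT; have := piP b (j v) v; rewrite subrr nm0 mulr0.
split.
- move=> v k a b /=; apply/eqP; rewrite -subr_eq0; apply/eqP.
  have [v_ vP] := dense_seq v.
  apply: (@nm_null _ _ _ (`|C (k *: a + b)| + cm k * `|C a| + `|C b|)) => n.
  have -> : pi (k *: a + b) v - (k *: pi a v + pi b v) =
      (pi (k *: a + b) v - j (T (k *: a + b) (v_ n))) +
      (- (k *: (pi a v - j (T a (v_ n)))) + - (pi b v - j (T b (v_ n)))).
    have -> : j (T (k *: a + b) (v_ n)) = k *: j (T a (v_ n)) + j (T b (v_ n)).
      by rewrite (Tlinl (v_ n) k a b) (linD jlin) (linZ jlin).
    by rewrite scalerBr; zmod.
  rewrite -[in leRHS]addrA [leRHS]mulrDl (le_trans (nmD _ _))// lerD ?near//.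
  rewrite [leRHS]mulrDl (le_trans (nmD _ _))// lerD// nmN; last exact: near.
  by rewrite nmZ -mulrA ler_wpM2l ?cm_ge0// near.
- exact: pilinr.
- by move=> b; exact: bounded_linear_cont (pilinr b) (piB b).
- move=> a b v; apply/eqP; rewrite -subr_eq0; apply/eqP.
  have [v_ vP] := dense_seq v.
  apply: (@nm_null _ _ _ (`|C (a ⋅ b)| + `|C a| * `|C b|)) => n.
  rewrite (le_trans (nm_dist_tri (j (T (a ⋅ b) (v_ n))) _ _))// [leRHS]mulrDl lerD ?near//.
  by rewrite Tmul nmB -mulrA (le_trans (piP _ _ _))// ler_wpM2l// near.
- move=> b u v; apply/eqP; rewrite -subr_eq0; apply/eqP.
  have [u_ uP] := dense_seq u; have [v_ vP] := dense_seq v.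
  have inv1 n : inv_seq R n <= 1.
    by rewrite -[leRHS]invr1 lef_pV2 ?posrE// ler1n.
  have inv0 n : 0 <= inv_seq R n by rewrite invr_ge0.
  have small (f g f' g' : H) (p q : R) n : 0 <= p -> 0 <= q ->
      nm (f - f') <= p * inv_seq R n -> nm (g - g') <= q * inv_seq R n ->
      cm (inner f g - inner f' g') <= (p * (nm g + q) + nm f * q) * inv_seq R n.
    move=> p0 q0 ff gg.
    have -> : inner f g - inner f' g' = inner (f - f') g' + inner f (g - g').
      by rewrite innerBl innerBr; ring.
    have g'E : nm g' <= nm g + q.
      rewrite -[g'](subrK g) addrC (le_trans (nmD _ _))// lerD// nmB (le_trans gg)//.
      by rewrite ler_piMr.
    rewrite (le_trans (cmD _ _))// [leRHS]mulrDl lerD// (le_trans (inner_cs _ _))//.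
      rewrite mulrAC (le_trans (ler_wpM2r (nm_ge0 _) ff))// ler_wpM2l// mulr_ge0//.
    by rewrite -mulrA ler_wpM2l ?nm_ge0.
  have u1 n : nm (u - j (u_ n)) <= 1 * inv_seq R n by rewrite mul1r.
  have v1 n : nm (v - j (v_ n)) <= 1 * inv_seq R n by rewrite mul1r.
  have s1 n := small _ _ _ _ _ _ n (normr_ge0 (C b)) ler01 (near b u (u_ n) n (uP n)) (v1 n).
  have s2 n := small _ _ _ _ _ _ n ler01 (normr_ge0 (C b^*s)) (u1 n)
    (near b^*s v (v_ n) n (vP n)).
  apply: cm_null => n.
  have -> : inner (pi b u) v - inner u (pi b^*s v) =
    (inner (pi b u) v - inner (j (T b (u_ n))) (j (v_ n))) +
    - (inner u (pi b^*s v) - inner (j (u_ n)) (j (T b^*s (v_ n)))).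
    by rewrite Tstar; ring.
  rewrite (le_trans (cmD _ _))// cmN (le_trans (lerD (s1 n) (s2 n)))//.
  by rewrite -mulrDl.
Qed.

End DenseExtension.

Section Irreducible.
Variables (R : realType) (B : starAlgType R) (H : hilbertType R) (pi : B -> H -> H).
Hypotheses (rpi : is_representation pi) (ipi : is_irreducible pi).

(* Irreducible even for the restriction of [pi] to a left ideal [S]. *)
Lemma irr_dense_ideal (S : set B) v0 :
    S 0 -> (forall (k : R[i]) a b, S a -> S b -> S (k *: a + b)) ->
    (forall a b, S b -> S (a ⋅ b)) -> (exists2 b, S b & pi b v0 <> 0) ->
  forall h (e : R), 0 < e -> exists2 b, S b & nm (h - pi b v0) < e.
Proof.
move=> S0 SD SM [b0 Sb0 b0v0].
pose D := [set h | exists2 b, S b & h = pi b v0].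
have cW := @closure_subspace R H D; set W := [set h | _] in cW.
have {}cW : closed_subspace W.
  apply: cW; first by exists 0; rewrite // (rep0l rpi).
  move=> k _ _ [a Sa ->] [b Sb ->]; exists (k *: a + b); first exact: SD.
  by rewrite (repDl rpi) (repZl rpi).
have [|W0|WT] := ipi.2 W cW.
- move=> b h Wh e e0; have [C C0 bC] := rep_lipschitz rpi b.
  have C1 : 0 < C + 1 by rewrite ltr_wpDl.
  have [|_ [a Sa ->] ha] := Wh (e / (C + 1)); first by rewrite divr_gt0.
  exists (pi b (pi a v0)).
    by exists (b ⋅ a); [exact: SM|rewrite (rep_mul rpi)].
  rewrite -(repBr rpi) (le_lt_trans (bC _))// (@le_lt_trans _ _ ((C + 1) * nm (h - pi a v0)))//.
    by rewrite ler_wpM2r ?nm_ge0// lerDl.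
  by rewrite mulrC -ltr_pdivlMr.
- exfalso; apply: b0v0; have : W (pi b0 v0); last by rewrite W0.
  by move=> e e0; exists (pi b0 v0); rewrite ?subrr ?nm0//; exists b0.
- move=> h e e0; have : W h by rewrite WT.
  by move=> /(_ e e0)[_ [b Sb ->] hb]; exists b.
Qed.

(** As S is a right ideal, the vectors killed by S form a closed invariant subspace; it is not the
    whole space because S acts nontrivially. *)
Lemma irr_nondegenerate (S : set B) u :
    (forall a b, S a -> S (a ⋅ b)) -> (exists2 b, S b & exists v, pi b v <> 0) ->
  (forall b, S b -> pi b u = 0) -> u = 0.
Proof.
move=> SM [b0 Sb0 [v b0v]] Su.
pose W := [set h | forall b, S b -> pi b h = 0].
have [|W0|WT] := ipi.2 W (rep_ker_subspace rpi (erefl W)).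
- by move=> b h Wh a Sa; rewrite -(rep_mul rpi); apply: Wh; exact: SM.
- by have : W u by []; rewrite W0.
- exfalso; apply: b0v; have : W v by rewrite WT.
  by move=> /(_ b0 Sb0).
Qed.

End Irreducible.

(** * Passing between representations of A and of M(A) *)

Section MultiplierRepresentations.
Variables (R : realType) (A : cstarAlgType R).
Notation MA := (multiplier A).
Implicit Types (a : A) (b c : MA).

Lemma mult_inM a (c : A) : mult_in (a ⋅ c) = mult_in a * mult_in c.
Proof. by apply: multiplierP => u /=; rewrite amulA. Qed.

Lemma mult_in_star a : mult_in a^*s = (mult_in a)^*s.
Proof. by apply: multiplierP => u /=; rewrite astarM astarK. Qed.

Lemma mult_in_linear : linear (@mult_in R A).
Proof.
by move=> k a c; apply: multiplierP => u /=; rewrite (amulDl, amulDr) ?amulZl ?amulZr.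
Qed.

Lemma mult_in_lmul b a : mult_in (lmul b a) = b * mult_in a.
Proof. by apply: multiplierP => u /=; rewrite ?lmulM// rlmul. Qed.

Lemma mult_in_rmul b a : mult_in (rmul b a) = mult_in a * b.
Proof. by apply: multiplierP => u /=; rewrite ?rmulM// rlmul. Qed.

Lemma mult_in_inj a (c : A) : mult_in a = mult_in c -> a = c.
Proof.
move=> ac; apply/eqP; rewrite -subr_eq0; apply/eqP/nm0_eq0.
by rewrite -mult_inE (linB mult_in_linear) ac subrr N0.
Qed.

Lemma star_lmul b a (c : A) : (lmul b a)^*s ⋅ c = a^*s ⋅ lmul b^*s c.
Proof. by rewrite -rlmul /= astarK. Qed.

Section Positivity.
Variables (H : hilbertType R) (sg : MA -> H -> H).
Hypothesis rsg : is_representation sg.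

Lemma rep_M b c v : sg (b * c) v = sg b (sg c v).
Proof. exact: (rep_mul rsg). Qed.

Lemma rep_pos b v : pos b -> 0 <= rin (sg b v) v.
Proof.
move=> pb; have [k [pk <- _]] := pos_sqrt pb.
rewrite rep_M /rin (rep_star rsg) (pos_herm pk).
by rewrite inner_real sqr_ge0.
Qed.

Lemma rep_rs t b v : sg (rs A t * b) v = (t%:C)%C *: sg b v.
Proof. by rewrite rsE (repZl rsg). Qed.

(** A representation need not be unital, but [sg 1] is a projection. Under irreducibility it is the
    identity, by [rep_one]. *)
Lemma rep_one_le v : rin (sg 1 v) v <= nm v ^+ 2.
Proof.
have e : nm (sg 1 v) ^+ 2 = rin (sg 1 v) v.
  by rewrite (rep_nm_sqr rsg) mstar1; congr (rin (sg _ v) v); exact: mulr1.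
have := rin_cs (sg 1 v) v; rewrite -e expr2.
have [->|n0] := eqVneq (nm (sg 1 v)) 0; first by rewrite mul0r sqr_ge0.
have np : 0 < nm (sg 1 v) by rewrite lt_def n0 nm_ge0.
rewrite ler_pM2l// => h; rewrite expr2; apply: ler_pM => //; exact: nm_ge0.
Qed.

Lemma rep_le b t v : 0 <= t -> pos (rs A t - b) -> rin (sg b v) v <= t * nm v ^+ 2.
Proof.
move=> t0 pb; have := rep_pos v pb; rewrite (repBl rsg) rinDl rinNl subr_ge0 => h; apply: le_trans h _.
have -> : sg (rs A t) v = (t%:C)%C *: sg 1 v by rewrite -rep_rs mulr1.
by rewrite rinZl ler_wpM2l// rep_one_le.
Qed.

Lemma rep_contract b v : nm (sg b v) <= N b * nm v.
Proof.
rewrite -(ler_pXn2r (n := 2))// ?nnegrE ?mulr_ge0 ?nm_ge0 ?N_ge0//.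
rewrite (rep_nm_sqr rsg) exprMn; apply: rep_le; first exact: sqr_ge0.
by apply: N_pos_sub; [exact: (pos_herm (pos_sqr b))|rewrite -[b^*s ⋅ b]/(b^*s * b) N_Cstar].
Qed.

Lemma rep_one (isg : is_irreducible sg) v : sg 1 v = v.
Proof.
apply/eqP; rewrite -subr_eq0; apply/eqP.
apply: (irr_nondegenerate rsg isg (S := setT)) => //.
  by have [b [w bw]] := isg.1; exists b => //; exists w.
by move=> b _; rewrite (repBr rsg) -rep_M mulr1 subrr.
Qed.

Lemma rep_in : is_representation (fun a => sg (mult_in a)).
Proof.
split.
- by move=> v k a c /=; rewrite mult_in_linear (repDl rsg) (repZl rsg).
- by move=> a; exact: (rep_linearr rsg).
- by move=> a; exact: (rep_bounded rsg).
- by move=> a c v /=; rewrite mult_inM rep_M.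
- by move=> a u v; rewrite (rep_star rsg) mult_in_star.
Qed.

End Positivity.

(** Choose v0 not killed by A; the vectors pi a v0 are dense, and b sends pi a v0 to pi (b a) v0.
    Subspaces invariant under M(A) are invariant under A, so irreducibility is inherited. *)
Lemma prim_extend (P : prim A) : exists (H : hilbertType R) (sg : MA -> H -> H),
  [/\ is_representation sg, is_irreducible sg,
      forall a, prim_ideal P a <-> forall v, sg (mult_in a) v = 0 &
      rep_ker sg = ideal_tilde (prim_ideal P)].
Proof.
have [H [pi [rpi ipi PE]]] := primP P; exists H.
have [a0 [v0 a0v0]] := ipi.1.
pose T b a := lmul b a.
have pdense : forall h (e : R), 0 < e -> exists a, nm (h - pi a v0) < e.
  move=> h e e0.
  have [||||a _ ha] := irr_dense_ideal rpi ipi (S := setT) (v0 := v0) _ _ _ _ h e0 => //.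
    by exists a0.
  by exists a.
have Tbound b a : nm (pi (T b a) v0) <= N b * nm (pi a v0).
  rewrite -(ler_pXn2r (n := 2))// ?nnegrE ?mulr_ge0 ?nm_ge0 ?N_ge0//.
  have pb : pos (rs A (N b ^+ 2) - b^*s * b).
    by apply: N_pos_sub; [exact: (pos_herm (pos_sqr b))|rewrite N_Cstar].
  (* The representation acts only on A, so the inequality b^* b <= N(b)^2 is carried into A through
     a root w of the difference: N(b)^2 a^* a - (b a)^* (b a) = (w a)^* (w a). *)
  have [w [pw ww _]] := pos_sqrt pb.
  have E : (lmul b a)^*s ⋅ lmul b a = (((N b ^+ 2)%:C)%C *: (a^*s ⋅ a)) - (lmul w a)^*s ⋅ lmul w a.
    apply: mult_in_inj; rewrite (linB mult_in_linear) (linZ mult_in_linear).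
    rewrite !mult_inM !mult_in_star !mult_in_lmul -rsE !mstarM (pos_herm pw).
    have -> : (mult_in a)^*s * w * (w * mult_in a) = (mult_in a)^*s * (w * w) * mult_in a.
      by rewrite !mulrA.
    by rewrite ww mulrBr mulrBl -rsC !mulrA; zmod.
  rewrite !(rep_nm_sqr rpi) E (repBl rpi) (repZl rpi) rinDl rinNl rinZl exprMn (rep_nm_sqr rpi).
  by rewrite lerBlDr lerDl -(rep_nm_sqr rpi) sqr_ge0.
have jlin : linear (fun a => pi a v0) by exact: (rep_linearl rpi).
have [||||sg rsg sgP] := @dense_representation _ _ _ _ jlin pdense MA T (@N R A) _ _ _ _ Tbound.
- by move=> a k b c.
- by move=> b; exact: lmul_linear.
- by [].
- move=> b a c /=; rewrite !(rep_star rpi) -!(rep_mul rpi).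
  by rewrite /T star_lmul.
exists sg.
have sgin a h : sg (mult_in a) h = pi a h.
  have [C1 C10 C1P] := rep_lipschitz rsg (mult_in a).
  have [C2 C20 C2P] := rep_lipschitz rpi a.
  apply: (dense_eq (j := fun a => pi a v0) pdense (C := C1 + C2)) => [u v|u v|v].
  - by rewrite -(repBr rsg) (le_trans (C1P _))// ler_wpM2r ?nm_ge0// lerDl.
  - by rewrite -(repBr rpi) (le_trans (C2P _))// ler_wpM2r ?nm_ge0// lerDr.
  - by rewrite sgP /T/= (rep_mul rpi).
split=> //.
- split; first by exists (mult_in a0), v0; rewrite sgin.
  move=> W cW Winv; apply: (ipi.2 W cW) => a v Wv.
  by rewrite -sgin; exact: Winv.
- by move=> a; rewrite PE; split => h v; [rewrite sgin|rewrite -sgin]; exact: h.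
- apply/seteqP; split => b bP.
  + move=> a; rewrite PE; split => v /=; rewrite -sgin (mult_in_lmul, mult_in_rmul) rep_M// bP//.
    by rewrite (rep0 rsg).
  + move=> h; have [C C0 CP] := rep_lipschitz rsg b.
    apply: (dense_eq (j := fun a => pi a v0) pdense (G := fun=> 0) (C := C)) => [u v|u v|a].
    * by rewrite -(repBr rsg).
    * by rewrite subrr nm0 mulr_ge0 ?nm_ge0.
    * by rewrite sgP /T; have [+ _] := bP a; rewrite PE; apply.
Qed.

(** No nonzero vector is killed by A, and by [irr_dense_ideal] for the ideal A the orbit of a
    nonzero vector under A is already dense; this gives irreducibility of the restriction and, with
    it, the description of the kernel. *)
Lemma prim_restrict (H : hilbertType R) (sg : MA -> H -> H) :
    is_representation sg -> is_irreducible sg -> (exists a v, sg (mult_in a) v <> 0) ->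
  exists P : prim A, (forall a, prim_ideal P a <-> forall v, sg (mult_in a) v = 0) /\
    rep_ker sg = ideal_tilde (prim_ideal P).
Proof.
move=> rsg isg [a0 [v0 a0v0]].
have rpi := rep_in rsg.
pose S := [set b | exists a, b = mult_in a].
have SL b c : S c -> S (b * c) by move=> [a ->]; exists (lmul b a); rewrite mult_in_lmul.
have SR b c : S b -> S (b * c) by move=> [a ->]; exists (rmul c a); rewrite mult_in_rmul.
have S0 : S 0 by exists 0; rewrite (lin0 mult_in_linear).
have SD (k : R[i]) b c : S b -> S c -> S (k *: b + c).
  by move=> [a ->] [d ->]; exists (k *: a + d); rewrite mult_in_linear.
have nd u : (forall a, sg (mult_in a) u = 0) -> u = 0.
  move=> u0; apply: (irr_nondegenerate rsg isg (S := S)) => //.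
    by exists (mult_in a0); [exists a0|exists v0].
  by move=> _ [a ->].
have ipi : is_irreducible (fun a => sg (mult_in a)).
  split; first by exists a0, v0.
  move=> W [W0 WD Wcl] Winv.
  have [WE|/set0P[w []]] := eqVneq (W `\ 0) set0.
    left; apply/seteqP; split => [w Ww|_ ->//]; apply: contrapT => w0.
    by have : (W `\ 0) w by []; rewrite WE.
  move=> Ww w0; right; apply/seteqP; split=> // h _.
  apply: Wcl => U /nbhs_normP[e /= e0 eU].
  have Ee : (((complex.Re e))%:C)%C = e by rewrite RRe_real ?gtr0_real.
  have [|||||_ [a ->] ha] := irr_dense_ideal rsg isg (S := S) (v0 := w) _ _ _ _ h (e := complex.Re e) => //.
  - have : exists a, sg (mult_in a) w <> 0.
      by apply/not_existsP => wa; apply: w0; apply: nd => a; apply: contrapT; exact: wa.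
    by move=> [a aw]; exists (mult_in a) => //; exists a.
  - by rewrite -ltcR Ee.
  exists (sg (mult_in a) w); split; first exact: Winv.
  by apply: eU; rewrite /ball_/= -Ee -nm_lt.
have PP : is_primitive (rep_ker (fun a => sg (mult_in a))).
  by exists H, (fun a => sg (mult_in a)).
exists (Prim PP); split => //=.
apply/seteqP; split => b bP.
- move=> a; split => v /=; rewrite (mult_in_lmul, mult_in_rmul) rep_M// bP//.
  by rewrite (rep0 rsg).
- move=> h; apply: nd => a; rewrite -rep_M// -mult_in_rmul.
  by have [_] := bP a; apply.
Qed.

End MultiplierRepresentations.

(** * Completion of a pre-Hilbert space *)

Lemma real_complete (R : realType) (u : nat -> R) (eps : nat -> R) : vanish eps ->
    (forall n m, (n <= m)%N -> `|u m - u n| <= eps n) ->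
  exists l, forall n, `|l - u n| <= eps n.
Proof.
move=> v_eps ueps.
have : cauchy (u n @[n --> \oo]).
  apply: cauchy_exP => e e0.
  have [n0 h] := v_eps e e0.
  exists (u n0); exists n0 => // n n0n /=; rewrite /ball/= distrC.
  exact: le_lt_trans (ueps _ _ n0n) (h _ (leqnn _)).
move=> /cauchy_cvg/cvg_ex[l /cvgrPdist_lt ul]; exists l => n.
apply/ler_addgt0Pr => e e0.
have [n1 _ h] := ul e e0.
have h1 := h (maxn n1 n) (leq_maxl _ _).
rewrite -(subrKA (u (maxn n1 n))) (le_trans (ler_normD _ _))// addrC lerD//.
  exact/ueps/leq_maxr.
exact: ltW.
Qed.

Lemma complex_complete (R : realType) (z : nat -> R[i]) (eps : nat -> R) : vanish eps ->
    (forall n m, (n <= m)%N -> cm (z m - z n) <= eps n) ->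
  exists l, forall n, cm (l - z n) <= 2 * eps n.
Proof.
move=> v_eps zeps.
have Re_le (k : R[i]) : `|complex.Re k| <= cm k.
  by rewrite -(ler_pXn2r (n := 2))// ?nnegrE ?cm_ge0// cm_sqr real_normK ?num_real// lerDl sqr_ge0.
have Im_le (k : R[i]) : `|complex.Im k| <= cm k.
  by rewrite -(ler_pXn2r (n := 2))// ?nnegrE ?cm_ge0// cm_sqr real_normK ?num_real// lerDr sqr_ge0.
have [n m nm|x xP] := @real_complete R (fun n => complex.Re (z n)) eps v_eps.
  by rewrite -raddfB (le_trans (Re_le _))// zeps.
have [n m nm|y yP] := @real_complete R (fun n => complex.Im (z n)) eps v_eps.
  by rewrite -raddfB (le_trans (Im_le _))// zeps.
exists (Complex x y) => n; have := xP n; have := yP n.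
case: (z n) => a b /= yb xa; rewrite mulr2n mulrDl mul1r.
have -> : Complex x y - Complex a b = Complex (x - a) 0 + Complex 0 (y - b).
  by apply/eqP; rewrite eq_complex/= addr0 add0r !eqxx.
rewrite (le_trans (cmD _ _))// lerD// /cm normc_def/= expr0n/= ?addr0 ?add0r.
  by rewrite sqrtr_sqr.
by rewrite sqrtr_sqr.
Qed.

Record semi_inner (R : realType) (V : lmodType R[i]) := SemiInner {
  form :> V -> V -> R[i];
  formDl : forall u v w, form (u + v) w = form u w + form v w;
  formZl : forall (k : R[i]) u v, form (k *: u) v = k * form u v;
  formC : forall u v, form v u = (form u v)^*;
  form_ge0 : forall u, 0 <= complex.Re (form u u)
}.

(* The completion is realized by the antilinear functionals that can be
   approximated by functionals [form b _]. *)
Section Completion.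
Variables (R : realType) (V : lmodType R[i]) (s : semi_inner V).

Let sDl := formDl s.
Let sZl := formZl s.
Let sC := formC s.
Let s_ge0 := form_ge0 s.

Local Notation inv n := (inv_seq R n).

Lemma inv_ge0 n : 0 <= inv n.
Proof. by rewrite invr_ge0. Qed.

Lemma inv_gt0 n : 0 < inv n.
Proof. by rewrite invr_gt0. Qed.

Lemma inv_le1 n : inv n <= 1.
Proof. by rewrite -[leRHS]invr1 lef_pV2 ?posrE// ler1n. Qed.

Definition fdist (g : V -> R[i]) b (e : R) := forall c, cm (g c - s b c) <= e * sn s c.

Definition approximable g := forall e : R, 0 < e -> exists b, fdist g b e.

Record completion := Completion { cfun :> V -> R[i]; cfunP : approximable cfun }.

HB.instance Definition _ := gen_eqMixin completion.
HB.instance Definition _ := gen_choiceMixin completion.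

Lemma completion_eq (g h : completion) : (forall c, g c = h c) -> g = h.
Proof.
case: g => g gP; case: h => h hP /= /funext gh; subst.
by congr Completion; exact: Prop_irrelevance.
Qed.

Lemma completion_seq (g : completion) : exists b : nat -> V, forall n, fdist g (b n) (inv n).
Proof.
suff /choice[b bP] n : exists b, fdist g b (inv n) by exists b.
exact/cfunP/inv_gt0.
Qed.

Lemma fdistD g h b c d e : fdist g b d -> fdist h c e -> fdist (fun x => g x + h x) (b + c) (d + e).
Proof.
move=> gb hc x; rewrite sDl mulrDl.
have -> : g x + h x - (s b x + s c x) = (g x - s b x) + (h x - s c x) by zmod.
by rewrite (le_trans (cmD _ _))// lerD.
Qed.

Lemma fdistZ (k : R[i]) g b e : fdist g b e -> fdist (fun x => k * g x) (k *: b) (cm k * e).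
Proof. by move=> gb x; rewrite sZl -mulrBr cmM -mulrA ler_wpM2l ?cm_ge0. Qed.

Lemma fdistN g b e : fdist g b e -> fdist (fun x => - g x) (- b) e.
Proof. by move=> gb x; rewrite (sNl sZl) -opprD cmN. Qed.

Lemma fdist_form b : fdist (s b) b 0.
Proof. by move=> x; rewrite subrr mul0r cm_real normr0. Qed.

Program Definition compl0 := @Completion (fun=> 0) _.
Next Obligation.
move=> e e0; exists 0 => c; rewrite (s0l sZl) subrr cm_real normr0.
by rewrite mulr_ge0 ?sn_ge0// ltW.
Qed.

Program Definition complD (g h : completion) := @Completion (fun x => g x + h x) _.
Next Obligation.
move=> g h e e0; have e2 : 0 < e / 2 by rewrite divr_gt0.
have [b gb] := cfunP g e2; have [c hc] := cfunP h e2.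
by exists (b + c); rewrite [e]splitr; exact: fdistD.
Qed.

Program Definition complN (g : completion) := @Completion (fun x => - g x) _.
Next Obligation. by move=> g e /(cfunP g)[b gb]; exists (- b); exact: fdistN. Qed.

Program Definition complZ (k : R[i]) (g : completion) := @Completion (fun x => k * g x) _.
Next Obligation.
move=> k g e e0; have k1 : 0 < cm k + 1 by rewrite ltr_wpDl ?cm_ge0.
have [b gb] := cfunP g (divr_gt0 e0 k1).
exists (k *: b) => c; apply: le_trans (fdistZ k gb c) _.
rewrite ler_wpM2r ?sn_ge0// mulrCA ler_piMr ?(ltW e0)// ler_pdivrMr// mul1r lerDl//.
Qed.

Lemma complDA : associative complD.
Proof. by move=> f g h; apply: completion_eq => c /=; rewrite addrA. Qed.

Lemma complDC : commutative complD.
Proof. by move=> f g; apply: completion_eq => c /=; rewrite addrC. Qed.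

Lemma complD0 : left_id compl0 complD.
Proof. by move=> f; apply: completion_eq => c /=; rewrite add0r. Qed.

Lemma complDN : left_inverse compl0 complN complD.
Proof. by move=> f; apply: completion_eq => c /=; rewrite addNr. Qed.

HB.instance Definition _ := GRing.isZmodule.Build completion complDA complDC complD0 complDN.

Lemma complZA k l f : complZ k (complZ l f) = complZ (k * l) f.
Proof. by apply: completion_eq => c /=; rewrite mulrA. Qed.

Lemma complZ1 : left_id 1 complZ.
Proof. by move=> f; apply: completion_eq => c /=; rewrite mul1r. Qed.

Lemma complZDr : right_distributive complZ +%R.
Proof. by move=> k f g; apply: completion_eq => c /=; rewrite mulrDr. Qed.

Lemma complZDl f : {morph complZ^~ f : k l / k + l}.
Proof. by move=> k l; apply: completion_eq => c /=; rewrite mulrDl. Qed.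

HB.instance Definition _ := GRing.Zmodule_isLmodule.Build R[i] completion
  complZA complZ1 complZDr complZDl.

Lemma sn_fdist b c (d e : R) g : 0 <= d -> 0 <= e ->
  fdist g b d -> fdist g c e -> sn s (b - c) <= d + e.
Proof.
move=> d0 e0 gb gc; have [->|nz] := eqVneq (sn s (b - c)) 0; first exact: addr_ge0.
have sp : 0 < sn s (b - c) by rewrite lt_def nz sn_ge0.
rewrite -(ler_pM2r sp) -expr2 (sn_sqr s_ge0) (le_trans (Re_cm _))// (sBl sDl sZl).
have -> : s b (b - c) - s c (b - c) = (g (b - c) - s c (b - c)) - (g (b - c) - s b (b - c)).
  by zmod.
by rewrite (le_trans (cmD _ _))// cmN addrC mulrDl lerD.
Qed.

Lemma form_dist b c b' c' :
  cm (s b' c' - s b c) <= sn s (b' - b) * sn s c' + sn s b * sn s (c' - c).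
Proof.
have -> : s b' c' - s b c = s (b' - b) c' + s b (c' - c).
  by rewrite (sBl sDl sZl) (sBr sDl sZl sC); zmod.
by rewrite (le_trans (cmD _ _))// lerD// (cauchy_schwarz sDl sZl sC s_ge0).
Qed.

Lemma sn_near b c (d e : R) g : 0 <= d -> 0 <= e ->
  fdist g b d -> fdist g c e -> sn s b <= sn s c + (d + e).
Proof.
move=> d0 e0 gb gc; rewrite -[b](subrK c) addrC (le_trans (snD sDl sZl sC s_ge0 _ _))//.
by rewrite lerD// (sn_fdist d0 e0 gb gc).
Qed.

(** The inner product is a limit of values of s. Its estimate is required of all approximations,
    with an explicit error, so that each law of the inner product follows from the same law for s
    along sequences. *)
Lemma inner_exists (g h : completion) : exists z : R[i], forall b c d e,
  0 <= d -> 0 <= e -> fdist g b d -> fdist h c e ->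
  cm (z - s b c) <= d * (sn s c + e) + sn s b * e.
Proof.
have [b bP] := completion_seq g; have [c cP] := completion_seq h.
pose Kb := sn s (b 0%N) + 2; pose Kc := sn s (c 0%N) + 2.
have inv2 n : inv n + inv 0%N <= 2 by rewrite mulr2n lerD ?inv_le1.
have bK n : sn s (b n) <= Kb.
  rewrite (le_trans (sn_near _ _ (bP n) (bP 0%N)))// ?inv_ge0// lerD//.
have cK n : sn s (c n) <= Kc.
  rewrite (le_trans (sn_near _ _ (cP n) (cP 0%N)))// ?inv_ge0// lerD//.
have Kb0 : 0 <= Kb by rewrite addr_ge0 ?sn_ge0.
have Kc0 : 0 <= Kc by rewrite addr_ge0 ?sn_ge0.
pose eps n := (inv n + inv n) * Kc + Kb * (inv n + inv n).
have veps : vanish eps.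
  by apply: vanishD; [apply: vanishZr|apply: vanishZ] => //; apply: vanishD; exact: vanish_invn.
have inv_mono n m : (n <= m)%N -> inv m <= inv n.
  by move=> nm; rewrite lef_pV2 ?posrE// ler_nat.
have [n m nm|z zP] := @complex_complete _ (fun n => s (b n) (c n)) eps veps.
  have h1 : inv m + inv n <= inv n + inv n by rewrite lerD2r inv_mono.
  rewrite (le_trans (form_dist _ _ _ _))// lerD// ler_pM ?sn_ge0//.
    by rewrite (le_trans (sn_fdist _ _ (bP m) (bP n))) ?inv_ge0.
  by rewrite (le_trans (sn_fdist _ _ (cP m) (cP n))) ?inv_ge0.
exists z => b' c' d e d0 e0 gb hc; rewrite -subr_le0.
apply: (vanish_ge0 (f := fun n => 2 * eps n + (inv n * Kc + (d + sn s b') * inv n))).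
  apply: vanishD; first exact: vanishZ.
  apply: vanishD; [apply: vanishZr => //|apply: vanishZ; rewrite ?addr_ge0 ?sn_ge0//];
    exact: vanish_invn.
move=> n; rewrite lerBlDr.
have -> : z - s b' c' = (z - s (b n) (c n)) + (s (b n) (c n) - s b' c') by zmod.
rewrite (le_trans (cmD _ _))// -addrA lerD// (le_trans (form_dist _ _ _ _))//.
have x1 := sn_fdist (inv_ge0 n) d0 (bP n) gb.
have x2 := sn_fdist (inv_ge0 n) e0 (cP n) hc.
have x3 := sn_near (inv_ge0 n) e0 (cP n) hc.
have y1 := cK n; have y2 := inv_ge0 n; have y3 := sn_ge0 s (c n); have y4 := sn_ge0 s b'.
have y5 := sn_ge0 s (b n - b').
have z1 : sn s (b n - b') * sn s (c n) <= inv n * Kc + d * (sn s c' + (inv n + e)).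
  rewrite (le_trans (ler_wpM2r y3 x1))// mulrDl lerD ?ler_wpM2l//.
have z2 : sn s b' * sn s (c n - c') <= sn s b' * (inv n + e) by rewrite ler_wpM2l.
by rewrite (le_trans (lerD z1 z2))// le_eqVlt; apply/orP; left; apply/eqP; ring.
Qed.

Definition cinner (g h : completion) : R[i] := projT1 (cid (inner_exists g h)).

Lemma cinnerP (g h : completion) b c d e :
  0 <= d -> 0 <= e -> fdist g b d -> fdist h c e ->
  cm (cinner g h - s b c) <= d * (sn s c + e) + sn s b * e.
Proof. exact: (projT2 (cid (inner_exists g h))). Qed.

Lemma cinner_seq (g h : completion) (b c : nat -> V) p q : 0 <= p -> 0 <= q ->
    (forall n, fdist g (b n) (p * inv n)) -> (forall n, fdist h (c n) (q * inv n)) ->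
  exists K, forall n, cm (cinner g h - s (b n) (c n)) <= K * inv n.
Proof.
move=> p0 q0 gb hc.
exists (p * (sn s (c 0%N) + 3 * q) + (sn s (b 0%N) + 2 * p) * q) => n.
have pi0 m : 0 <= p * inv m by rewrite mulr_ge0 ?inv_ge0.
have qi0 m : 0 <= q * inv m by rewrite mulr_ge0 ?inv_ge0.
rewrite (le_trans (cinnerP (pi0 n) (qi0 n) (gb n) (hc n)))//.
have pi1 m : p * inv m <= p by rewrite ler_piMr// inv_le1.
have qi1 m : q * inv m <= q by rewrite ler_piMr// inv_le1.
have x1 := sn_near (pi0 n) (pi0 0%N) (gb n) (gb 0%N).
have x2 := sn_near (qi0 n) (qi0 0%N) (hc n) (hc 0%N).
have x3 : sn s (c n) + q * inv n <= sn s (c 0%N) + 3 * q.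
  have := qi1 n; have := qi1 0%N; lra.
have x4 : sn s (b n) <= sn s (b 0%N) + 2 * p by have := pi1 n; have := pi1 0%N; lra.
have -> : (p * (sn s (c 0%N) + 3 * q) + (sn s (b 0%N) + 2 * p) * q) * inv n =
  (p * inv n) * (sn s (c 0%N) + 3 * q) + (sn s (b 0%N) + 2 * p) * (q * inv n) by ring.
by rewrite lerD// ?ler_wpM2l ?ler_wpM2r.
Qed.

Lemma fdist_seq1 (g : V -> R[i]) (b : nat -> V) :
  (forall n, fdist g (b n) (inv n)) -> forall n, fdist g (b n) (1 * inv n).
Proof. by move=> gb n; rewrite mul1r. Qed.

Lemma cinnerDl (f g h : completion) : cinner (f + g) h = cinner f h + cinner g h.
Proof.
have [a aP] := completion_seq f; have [b bP] := completion_seq g; have [c cP] := completion_seq h.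
have [K1 K1P] := cinner_seq ler01 ler01 (fdist_seq1 aP) (fdist_seq1 cP).
have [K2 K2P] := cinner_seq ler01 ler01 (fdist_seq1 bP) (fdist_seq1 cP).
have abP n : fdist (f + g) (a n + b n) (2 * inv n).
  by rewrite mulr2n mulrDl !mul1r; exact: fdistD.
have [K3 K3P] := cinner_seq (ler0n _ 2) ler01 abP (fdist_seq1 cP).
apply/eqP; rewrite -subr_eq0; apply/eqP; apply: (@cm_null _ _ (K3 + (K1 + K2))) => n.
have -> : cinner (f + g) h - (cinner f h + cinner g h) =
  (cinner (f + g) h - s (a n + b n) (c n)) +
  (- (cinner f h - s (a n) (c n)) + - (cinner g h - s (b n) (c n))).
  by rewrite sDl; zmod.
rewrite !mulrDl (le_trans (cmD _ _))// lerD// (le_trans (cmD _ _))// !cmN lerD//.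
Qed.

Lemma cinnerZl k (f h : completion) : cinner (k *: f) h = k * cinner f h.
Proof.
have [a aP] := completion_seq f; have [c cP] := completion_seq h.
have [K1 K1P] := cinner_seq ler01 ler01 (fdist_seq1 aP) (fdist_seq1 cP).
have kaP n : fdist (k *: f) (k *: a n) (cm k * inv n) by exact: fdistZ.
have [K3 K3P] := cinner_seq (cm_ge0 k) ler01 kaP (fdist_seq1 cP).
apply/eqP; rewrite -subr_eq0; apply/eqP; apply: (@cm_null _ _ (K3 + cm k * K1)) => n.
have -> : cinner (k *: f) h - k * cinner f h =
  (cinner (k *: f) h - s (k *: a n) (c n)) + - (k * (cinner f h - s (a n) (c n))).
  by rewrite sZl; ring.
rewrite mulrDl (le_trans (cmD _ _))// lerD// cmN cmM -mulrA ler_wpM2l ?cm_ge0//.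
Qed.

Lemma cm_conj (k : R[i]) : cm k^* = cm k.
Proof. by rewrite /cm !normc_def; case: k => x y /=; rewrite sqrrN. Qed.

Lemma cinnerC (g h : completion) : cinner h g = (cinner g h)^*.
Proof.
have [a aP] := completion_seq g; have [c cP] := completion_seq h.
have [K1 K1P] := cinner_seq ler01 ler01 (fdist_seq1 aP) (fdist_seq1 cP).
have [K2 K2P] := cinner_seq ler01 ler01 (fdist_seq1 cP) (fdist_seq1 aP).
apply/eqP; rewrite -subr_eq0; apply/eqP; apply: (@cm_null _ _ (K2 + K1)) => n.
have -> : cinner h g - (cinner g h)^* =
  (cinner h g - s (c n) (a n)) + - (cinner g h - s (a n) (c n))^*.
  by rewrite rmorphB/= -sC; zmod.
by rewrite mulrDl (le_trans (cmD _ _))// lerD// cmN cm_conj.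
Qed.

Lemma cinner_ge0 (g : completion) : 0 <= complex.Re (cinner g g).
Proof.
have [a aP] := completion_seq g.
have [K KP] := cinner_seq ler01 ler01 (fdist_seq1 aP) (fdist_seq1 aP).
rewrite -oppr_le0; apply: (vanish_ge0 (f := fun n => `|K| * inv n)).
  by apply: vanishZ => //; exact: vanish_invn.
move=> n; have := Re_cm (- (cinner g g - s (a n) (a n))).
rewrite cmN opprB raddfB/= => h; have := s_ge0 (a n).
have := KP n; have : K * inv n <= `|K| * inv n by rewrite ler_wpM2r ?inv_ge0// ler_norm.
lra.
Qed.

(** Vectors at seminorm distance 0 define the same functional, so null vectors are divided out
    without forming a quotient. *)
Program Definition cembed b := @Completion (s b) _.
Next Obligation.
move=> b e e0; exists b => c; apply: le_trans (fdist_form b c) _.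
by rewrite ler_wpM2r ?sn_ge0// ltW.
Qed.

Lemma cembed_linear : linear cembed.
Proof. by move=> k b c; apply: completion_eq => x /=; rewrite sDl sZl. Qed.

Lemma cinner_embedr (g : completion) c : cinner g (cembed c) = g c.
Proof.
have [a aP] := completion_seq g.
apply/eqP; rewrite -subr_eq0; apply/eqP; apply: (@cm_null _ _ (sn s c + sn s c)) => n.
have -> : cinner g (cembed c) - g c = (cinner g (cembed c) - s (a n) c) + - (g c - s (a n) c) by zmod.
rewrite mulrDl (le_trans (cmD _ _))// lerD// ?cmN.
  have := @cinnerP g (cembed c) _ c _ 0 (inv_ge0 n) (lexx 0) (aP n) (fdist_form c).
  by rewrite mulr0 !addr0 mulrC.
by rewrite mulrC; exact: aP.
Qed.

Lemma cinner_embed b c : cinner (cembed b) (cembed c) = s b c.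
Proof. by rewrite cinner_embedr. Qed.

Lemma sn_embed b : sn cinner (cembed b) = sn s b.
Proof. by rewrite /sn cinner_embed. Qed.

(** For a_n approximating g, the number s a_n a_n is close to g a_n, hence at most about e times the
    seminorm of a_n; it also tends to the square of the norm of g. *)
Lemma sn_le_fdist (g : completion) (e : R) : 0 <= e ->
  (forall c, cm (g c) <= e * sn s c) -> sn cinner g <= e.
Proof.
move=> e0 ge; have [a aP] := completion_seq g.
have [K KP] := cinner_seq ler01 ler01 (fdist_seq1 aP) (fdist_seq1 aP).
rewrite -(ler_pXn2r (n := 2))// ?nnegrE ?sn_ge0// (sn_sqr cinner_ge0).
rewrite -subr_le0; pose M := sn s (a 0%N) + 2.
apply: (vanish_ge0 (f := fun n => (3 * `|K| + 2 * M) * inv n)).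
  apply: vanishZ; last exact: vanish_invn.
  by rewrite !(addr_ge0, mulr_ge0)// sn_ge0.
move=> n; have aM : sn s (a n) <= M.
  rewrite (le_trans (sn_near (inv_ge0 n) (inv_ge0 0%N) (aP n) (aP 0%N)))// lerD//.
  by rewrite mulr2n lerD ?inv_le1.
have h1 := Re_cm (cinner g g - s (a n) (a n)).
have h2 := Re_cm (- (cinner g g - s (a n) (a n))).
rewrite cmN opprB raddfB/= in h2; rewrite raddfB/= in h1.
have h3 := KP n; have h4 : K * inv n <= `|K| * inv n by rewrite ler_wpM2r ?inv_ge0// ler_norm.
have h5 := Re_cm (s (a n) (a n)).
have h6 : cm (s (a n) (a n)) <= inv n * sn s (a n) + e * sn s (a n).
  have -> : s (a n) (a n) = - (g (a n) - s (a n) (a n)) + g (a n) by zmod.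
  by rewrite (le_trans (cmD _ _))// cmN lerD// aP.
have h7 := sn_sqr s_ge0 (a n).
have h8 : inv n * sn s (a n) <= inv n * M by rewrite ler_wpM2l ?inv_ge0.
have h9 : 0 <= (e - sn s (a n)) ^+ 2 by rewrite sqr_ge0.
rewrite -h7 in h1 h2 h5.
have -> : (3 * `|K| + 2 * M) * inv n = 3 * (`|K| * inv n) + 2 * (inv n * M) by ring.
have k0 : 0 <= `|K| * inv n by rewrite mulr_ge0 ?inv_ge0.
move: (sn s (a n)) h1 h3 h4 h5 h6 h8 h9 => t h1 h3 h4 h5 h6 h8 h9.
have h10 : t ^+ 2 <= 2 * (inv n * M) + e ^+ 2 by nra.
lra.
Qed.

Definition cnorm (g : completion) : R[i] := ((sn cinner g)%:C)%C.

Lemma cnormD g h : cnorm (g + h) <= cnorm g + cnorm h.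
Proof. by rewrite -rmorphD lecR (snD cinnerDl cinnerZl cinnerC cinner_ge0). Qed.

Lemma cnormZ k g : cnorm (k *: g) = `|k| * cnorm g.
Proof. by rewrite /cnorm (snZ cinnerZl cinnerC cinner_ge0) rmorphM/= cmE. Qed.

Lemma cm_eval (g : completion) c : cm (g c) <= sn cinner g * sn s c.
Proof.
rewrite -cinner_embedr -sn_embed.
exact: (cauchy_schwarz cinnerDl cinnerZl cinnerC cinner_ge0).
Qed.

Lemma cnorm0_eq0 g : cnorm g = 0 -> g = 0.
Proof.
move=> /complexI g0; apply: completion_eq => c; apply: cm0_eq0; apply/eqP.
by rewrite eq_le cm_ge0 andbT (le_trans (cm_eval g c))// g0 mul0r.
Qed.

HB.instance Definition _ := Lmodule_isNormed.Build R[i] completion cnormD cnormZ cnorm0_eq0.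

Lemma nm_completion (g : completion) : nm g = sn cinner g.
Proof. by []. Qed.

Lemma completion_complete (F : set_system completion) : ProperFilter F -> cauchy F -> cvg F.
Proof.
move=> FF Fc.
have Fball n : exists g : completion, F (ball g ((inv n)%:C)%C).
  by apply: ((cauchyP F).1 Fc); rewrite ltcR inv_gt0.
have /choice[g gP] := Fball.
have near2 n m : sn cinner (g m - g n) <= inv n + inv m.
  have [f [fn fm]] : (ball (g n) ((inv n)%:C)%C `&` ball (g m) ((inv m)%:C)%C) !=set0.
    exact: (@filter_ex _ F FF _ (filterI (gP n) (gP m))).
  move: fn fm; rewrite -!ball_normE /ball_/= -!nm_lt => /ltW fn /ltW fm.
  rewrite -nm_completion (le_trans (nm_dist_tri f _ _))// addrC lerD// nmB//.
have near_eval n m c : cm (g m c - g n c) <= (inv n + inv m) * sn s c.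
  by rewrite (le_trans (cm_eval (g m - g n) c))// ler_wpM2r ?sn_ge0.
have inv_mono n m : (n <= m)%N -> inv m <= inv n.
  by move=> nm; rewrite lef_pV2 ?posrE// ler_nat.
have /choice[l lP] c : exists l, forall n, cm (l - g n c) <= 2 * ((inv n + inv n) * sn s c).
  apply: (complex_complete (z := fun n => g n c) (eps := fun n => (inv n + inv n) * sn s c)).
    by apply: vanishZr; [exact: sn_ge0|apply: vanishD; exact: vanish_invn].
  move=> n m nm; rewrite (le_trans (near_eval n m c))// ler_wpM2r ?sn_ge0// lerD2l.
  exact: inv_mono.
have lapp : approximable l.
  (* The limit l is within 4 / (n + 1) of g_n, and g_n is within 1 / (n + 1) of an embedded
     vector. *)
  move=> e e0; have [n hn] := @vanish_invn R (e / 5) ltac:(lra).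
  have [b gb] := completion_seq (g n); exists (b n) => c.
  have -> : l c - s (b n) c = (l c - g n c) + (g n c - s (b n) c) by zmod.
  rewrite (le_trans (cmD _ _))// (le_trans (lerD (lP c n) (gb n c)))//.
  have -> : 2 * ((inv n + inv n) * sn s c) + inv n * sn s c = 5 * inv n * sn s c by ring.
  rewrite ler_wpM2r ?sn_ge0//; have := hn n (leqnn n); rewrite -/(inv_seq R n); lra.
pose L := Completion lapp.
have LP n : sn cinner (L - g n) <= 4 * inv n.
  apply: sn_le_fdist; first by rewrite mulr_ge0 ?inv_ge0.
  move=> c; rewrite (le_trans (lP c n))// le_eqVlt; apply/orP; left; apply/eqP; ring.
apply/cvg_ex; exists L; apply/cvgrPdist_lt => e e0.
have Ee : (((complex.Re e))%:C)%C = e by rewrite RRe_real ?gtr0_real.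
have re0 : 0 < complex.Re e by rewrite -ltcR Ee.
have [n hn] := @vanish_invn R (complex.Re e / 5) ltac:(lra).
near=> f; rewrite -Ee -nm_lt.
have : ball (g n) ((inv n)%:C)%C f by near: f; exact: gP.
rewrite -ball_normE /ball_/= -nm_lt => fn.
rewrite (le_lt_trans (nm_dist_tri (g n) _ _))//.
have := LP n; rewrite -nm_completion; have := hn n (leqnn n); rewrite -/(inv_seq R n).
lra.
Unshelve. all: by end_near. Qed.

HB.instance Definition _ := Uniform_isComplete.Build completion completion_complete.

Lemma cinner_norm (g : completion) : cinner g g = `|g| ^+ 2.
Proof.
rewrite -nmE -rmorphXn/= nm_completion (sn_sqr cinner_ge0).
exact: s_real cinnerC g.
Qed.

HB.instance Definition _ := isHilbert.Build R completion cinnerDl cinnerZl cinnerC cinner_norm.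

Lemma hilbert_completion : exists (H : hilbertType R) (j : V -> H),
  [/\ linear j, forall u v, inner (j u) (j v) = s u v &
      forall h (e : R), 0 < e -> exists v, nm (h - j v) < e].
Proof.
exists completion, cembed; split; [exact: cembed_linear|exact: cinner_embed|].
move=> h e e0; have [|b hb] := cfunP h (e := e / 2); first by rewrite divr_gt0.
exists b; rewrite (@le_lt_trans _ _ (e / 2))//; last by lra.
by apply: sn_le_fdist => //; rewrite divr_ge0// ltW.
Qed.

End Completion.

(** * Extreme functionals and irreducible quotients *)

Lemma closed_approx (R : realType) (H : hilbertType R) (W : set H) h :
  closed W -> (forall e : R, 0 < e -> exists2 w, W w & nm (h - w) < e) -> W h.
Proof.
move=> Wcl Wh; apply: Wcl => U /nbhs_normP[e /= e0 eU].
have Ee : (((complex.Re e))%:C)%C = e by rewrite RRe_real ?gtr0_real.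
have [|w Ww hw] := Wh (complex.Re e); first by rewrite -ltcR Ee.
by exists w; split => //; apply: eU; rewrite /ball_/= -Ee -nm_lt.
Qed.

Lemma hilbert_projection (R : realType) (H : hilbertType R) (W : set H) (xi : H) :
  closed_subspace W -> exists2 eta, W eta & forall w, W w -> inner (xi - eta) w = 0.
Proof.
move=> [W0 WD Wcl].
have WB u v : W u -> W v -> W (u + v) by move=> Wu; rewrite -[u]scale1r; exact: WD.
have WZ (k : R[i]) u : W u -> W (k *: u) by move=> Wu; rewrite -[_ *: _]addr0; exact: WD.
pose D : set R := [set r | exists2 w, W w & r = nm (xi - w) ^+ 2].
have Dinf : has_inf D.
  split; first by exists (nm (xi - 0) ^+ 2), 0.
  by exists 0 => _ [w _ ->]; exact: sqr_ge0.
have Dlb w : W w -> inf D <= nm (xi - w) ^+ 2.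
  by move=> Ww; apply: ge_inf; [exact: Dinf.2|exists w].
have /choice[w wP] n : exists w, W w /\ nm (xi - w) ^+ 2 <= inf D + inv_seq R n ^+ 2.
  have [|_ [w Ww ->] /ltW h] := @inf_adherent _ D (inv_seq R n ^+ 2) _ Dinf; last by exists w.
  by rewrite exprn_gt0// invr_gt0.
have inv_mono n m : (n <= m)%N -> inv_seq R m <= inv_seq R n.
  by move=> nm; rewrite lef_pV2 ?posrE// ler_nat.
(* By the parallelogram law the squared distance of w_n and w_m is at most 2 / (n+1)^2 + 2 /
   (m+1)^2, hence at most (2 / (n+1))^2 for n <= m. *)
have veps : vanish (fun n => 2 * inv_seq R n) by apply: vanishZ => //; exact: vanish_invn.
have [n m nlem|eta etaP] := @banach_complete _ _ w _ veps.
  rewrite -(ler_pXn2r (n := 2))// ?nnegrE ?nm_ge0 ?mulr_ge0 ?invr_ge0//.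
  have [Wn hn] := wP n; have [Wm hm] := wP m.
  have hmid := Dlb _ (WZ ((2^-1)%:C)%C _ (WB _ _ Wn Wm)).
  have e1 : xi - ((2^-1)%:C)%C *: (w n + w m) = ((2^-1)%:C)%C *: ((xi - w n) + (xi - w m)).
    have -> : xi - w n + (xi - w m) = (xi + xi) - (w n + w m) by zmod.
    rewrite scalerBr [_ *: (xi + xi)]scalerDr -scalerDl -rmorphD; congr (_ - _).
    by rewrite (_ : 2^-1 + 2^-1 = 1 :> R) ?scale1r//; lra.
  rewrite e1 nmZr exprMn nm_sqrD in hmid.
  have e2 : w m - w n = (xi - w n) + - (xi - w m) by zmod.
  rewrite e2 nm_sqrD rinNr nmN.
  have := inv_mono n m nlem; have : 0 <= inv_seq R m by rewrite invr_ge0.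
  move: hn hm hmid; rewrite [in `|2^-1|]ger0_norm//.
  move: (nm (xi - w n) ^+ 2) (nm (xi - w m) ^+ 2) (rin _ _) (inv_seq R n) (inv_seq R m) (inf D).
  move=> a b c i k d h1 h2 h3 h4 h5; nra.
have Weta : W eta.
  apply: closed_approx Wcl _ => e e0; have [n hn] := veps e e0.
  by exists (w n); [have [] := wP n|rewrite (le_lt_trans (etaP n))// hn].
exists eta => //.
(* W is stable under multiplication by -1 and by -i, so this one-sided bound on real parts makes the
   whole inner product vanish. *)
suff rin0 v : W v -> rin (xi - eta) v <= 0.
  have {}rin0 v : W v -> rin (xi - eta) v = 0.
    move=> Wv; apply/eqP; rewrite eq_le rin0//= -oppr_le0 -rinNr rin0//.
    by rewrite -scaleN1r; exact: WZ.
  move=> v Wv; apply: s_eq0; first exact: rin0.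
  have := rin0 _ (WZ (- 'i%C)%C _ Wv); rewrite /rin innerZr.
  by case: (inner _ v) => x y /=; lra.
move=> Wv.
apply: (vanish_ge0 (f := fun n => (2^-1 * (nm v ^+ 2 + 1) + 2 * nm v) * inv_seq R n)).
  apply: vanishZ; last exact: vanish_invn.
  by rewrite !(addr_ge0, mulr_ge0)// ?sqr_ge0 ?nm_ge0.
move=> n; have [Wn hn] := wP n; have i0 : 0 < inv_seq R n by rewrite invr_gt0.
(* Moving w_n by v / (n + 1) gains at most the excess 1 / (n + 1)^2; after division by the step
   length the error is still of order 1 / (n + 1). *)
have h1 := Dlb _ (WB _ _ Wn (WZ ((inv_seq R n)%:C)%C _ Wv)).
have e1 : xi - (w n + ((inv_seq R n)%:C)%C *: v) = (xi - w n) + - (((inv_seq R n)%:C)%C *: v) by zmod.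
rewrite e1 nm_sqrD rinNr rinZr nmN nmZr ger0_norm ?(ltW i0)// exprMn in h1.
have e2 : xi - eta = (xi - w n) + - (eta - w n) by zmod.
rewrite e2 rinDl.
have h2 := rin_cs (- (eta - w n)) v; rewrite nmN in h2.
have h3 := etaP n; have h4 := nm_ge0 v.
have h5 : nm (eta - w n) * nm v <= 2 * inv_seq R n * nm v by rewrite ler_wpM2r.
have h6 : inv_seq R n * (2 * rin (xi - w n) v) <= inv_seq R n * (inv_seq R n * (nm v ^+ 2 + 1)).
  by move: h1 hn; rewrite !expr2; move: (nm (xi - w n) * _) (rin (xi - w n) v) => a b; nra.
rewrite ler_pM2l// in h6; nra.
Qed.

Section ExtremeFunctional.
Variables (R : realType) (V : lmodType R[i]).
Implicit Types (p q f g : V -> R) (u v y : V).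

Local Notation "t *r v" := ((t%:C)%C *: v) (at level 40).

Definition sublinear q :=
  (forall u v, q (u + v) <= q u + q v) /\ (forall (t : R) u, 0 <= t -> q (t *r u) = t * q u).

Definition real_linear f :=
  (forall u v, f (u + v) = f u + f v) /\ (forall (t : R) u, f (t *r u) = t * f u).

(* The functionals below [q] form a face of the set of those below [p]. *)
Definition face p q := forall f g (s : R), real_linear f -> real_linear g ->
  (forall v, f v <= p v) -> (forall v, g v <= p v) -> 0 < s < 1 ->
  (forall v, s * f v + (1 - s) * g v <= q v) ->
  (forall v, f v <= q v) /\ (forall v, g v <= q v).

Lemma sub0 q : sublinear q -> q 0 = 0.
Proof. by move=> [_ qZ]; have := qZ 0 0 (lexx 0); rewrite scaler0 mul0r. Qed.

Lemma subN q v : sublinear q -> - q (- v) <= q v.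
Proof. by move=> qs; rewrite -subr_ge0 opprK -(sub0 qs) -(subrr v); exact: qs.1. Qed.

Lemma real_linearN f v : real_linear f -> f (- v) = - f v.
Proof.
move=> [fD fZ]; have := fZ (-1) v; rewrite rmorphN rmorph1 scaleN1r => ->.
by rewrite mulN1r.
Qed.

(** The linear functionals below [touch q y] are exactly the linear f <= q with f y = q y: the
    infimum over t turns the constraint at y into an inequality. *)
Definition touch_set q y v : set R := [set r | exists2 t : R, 0 <= t & r = q (v + t *r y) - t * q y].
Definition touch q y v : R := inf (touch_set q y v).

Section Touch.
Variables (q : V -> R) (y : V).
Hypothesis qs : sublinear q.

Lemma touch_has_inf v : has_inf (touch_set q y v).
Proof.
split; first by exists (q (v + 0 *r y) - 0 * q y), 0.
exists (- q (- v)) => _ [t t0 ->].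
have := qs.1 (- v) (v + t *r y); rewrite addKr (qs.2 t y t0); lra.
Qed.

Lemma touch_le v (t : R) : 0 <= t -> touch q y v <= q (v + t *r y) - t * q y.
Proof. by move=> t0; apply: ge_inf; [exact: (touch_has_inf v).2|exists t]. Qed.

Lemma touch_ge v r : (forall t : R, 0 <= t -> r <= q (v + t *r y) - t * q y) -> r <= touch q y v.
Proof.
by move=> h; apply: lb_le_inf => [|_ [t t0 ->]]; [exact: (touch_has_inf v).1|exact: h].
Qed.

Lemma touch_le_self v : touch q y v <= q v.
Proof. by have := touch_le v (lexx 0); rewrite scale0r addr0 mul0r subr0. Qed.

Lemma touchN : touch q y (- y) <= - q y.
Proof. by have := touch_le (- y) ler01; rewrite scale1r addNr (sub0 qs) mul1r sub0r. Qed.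

Lemma touch_sublinear : sublinear (touch q y).
Proof.
split=> [u v|].
  rewrite -lerBlDr; apply: touch_ge => t t0; rewrite lerBlDr -lerBlDl; apply: touch_ge => t' t'0.
  rewrite lerBlDl; have := touch_le (u + v) (addr_ge0 t0 t'0) => /le_trans; apply.
  have -> : u + v + (t + t') *r y = (u + t *r y) + (v + t' *r y).
    have -> : ((t + t')%:C)%C = (t%:C)%C + (t'%:C)%C :> R[i] by exact: rmorphD.
    by rewrite scalerDl; zmod.
  by have := qs.1 (u + t *r y) (v + t' *r y); lra.
have le t u : 0 < t -> t * touch q y u <= touch q y (t *r u).
  move=> t0; apply: touch_ge => r r0; rewrite -ler_pdivlMl//.
  apply: le_trans (touch_le u (divr_ge0 r0 (ltW t0))) _; rewrite ler_pdivlMl// mulrBr mulrA.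
  rewrite [t * (r / t)]mulrC mulfVK ?gt_eqF// -(qs.2 t _ (ltW t0)) scalerDr scalerA -rmorphM.
  by rewrite [t * (r / t)]mulrC mulfVK ?gt_eqF.
move=> t u; rewrite le_eqVlt => /predU1P[<-|t0].
  rewrite scale0r mul0r; apply/eqP; rewrite eq_le.
  rewrite (le_trans (touch_le_self _)) ?(sub0 qs)//=.
  apply: touch_ge => r r0; rewrite add0r (qs.2 _ _ r0); lra.
apply/eqP; rewrite eq_le le// andbT.
have := le t^-1 (t *r u); rewrite invr_gt0 => /(_ t0).
by rewrite scalerA -rmorphM mulVf ?gt_eqF// scale1r ler_pdivrMl.
Qed.

Lemma touch_face p : face p q -> face p (touch q y).
Proof.
move=> qf f g s fl gl fp gp /andP[s0 s1] fg.
have [||fq gq] := qf f g s fl gl fp gp; first by rewrite s0.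
  by move=> v; exact: le_trans (fg v) (touch_le_self v).
have := le_trans (fg (- y)) touchN; rewrite !real_linearN// => h.
have fy := fq y; have gy := gq y.
have {fy}fy : f y = q y by nra.
have {gy}gy : g y = q y by nra.
split=> v; apply: touch_ge => t t0.
  by have := fq (v + t *r y); rewrite fl.1 fl.2 fy; lra.
by have := gq (v + t *r y); rewrite gl.1 gl.2 gy; lra.
Qed.

End Touch.

(** Hahn-Banach and Krein-Milman in one step, with no topology on the dual. Zorn's lemma is applied
    to the sublinear functionals below [touch p y] that define faces; a minimal one is linear, and
    the face property makes it extreme. *)
Lemma extreme_functional p y : sublinear p -> exists f,
  [/\ real_linear f, forall v, f v <= p v, f y = p y &
    forall g h (s : R), real_linear g -> real_linear h ->
      (forall v, g v <= p v) -> (forall v, h v <= p v) -> 0 < s < 1 ->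
      (forall v, f v = s * g v + (1 - s) * h v) -> forall v, g v = f v].
Proof.
move=> ps; pose p1 := touch p y.
have p1s := touch_sublinear y ps.
have p1f : face p p1 by apply: touch_face.
pose T := {q : V -> R | [/\ sublinear q, forall v, q v <= p1 v & face p q]}.
pose below (a b : T) := `[< forall v, sval b v <= sval a v >].
have [||||m mmin] := @Zorn T below.
- by move=> t; apply/asboolP.
- by move=> a b c /asboolP ab /asboolP bc; apply/asboolP => v; exact: le_trans (bc v) (ab v).
- move=> [a aP] [b bP] /asboolP ab /asboolP ba; apply: eq_exist => /=; apply/funext => v.
  by apply/eqP; rewrite eq_le (ba v) (ab v).
- move=> C Ctot.
  have [->|/set0P[c0 Cc0]] := eqVneq C set0.
    have p1P : [/\ sublinear p1, forall v, p1 v <= p1 v & face p p1] by [].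
    by exists (exist _ p1 p1P).
  pose E v : set R := [set r | exists2 c : T, C c & r = sval c v].
  have Einf v : has_inf (E v).
    split; first by exists (sval c0 v), c0.
    exists (- p1 (- v)) => _ [[c [cs cp cf]] _ ->] /=.
    by rewrite (le_trans _ (subN v cs))// lerN2.
  pose q v := inf (E v).
  have qle (c : T) v : C c -> q v <= sval c v.
    by move=> Cc; apply: ge_inf; [exact: (Einf v).2|exists c].
  have qge v r : (forall c : T, C c -> r <= sval c v) -> r <= q v.
    by move=> h; apply: lb_le_inf => [|_ [c Cc ->]]; [exact: (Einf v).1|exact: h].
  have sl (c : T) : sublinear (sval c) by have [] := svalP c.
  have qs : sublinear q.
    split=> [u v|t u t0].
      rewrite -lerBlDr; apply: (qge) => a Ca; rewrite lerBlDr -lerBlDl; apply: (qge) => b Cb.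
      (* Subadditivity of an infimum requires a chain: the smaller of the two functionals serves
         both arguments. *)
      rewrite lerBlDl; have [/asboolP ab|/asboolP ba] := Ctot a b Ca Cb.
        by rewrite (le_trans (qle b _ Cb))// (le_trans ((sl b).1 u v))// lerD2r.
      by rewrite (le_trans (qle a _ Ca))// (le_trans ((sl a).1 u v))// lerD2l.
    have [->|tn] := eqVneq t 0.
      rewrite scale0r mul0r; apply/eqP; rewrite eq_le; apply/andP; split.
        by rewrite (le_trans (qle c0 _ Cc0))// (sub0 (sl c0)).
      by apply: qge => c Cc; rewrite (sub0 (sl c)).
    have tp : 0 < t by rewrite lt_def tn.
    apply/eqP; rewrite eq_le; apply/andP; split.
      rewrite -ler_pdivrMl//; apply: qge => c Cc; rewrite ler_pdivrMl//.
      by rewrite -(sl c).2// qle.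
    by apply: qge => c Cc; rewrite (sl c).2// ler_wpM2l// qle.
  have qp1 v : q v <= p1 v.
    by rewrite (le_trans (qle c0 v Cc0))//; have [] := svalP c0.
  have qf : face p q.
    move=> f g s fl gl fp gp s01 fg.
    have h (c : T) : C c -> (forall v, f v <= sval c v) /\ (forall v, g v <= sval c v).
      move=> Cc; have [_ _ cf] := svalP c; apply: (cf f g s) => // v.
      exact: le_trans (fg v) (qle c v Cc).
    by split=> v; apply: qge => c /h[].
  exists (exist _ q (And3 qs qp1 qf)) => c Cc; apply/asboolP => v /=.
  exact: qle.
have [ms mp1 mf] := svalP m; set f := sval m in ms mp1 mf.
have fN v : f (- v) = - f v.
  (* Minimality forces [touch f v] = f, and the value of [touch f v] at -v is at most - f v. So f is
     odd, and an odd sublinear functional is linear. *)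
  have tP : [/\ sublinear (touch f v), forall u, touch f v u <= p1 u & face p (touch f v)].
    split; [exact: touch_sublinear|move=> u|exact: touch_face].
    exact: le_trans (touch_le_self v ms u) (mp1 u).
  have mt : below m (exist _ (touch f v) tP).
    by apply/asboolP => u /=; exact: touch_le_self.
  have tm : touch f v = f by exact: (congr1 sval (mmin _ mt)).
  apply/eqP; rewrite eq_le -{1}tm touchN//=.
  by have := subN (- v) ms; rewrite opprK lerNl.
have fl : real_linear f.
  have fD u v : f (u + v) = f u + f v.
    apply/eqP; rewrite eq_le ms.1/=.
    by have := ms.1 (- u) (- v); rewrite -opprD !fN -opprD lerN2.
  split=> // t u; have [t0|t0] := leP 0 t; first exact: ms.2.
  have := ms.2 (- t) u; rewrite oppr_ge0 (ltW t0) => /(_ isT).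
  rewrite mulNr (_ : ((- t)%:C)%C = - (t%:C)%C :> R[i]) ?scaleNr; last exact: rmorphN.
  by rewrite fN => /oppr_inj.
exists f; split=> //.
- by move=> v; rewrite (le_trans (mp1 v))// touch_le_self.
- apply/eqP; rewrite eq_le (le_trans (mp1 y)) ?touch_le_self//=.
  by rewrite -lerN2 -fN (le_trans (mp1 _))// touchN.
- move=> g h s gl hl gp hp s01 fgh.
  have [|gf _] := mf g h s gl hl gp hp s01; first by move=> v; rewrite fgh.
  move=> v; apply/eqP; rewrite eq_le gf/= -lerN2 -fN -real_linearN//.
Qed.

End ExtremeFunctional.

(** * Irreducible representations that kill a given ideal *)

Section IrreducibleQuotient.
Variables (R : realType) (A : cstarAlgType R).
Notation MA := (multiplier A).
Implicit Types (a b c k : MA) (t : R).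
Local Notation rs := (rs A).

Record star_ideal (K : set MA) : Prop := {
  sideal0 : K 0;
  sidealD : forall b c, K b -> K c -> K (b + c);
  sidealMl : forall b c, K c -> K (b * c);
  sidealMr : forall b c, K b -> K (b * c);
  sideal_star : forall b, K b -> K b^*s
}.

Definition hp b : MA := rs 2^-1 * (b + b^*s).

Lemma hp_herm b : b^*s = b -> hp b = b.
Proof.
move=> hb; have bb : b + b = rs 2 * b by rewrite -[2]/(1 + 1) rsD rs1 mulrDl mul1r.
by rewrite /hp hb bb rsVK.
Qed.

Lemma hp_star b : (hp b)^*s = hp b.
Proof. by rewrite mstarZ mstarD astarK addrC. Qed.

Lemma hpD b c : hp (b + c) = hp b + hp c.
Proof. by rewrite /hp mstarD -mulrDr; congr (_ * _); zmod. Qed.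

Lemma hpZ t b : hp (rs t * b) = rs t * hp b.
Proof. by rewrite /hp mstarZ -mulrDr rsCA. Qed.

Lemma hpN b : hp (- b) = - hp b.
Proof. by rewrite /hp mstarN -mulrN; congr (_ * _); zmod. Qed.

Lemma hp_antiherm b : b^*s = - b -> hp b = 0.
Proof. by move=> hb; rewrite /hp hb subrr mulr0. Qed.

Lemma pos_slack s t b : s <= t -> pos (rs s + b) -> pos (rs t + b).
Proof.
move=> st pb; have -> : rs t + b = rs (t - s) + (rs s + b) by rewrite rsB; zmod.
by apply: posD => //; apply: pos_rs; rewrite subr_ge0.
Qed.

Variables (K : set MA) (Kid : star_ideal K) (a : MA) (tau : R).
Hypotheses (tau0 : 0 < tau) (Ka : forall k, K k -> ~ pos (rs tau - a^*s * a + k)).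

Let KN k : K k -> K (- k).
Proof. by rewrite -mulN1r; exact: sidealMl. Qed.

Let Khp k : K k -> K (hp k).
Proof. by move=> Kk; apply: sidealMl => //; apply: sidealD => //; exact: sideal_star. Qed.

(** If t < 0, then k >= -t > 0, and the multiple l k with l = N(a)^2 / -t dominates a^* a, against
    [Ka]. This keeps the gauge below bounded from below. *)
Lemma ideal_bound t k : K k -> pos (rs t + k) -> 0 <= t.
Proof.
move=> Kk pk; rewrite leNgt; apply/negP => t0.
pose l := N a ^+ 2 / - t.
have l0 : 0 <= l by rewrite divr_ge0 ?sqr_ge0// oppr_ge0 ltW.
apply: (Ka (k := rs l * k)); first exact: sidealMl.
rewrite -addrA; apply: (@pos_slack 0); first exact: ltW.
have -> : rs 0 + (- (a^*s * a) + rs l * k) = rs l * (rs t + k) + (rs (N a ^+ 2) - a^*s * a).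
  rewrite mulrDr -rsM (_ : l * t = - N a ^+ 2) ?rsN ?rs0; first by zmod.
  by rewrite /l invrN mulrN mulNr mulfVK// lt_eqF.
apply: posD; first exact: pos_rsM.
by apply: N_pos_sub; [exact: (pos_herm (pos_sqr a))|rewrite N_Cstar].
Qed.

(** Modulo K, the gauge of b is the top of the spectrum of the real part of b; the real linear
    functionals below it are the real parts of the states that vanish on K. *)
Definition gauge_set b : set R := [set t | exists2 k, K k & pos (rs t - hp b + k)].
Definition gauge b : R := inf (gauge_set b).

Lemma gauge_nonempty b : gauge_set b !=set0.
Proof.
exists (N (hp b)), 0; first exact: sideal0.
by rewrite addr0; apply: N_pos_sub; rewrite ?hp_star.
Qed.

Lemma gauge_has_inf b : has_inf (gauge_set b).
Proof.
split; first exact: gauge_nonempty.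
have [t0 [k0 Kk0 p0]] := gauge_nonempty (- b).
exists (- t0) => t [k Kk pk]; rewrite -subr_ge0 opprK.
apply: (@ideal_bound _ (k + k0)); first exact: sidealD.
have -> : rs (t + t0) + (k + k0) = (rs t - hp b + k) + (rs t0 - hp (- b) + k0).
  by rewrite hpN rsD; zmod.
exact: posD.
Qed.

Lemma gauge_le b t k : K k -> pos (rs t - hp b + k) -> gauge b <= t.
Proof. by move=> Kk pk; apply: ge_inf; [exact: (gauge_has_inf b).2|exists k]. Qed.

Lemma gauge_ge b r : (forall t k, K k -> pos (rs t - hp b + k) -> r <= t) -> r <= gauge b.
Proof.
by move=> h; apply: lb_le_inf => [|t [k Kk pk]]; [exact: gauge_nonempty|exact: h pk].
Qed.

Lemma gauge_sublinear : @sublinear R MA gauge.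
Proof.
split=> [u v|].
  rewrite -lerBlDr; apply: gauge_ge => t k Kk pk; rewrite lerBlDr -lerBlDl.
  apply: gauge_ge => t' k' Kk' pk'; rewrite lerBlDl.
  apply: (@gauge_le _ _ (k + k')); first exact: sidealD.
  have -> : rs (t + t') - hp (u + v) + (k + k') =
    (rs t - hp u + k) + (rs t' - hp v + k') by rewrite hpD rsD; zmod.
  exact: posD.
have le (t : R) u : 0 < t -> t * gauge u <= gauge ((t%:C)%C *: u).
  move=> t0; apply: gauge_ge => r k Kk pk; rewrite -ler_pdivlMl//.
  apply: (@gauge_le _ _ (rs t^-1 * k)); first exact: sidealMl.
  have -> : rs (t^-1 * r) - hp u + rs t^-1 * k = rs t^-1 * (rs r - hp ((t%:C)%C *: u) + k).
    by rewrite mulrDr mulrBr -rsE hpZ rsVK ?gt_eqF// rsM.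
  by apply: pos_rsM => //; rewrite invr_ge0 ltW.
move=> t u; rewrite le_eqVlt => /predU1P[<-|t0].
  rewrite scale0r mul0r; apply/eqP; rewrite eq_le; apply/andP; split.
    apply: (@gauge_le _ _ 0); first exact: sideal0.
    by rewrite hp_herm ?astar0// rs0 subrr addr0; exact: pos0.
  apply: gauge_ge => r k Kk; rewrite hp_herm ?astar0// subr0; exact: ideal_bound.
apply/eqP; rewrite eq_le le// andbT.
have := le t^-1 ((t%:C)%C *: u); rewrite invr_gt0 => /(_ t0).
by rewrite scalerA -rmorphM mulVf ?gt_eqF// scale1r ler_pdivrMl.
Qed.

(** The functional f attains the gauge at a^* a, where the gauge is at least tau > 0; so its GNS
    representation kills K but not a. For an invariant W, splitting the cyclic vector along W writes
    f as a convex combination of two vector states, and extremality forces W to be trivial. *)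
Lemma irreducible_quotient : exists (H : hilbertType R) (sg : MA -> H -> H),
  [/\ is_representation sg, is_irreducible sg,
      forall k, K k -> forall v, sg k v = 0 & exists v, sg a v <> 0].
Proof.
have haa : (a^*s * a)^*s = a^*s * a by exact: pos_herm (pos_sqr a).
have [f [flin fp fa fext]] := extreme_functional (a^*s * a) gauge_sublinear.
have fa0 : 0 < f (a^*s * a).
  rewrite fa (lt_le_trans tau0)//; apply: gauge_ge => t k Kk; rewrite hp_herm// => pk.
  rewrite leNgt; apply/negP => /ltW tt; apply: (Ka Kk).
  by rewrite -addrA; apply: (pos_slack tt); rewrite addrA.
have fD := flin.1; have fN b : f (- b) = - f b := real_linearN b flin.
have fZ t b : f (rs t * b) = t * f b by rewrite rsE; exact: flin.2.
have fpos b : pos b -> 0 <= f b.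
  move=> pb; rewrite -oppr_le0 -fN (le_trans (fp _))//.
  apply: (@gauge_le _ _ 0); first exact: sideal0.
  by rewrite addr0 rs0 sub0r hpN opprK hp_herm// pos_herm.
have fK k : K k -> f k = 0.
  suff h k' : K k' -> f k' <= 0.
    by move=> Kk; apply/eqP; rewrite eq_le h//= -oppr_le0 -fN h//; exact: KN.
  move=> Kk; rewrite (le_trans (fp _))//; apply: (gauge_le (Khp Kk)).
  by rewrite rs0 sub0r addNr; exact: pos0.
have f1 : f 1 = 1.
  apply/eqP; rewrite eq_le; apply/andP; split.
    rewrite (le_trans (fp _))//; apply: (@gauge_le _ _ 0); first exact: sideal0.
    by rewrite hp_herm ?mstar1// rs1 subrr addr0; exact: pos0.
  rewrite -lerN2 -fN (le_trans (fp _))//; apply: (@gauge_le _ _ 0); first exact: sideal0.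
  by rewrite hpN hp_herm ?mstar1// rsN rs1 opprK addNr addr0; exact: pos0.
have fanti b : b^*s = - b -> f b = 0.
  have h c : c^*s = - c -> f c <= 0.
    move=> hc; rewrite (le_trans (fp _))//; apply: (@gauge_le _ _ 0); first exact: sideal0.
    by rewrite hp_antiherm// rs0 subrr addr0; exact: pos0.
  move=> hb; apply/eqP; rewrite eq_le h//= -oppr_le0 -fN h//.
  by rewrite mstarN hb.
have fstar b : f b^*s = f b.
  by apply/eqP; rewrite -subr_eq0 -fN -fD fanti// mstarD mstarN astarK; zmod.
have f0 : f 0 = 0 by rewrite fK//; exact: sideal0.
(* The complex linear functional with real part f. *)
pose F b : R[i] := Complex (f b) (- f (iu A * b)).
have FD b c : F (b + c) = F b + F c.
  by rewrite /F mulrDr !fD opprD.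
have FZ (k : R[i]) b : F (k *: b) = k * F b.
  have kb : k *: b = rs (complex.Re k) * b + rs (complex.Im k) * (iu A * b).
    rewrite !rsE iuE scalerA -scalerDl; congr (_ *: _).
    by rewrite mulrC -complexE.
  have ikb : iu A * (k *: b) = rs (complex.Re k) * (iu A * b) - rs (complex.Im k) * b.
    by rewrite kb mulrDr !rsCA [iu A * (iu A * b)]mulrA iu2 mulN1r mulrN.
  rewrite /F ikb kb !fD fN !fZ; case: (k) => x y /=.
  by apply/eqP; rewrite eq_complex/=; apply/andP; split; apply/eqP; ring.
have FC b c : F (b^*s * c) = (F (c^*s * b))^*.
  have e1 : f (b^*s * c) = f (c^*s * b) by rewrite -fstar mstarM astarK.
  have e2 : f (iu A * (b^*s * c)) = - f (iu A * (c^*s * b)).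
    rewrite -fstar !mstarM astarK mstar_iu mulrN fN; congr (- f _).
    by rewrite -iuC.
  by apply/eqP; rewrite eq_complex/= e1 e2 !eqxx.
pose G b c := F (c^*s * b).
have GD u v w : G (u + v) w = G u w + G v w by rewrite /G mulrDr FD.
have GZ (k : R[i]) u v : G (k *: u) v = k * G u v.
  by rewrite /G -FZ; congr F; exact: amulZr.
pose s := @SemiInner R MA G GD GZ (fun u v => FC u v) (fun u => fpos _ (pos_sqr u)).
have [H [j [jlin jin jdense]]] := hilbert_completion s.
have jF u v : inner (j u) (j v) = F (v^*s * u) := jin u v.
have jnm b : nm (j b) ^+ 2 = f (b^*s * b) by rewrite -rin_sqr /rin jF.
have [||||b c|pi rpi piP] := @dense_representation R MA H j jlin jdense MA (fun b c => b * c) (@N R A).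
- by move=> c k b d /=; rewrite mulrDl; congr (_ + _); exact: amulZl.
- by move=> c k b d /=; rewrite mulrDr; congr (_ + _); exact: amulZr.
- by move=> b c d; rewrite mulrA.
- by move=> b c d; rewrite !jF mstarM astarK mulrA.
- rewrite -(ler_pXn2r (n := 2))// ?nnegrE ?mulr_ge0 ?nm_ge0 ?N_ge0//.
  rewrite exprMn !jnm -fZ -subr_ge0 -fN -fD; apply: (fpos).
  have -> : rs (N b ^+ 2) * (c^*s * c) - (b * c)^*s * (b * c) =
      c^*s * (rs (N b ^+ 2) - b^*s * b) * c.
    by rewrite mulrBr mulrBl mstarM -rsC !mulrA.
  apply: pos_conj; apply: N_pos_sub; last by rewrite N_Cstar.
  exact: pos_herm (pos_sqr b).
pose xi := j 1.
have piE b : pi b xi = j b by rewrite piP mulr1.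
have dense0 u : (forall c, rin u (j c) = 0) -> u = 0.
  move=> u0; have [//|u1] := eqVneq u 0.
  have np : 0 < nm u by exact: nm_gt0.
  have [c uc] := jdense u _ np.
  have := rin_cs u (u - j c); rewrite rinDr rinNr u0 subr0 rin_sqr expr2 ler_pM2l//.
  by rewrite leNgt uc.
have fE b : f b = rin (pi b xi) xi.
  by rewrite piE /rin jF mstar1 mul1r.
have piK k : K k -> forall v, pi k v = 0.
  move=> Kk; have [C C0 CP] := rep_lipschitz rpi k.
  apply: (dense_eq (j := j) jdense (G := fun=> 0) (C := C)) => [u v|u v|c].
  - by rewrite -(repBr rpi).
  - by rewrite subrr nm0 mulr_ge0 ?nm_ge0.
  - rewrite piP; apply: nm0_eq0; apply/eqP; rewrite -sqrf_eq0 jnm fK//.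
    by apply: sidealMl => //; exact: sidealMr.
exists H, pi; split=> //; last first.
  exists xi; rewrite piE => ja; move: (jnm a); rewrite ja nm0 expr0n => e.
  by rewrite -e ltxx in fa0.
split.
  exists a, xi; rewrite piE => ja; move: (jnm a); rewrite ja nm0 expr0n => e.
  by rewrite -e ltxx in fa0.
move=> W cW Winv; have [W0 WD Wcl] := cW.
have xiT : W xi -> W = setT.
  move=> Wxi; apply/seteqP; split=> // h _; apply: closed_approx Wcl _ => e e0.
  by have [c hc] := jdense h e e0; exists (j c) => //; rewrite -piE; exact: Winv.
have [eta Weta etaP] := hilbert_projection xi cW.
have orth w : W w -> rin (xi - eta) w = 0 by move=> Ww; rewrite /rin etaP.
have xiN : nm xi ^+ 2 = 1 by rewrite jnm mstar1 mul1r.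
have etaN : nm eta ^+ 2 + nm (xi - eta) ^+ 2 = 1.
  have := nm_sqrD (xi - eta) eta; rewrite subrK xiN orth//; lra.
set s0 := nm eta ^+ 2 in etaN.
have [s00|s0n] := eqVneq s0 0.
  left; have eta0 : eta = 0 by apply: nm0_eq0; apply/eqP; rewrite -sqrf_eq0; exact/eqP.
  apply/seteqP; split=> [w Ww|_ ->//]; apply: dense0 => c.
  rewrite -piE /rin (rep_starr rpi) -/(rin _ _) rinC -[xi]subr0 -eta0 orth//.
  exact: Winv.
right; apply: xiT.
have s0p : 0 < s0 by rewrite lt_def s0n sqr_ge0.
have Wscale (r : R) v : W v -> W ((r%:C)%C *: v).
  by move=> Wv; rewrite -[_ *: _]addr0; exact: WD.
have [s1|s1n] := eqVneq s0 1.
  have : xi - eta = 0.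
    by apply: nm0_eq0; apply/eqP; rewrite -sqrf_eq0; apply/eqP; lra.
  by move/eqP; rewrite subr_eq0 => /eqP ->.
have s1p : s0 < 1.
  rewrite lt_neqAle s1n/=; have := sqr_ge0 (nm (xi - eta)); lra.
(* The vector functional of z, to be normalized by the squared norm r of z. It lies below the gauge
   because pi kills K. *)
pose st z (r : R) b := r^-1 * rin (pi b z) z.
have st_lin z r : @real_linear R MA (st z r).
  split=> [b c|t b]; first by rewrite /st (repDl rpi) rinDl mulrDr.
  by rewrite /st (repZl rpi) rinZl mulrCA.
have st_le z r : 0 < r -> nm z ^+ 2 = r -> forall b, st z r b <= gauge b.
  move=> r0 zr b; apply: gauge_ge => t k Kk /(rep_pos rpi z).
  rewrite (repDl rpi) (repBl rpi) (piK _ Kk) addr0 rinDl rinNl subr_ge0.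
  have -> : rin (pi (rs t) z) z = t * r.
    have -> : pi (rs t) z = (t%:C)%C *: z; last by rewrite rinZl rin_sqr zr.
    have [C C0 CP] := rep_lipschitz rpi (rs t).
    apply: (dense_eq (j := j) jdense (F := pi (rs t)) (G := fun z => (t%:C)%C *: z) (C := C + `|t|)).
    - by move=> u v; rewrite -(repBr rpi) (le_trans (CP _))// ler_wpM2r ?nm_ge0// lerDl.
    - by move=> u v; rewrite -scalerBr nmZr ler_wpM2r ?nm_ge0// lerDr.
    - by move=> c; rewrite piP rsE (linZ jlin).
  have -> : rin (pi (hp b) z) z = rin (pi b z) z.
    rewrite /hp rsE (repZl rpi) rinZl (repDl rpi) rinDl.
    have -> : rin (pi b^*s z) z = rin (pi b z) z; last by lra.
    by rewrite /rin (rep_star rpi) astarK -/(rin _ _) rinC.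
  by rewrite /st ler_pdivrMl// mulrC.
have fsplit b : f b = s0 * st eta s0 b + (1 - s0) * st (xi - eta) (1 - s0) b.
  have s1pp : 1 - s0 != 0 by rewrite subr_eq0 gt_eqF.
  rewrite /st !mulrA !divff// !mul1r fE.
  have c1 : rin (pi b eta) (xi - eta) = 0 by rewrite rinC orth//; exact: Winv.
  have c2 : rin (pi b (xi - eta)) eta = 0.
    by rewrite /rin (rep_star rpi) -/(rin _ _) orth//; exact: Winv.
  have -> : rin (pi b xi) xi = rin (pi b (xi - eta + eta)) (xi - eta + eta) by rewrite subrK.
  rewrite (repDr rpi) rinDl !(rinDr _ (xi - eta) eta) c1 c2; lra.
have etaE := fext _ _ s0 (st_lin eta s0) (st_lin (xi - eta) (1 - s0))
  (st_le eta s0 s0p erefl) (st_le (xi - eta) (1 - s0) _ _) _ fsplit.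
(* By extremality f is the vector state of eta. Since xi - eta is orthogonal to W, testing against j
   c gives eta = s0 xi, which puts xi into W. *)
have etaxi : eta - (s0%:C)%C *: xi = 0.
  apply: dense0 => c; rewrite rinDl rinNl rinZl.
  have -> : rin eta (j c) = rin (pi c^*s eta) eta.
    rewrite -piE /rin (rep_starr rpi) -!/(rin _ _).
    have := orth _ (Winv c^*s _ Weta); rewrite rinC rinDr rinNr => h; lra.
  have := etaE _ _ _ c^*s; rewrite fE /st => h.
  have -> : rin xi (j c) = rin (pi c^*s xi) xi by rewrite -piE /rin (rep_starr rpi).
  rewrite -h ?mulrA ?divff ?mul1r ?subrr//; lra.
move/eqP: etaxi; rewrite subr_eq0 => /eqP etaxi.
have -> : xi = ((s0^-1)%:C)%C *: eta.
  by rewrite [in RHS]etaxi scalerA -rmorphM mulVf// scale1r.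
exact: Wscale.
Qed.

End IrreducibleQuotient.

(** * Primitive ideals of the multiplier algebra *)

Lemma prim_open_sep (R : realType) (B : starAlgType R) (U : set (prim B)) (Q : prim B) :
  open U -> U Q -> exists c, ~ prim_ideal Q c /\ forall Q', ~ U Q' -> prim_ideal Q' c.
Proof.
move=> oU UQ; have /existsNP[c /not_implyP[kc Qc]] : ~ (ker_of (~` U) `<=` prim_ideal Q).
  by move=> /oU; apply.
by exists c; split=> // Q' UQ'; exact: kc.
Qed.

Lemma prim_open_ideal (R : realType) (B : starAlgType R) (c : B) : open [set Q : prim B | ~ prim_ideal Q c].
Proof.
by move=> Q h Qc; apply: Qc; apply: h => Q' /contrapT.
Qed.

Section PrimitiveIdeals.
Variables (R : realType) (A : cstarAlgType R).
Notation MA := (multiplier A).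
Implicit Types (P : prim A) (Q : prim MA) (b c k y : MA) (t : R).
Local Notation rs := (rs A).

Lemma rep_ker_star_ideal (H : hilbertType R) (sg : MA -> H -> H) :
  is_representation sg -> star_ideal (rep_ker sg).
Proof.
move=> rsg; split.
- by move=> v; exact: rep0l.
- by move=> b c bk ck v; rewrite (repDl rsg) bk ck addr0.
- by move=> b c ck v; rewrite (rep_M rsg) ck (rep0 rsg).
- by move=> b c bk v; rewrite (rep_M rsg) bk.
- move=> b bk v; apply: inner_eq => w.
  by rewrite (rep_star rsg) astarK bk inner0r inner0l.
Qed.

Definition tilde P : set MA := ideal_tilde (prim_ideal P).

Lemma tilde_star_ideal P : star_ideal (tilde P).
Proof.
have [H [sg [rsg _ _ kersg]]] := prim_extend P.
by rewrite /tilde -kersg; exact: rep_ker_star_ideal.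
Qed.

Lemma tilde_prim P : exists2 Q, prim_ideal Q = tilde P &
  forall a, prim_ideal P a <-> prim_ideal Q (mult_in a).
Proof.
have [H [sg [rsg isg Psg kersg]]] := prim_extend P.
have PQ : is_primitive (rep_ker sg) by exists H, sg.
by exists (Prim PQ).
Qed.

Lemma tilde_in P a : tilde P (mult_in a) <-> prim_ideal P a.
Proof. by have [Q <- h] := tilde_prim P; rewrite h. Qed.

(** A representation of M(A) either kills A or restricts to an irreducible one of A. Only the second
    kind of Q is visible in Prim(A), and this dichotomy is used wherever a Q has to be
    identified. *)
Lemma prim_multiplier_cases Q : (forall a, prim_ideal Q (mult_in a)) \/
  exists P, prim_ideal Q = tilde P.
Proof.
have [H [sg [rsg isg QE]]] := primP Q.
have [h|/existsNP[a]] := pselect (forall a, prim_ideal Q (mult_in a)); first by left.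
rewrite QE => /existsNP[v av]; right.
have [|P [_ PE]] := prim_restrict rsg isg; first by exists a, v.
by exists P.
Qed.

Lemma prim_quotient (K : set MA) b t : star_ideal K -> 0 < t ->
    (forall k, K k -> ~ pos (rs t - b^*s * b + k)) ->
  exists2 Q, K `<=` prim_ideal Q & ~ prim_ideal Q b.
Proof.
move=> Kid t0 Kb; have [H [sg [rsg isg Ksg [v bv]]]] := irreducible_quotient Kid t0 Kb.
have PQ : is_primitive (rep_ker sg) by exists H, sg.
exists (Prim PQ) => /=; first by move=> k Kk w; exact: Ksg.
by move=> /(_ v).
Qed.

(** A nonzero b yields a nonzero c = b a in A. Modulo the zero ideal, c^* c is not below half of its
    norm, so some Q omits c; such a Q does not contain A and is therefore a [tilde P]. *)
Lemma tilde_inter0 b : (forall P, tilde P b) -> b = 0.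
Proof.
move=> tb; apply: contrapT => b0.
have [a ba] : exists a, lmul b a <> 0.
  apply/not_existsP => h; apply: b0; apply: N0_eq0; apply/eqP.
  rewrite eq_le N_ge0 andbT; apply: N_le => // a; rewrite mul0r.
  by have /contrapT -> := h a; rewrite nm0.
pose c := mult_in (lmul b a).
have c0 : 0 < N c.
  rewrite lt_def N_ge0 andbT; apply/eqP; rewrite mult_inE => /nm0_eq0; exact: ba.
have K0 : star_ideal [set (0 : MA)].
  split=> //.
  - by move=> u v /= -> ->; rewrite addr0.
  - by move=> u v /= ->; rewrite mulr0.
  - by move=> u v /= ->; rewrite mul0r.
  - by move=> u /= ->; rewrite astar0.
have [||Q _ Qc] := prim_quotient (b := c) (t := N c ^+ 2 / 2) K0.
- by rewrite divr_gt0// exprn_gt0.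
- move=> _ /= ->; rewrite addr0 => pc.
  have : N (c^*s * c) <= N c ^+ 2 / 2.
    by apply: pos_le_N => //; [rewrite divr_ge0// sqr_ge0|exact: pos_sqr].
  rewrite N_Cstar; have : 0 < N c ^+ 2 by rewrite exprn_gt0.
  lra.
have [QA|[P PE]] := prim_multiplier_cases Q; first exact/Qc/QA.
by rewrite PE in Qc; apply: Qc; apply/tilde_in; have [] := tb P a.
Qed.

Lemma open_not_tilde n : open [set P | ~ tilde P n].
Proof.
have -> : [set P | ~ tilde P n] =
    \bigcup_a ([set P | ~ prim_ideal P (lmul n a)] `|` [set P | ~ prim_ideal P (rmul n a)]).
  apply/seteqP; split => P /=.
    by move=> /existsNP[a /not_andP h]; exists a.
  by move=> [a _ h] /(_ a)[h1 h2]; case: h.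
apply: bigcup_open => a _; apply: openU; exact: prim_open_ideal.
Qed.

(** States that the norm of b in M(A)/[tilde P] is at most the root of t. *)
Definition small P b t := exists2 k, tilde P k & pos (rs t - b^*s * b + k).

Lemma small_bound P b t (H : hilbertType R) (sg : MA -> H -> H) v : 0 <= t ->
    is_representation sg -> rep_ker sg = tilde P -> small P b t ->
  nm (sg b v) ^+ 2 <= t * nm v ^+ 2.
Proof.
move=> t0 rsg kersg [k]; rewrite -kersg => kk pk.
have : 0 <= rin (sg (rs t - b^*s * b + k) v) v by exact: rep_pos.
rewrite (repDl rsg) kk addr0 (repBl rsg) rinDl rinNl subr_ge0 => h.
rewrite (rep_nm_sqr rsg); apply: le_trans h _.
have -> : sg (rs t) v = (t%:C)%C *: sg 1 v by rewrite -(rep_rs rsg) mulr1.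
by rewrite rinZl ler_wpM2l// (rep_one_le rsg).
Qed.

Lemma positive_excess y t : y^*s = y -> exists p n,
  [/\ pos p, pos n, y - rs t = p - n, p * n = 0 /\ n * p = 0 &
      forall c, c * y = y * c -> c * p = p * c /\ c * n = n * c].
Proof.
move=> hy; have [|p [n [pp pn yE pn0 com]]] := @pos_parts _ _ (y - rs t).
  by rewrite mstarB hy mstar_rs.
exists p, n; split=> // c cy; apply: com.
by rewrite mulrBr mulrBl cy rsC.
Qed.

(** With q the root of p, p (y - t) p = p^3 = (q p)^* (q p). The left side acts as a nonpositive
    operator, so q p and then p act as 0. *)
Lemma rep_excess (H : hilbertType R) (sg : MA -> H -> H) y t p n :
    is_representation sg -> pos p -> y - rs t = p - n -> p * n = 0 ->
    (forall v, rin (sg y v) v <= t * nm v ^+ 2) -> (forall v, sg 1 v = v) ->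
  rep_ker sg p.
Proof.
move=> rsg pp yE pn0 sy s1.
have [q [pq qq qc]] := pos_sqrt pp.
have kp : q * p = p * q by rewrite -qq mulrA.
have e : p * (y - rs t) * p = (q * p)^*s * (q * p).
  rewrite yE mulrBr pn0 subr0 mstarM (pos_herm pq) (pos_herm pp).
  by rewrite -[p * q * (q * p)]mulrA [q * (q * p)]mulrA qq mulrA.
have qp0 v : sg (q * p) v = 0.
  apply: nm0_eq0; apply/eqP; rewrite -sqrf_eq0 eq_le sqr_ge0 andbT.
  rewrite (rep_nm_sqr rsg) -[_ ⋅ _]/((q * p)^*s * (q * p)) -e -mulrA (rep_M rsg).
  rewrite -{1}(pos_herm pp) /rin (rep_star rsg) astarK -/(rin _ _) (rep_M rsg).
  rewrite (repBl rsg) rinDl rinNl.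
  have -> : sg (rs t) (sg p v) = (t%:C)%C *: sg p v.
    by rewrite -{2}(s1 (sg p v)) -(rep_rs rsg) mulr1.
  by rewrite rinZl rin_sqr subr_le0.
move=> v; apply: nm0_eq0; apply/eqP; rewrite -sqrf_eq0 (rep_nm_sqr rsg) (pos_herm pp).
have -> : p ⋅ p = q * (q * p) by rewrite mulrA qq.
by rewrite (rep_M rsg) qp0 (rep0 rsg) /rin inner0l.
Qed.

(** The inequality becomes membership in an ideal: t - b^* b + p = n is positive, and conversely p
    is killed wherever b^* b <= t. *)
Lemma small_excess P b t p n : 0 <= t -> pos p -> pos n ->
  b^*s * b - rs t = p - n -> p * n = 0 -> small P b t <-> tilde P p.
Proof.
move=> t0 pp pn bE pn0; split=> [bt|tp]; last first.
  exists p => //; have -> // : rs t - b^*s * b + p = n.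
  by rewrite -[rs t - _]opprB bE; zmod.
have [H [sg [rsg isg _ kersg]]] := prim_extend P.
rewrite -[tilde P]kersg; apply: (rep_excess rsg pp bE pn0); last exact: rep_one.
by move=> v; rewrite -[b^*s * b]/(b^*s ⋅ b) -(rep_nm_sqr rsg); exact: small_bound bt.
Qed.

Lemma open_not_small b t : 0 <= t -> open [set P | ~ small P b t].
Proof.
move=> t0; have [p [n [pp pn bE [pn0 _] _]]] := positive_excess t (pos_herm (pos_sqr b)).
rewrite (_ : [set P | _] = [set P | ~ tilde P p]); first exact: open_not_tilde.
by apply/seteqP; split=> P /=; rewrite (small_excess P t0 pp pn bE pn0).
Qed.

Variables (X : topologicalType) (phi : prim A -> X) (x : X).
Hypothesis phi_cont : continuous phi.

(** The multipliers that vanish over a neighbourhood of x. *)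
Definition germ_ideal : set MA :=
  [set c | exists2 W, nbhs x W & forall P, W (phi P) -> tilde P c].

Lemma germ_star_ideal : star_ideal germ_ideal.
Proof.
split.
- by exists setT => [|P _]; [exact: filterT|exact: sideal0 (tilde_star_ideal P)].
- move=> b c [V xV bV] [W xW cW]; exists (V `&` W); first exact: filterI.
  by move=> P [PV PW]; apply: (sidealD (tilde_star_ideal P)); [exact: bV|exact: cW].
- by move=> b c [W xW cW]; exists W => // P PW; exact: (@sidealMl _ _ _ (tilde_star_ideal P) b c (cW P PW)).
- by move=> b c [W xW bW]; exists W => // P PW; exact: (@sidealMr _ _ _ (tilde_star_ideal P) b c (bW P PW)).
- by move=> b [W xW bW]; exists W => // P PW; apply: (sideal_star (tilde_star_ideal P)); exact: bW.
Qed.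

(** Turns a lower bound at points accumulating over x into a single Q: positivity of t - b^* b + k
    with k in the germ ideal would make b small over a whole neighbourhood of x. *)
Lemma not_small_near b t : 0 < t ->
    (forall W, nbhs x W -> exists2 P, W (phi P) & ~ small P b t) ->
  exists2 Q, germ_ideal `<=` prim_ideal Q & ~ prim_ideal Q b.
Proof.
move=> t0 bt; apply: prim_quotient germ_star_ideal t0 _ => k [W xW kW] pk.
by have [P PW []] := bt W xW; exists k => //; exact: kW.
Qed.

Lemma germ_sub_fibre P : hausdorff_space X -> germ_ideal `<=` tilde P -> phi P = x.
Proof.
move=> hX gP; apply: hX => V W PV xW; apply: contrapT => VW.
have oU : open (phi @^-1` interior V).
  by apply: open_comp; [move=> P' _; exact: phi_cont|exact: open_interior].
have [|c [Pc cU]] := prim_open_sep oU (Q := P); first exact: PV.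
apply/Pc/tilde_in/gP; exists W => // P' P'W; apply/tilde_in/cU => /= /interior_subset VP'.
by apply: VW; exists (phi P').
Qed.

(** If [phibar Q] and [iota x] had disjoint neighbourhoods, some c outside Q would vanish at all
    primitive ideals mapped away from [phibar Q], hence near x; but then c lies in the germ
    ideal. *)
Lemma germ_sub_beta (bX : topologicalType) (iota : X -> bX) (phibar : prim MA -> bX) Q :
    hausdorff_space bX -> continuous iota -> is_base_extension iota phi phibar ->
  germ_ideal `<=` prim_ideal Q -> phibar Q = iota x.
Proof.
move=> hbX ciota [cphibar phibarE] gQ; apply: hbX => V W QV xW; apply: contrapT => VW.
have oU : open (phibar @^-1` interior V).
  by apply: open_comp; [move=> Q' _; exact: cphibar|exact: open_interior].
have [|c [Qc cU]] := prim_open_sep oU (Q := Q); first exact: QV.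
apply/Qc/gQ; exists (iota @^-1` W); first exact: ciota.
move=> P PW; have [Q' Q'E _] := tilde_prim P; rewrite -Q'E; apply: cU => /= /interior_subset.
by rewrite (phibarE P Q' Q'E) => VP; apply: VW; exists (iota (phi P)).
Qed.

(** Upper semicontinuity at x of the norms of an element of J_x. Otherwise some Q contains the germ
    ideal but not a; as a is in A, this Q is a [tilde P] with P over x, which contradicts the
    hypothesis on a. *)
Lemma fibre_small a t : hausdorff_space X -> 0 < t -> (forall P, phi P = x -> prim_ideal P a) ->
  exists2 W, nbhs x W & forall P, W (phi P) -> small P (mult_in a) t.
Proof.
move=> hX t0 xa; apply: contrapT => h.
have [|Q gQ Qa] := @not_small_near (mult_in a) t t0.
  move=> W xW; apply: contrapT => hW; apply: h; exists W => // P PW.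
  by apply: contrapT => aP; apply: hW; exists P.
have [/(_ a)//|[P QP]] := prim_multiplier_cases Q.
rewrite QP in gQ Qa; apply: Qa; apply/tilde_in/xa; exact: germ_sub_fibre.
Qed.

End PrimitiveIdeals.

(** * Approximate units and strictly convergent series *)

Lemma separable_sequence (T : topologicalType) (x0 : T) : separable T ->
  exists a : nat -> T, forall U, open U -> U !=set0 -> exists i, U (a i).
Proof.
move=> [D [/countable_injP[f finj] dD]].
(* An index that codes no point of D takes the default value x0; the coded indices suffice. *)
exists (fun n => xget x0 [set c | D c /\ f c = n]) => U oU U0.
have [y [Uy Dy]] := dD U U0 oU; exists (f y); case: xgetP => [d _ [Dd fd]|/(_ y)[]//].
by rewrite (finj d y) ?inE.
Qed.

Section Constructions.
Variables (R : realType) (A : cstarAlgType R).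
Notation MA := (multiplier A).
Implicit Types (P : prim A) (b c f : MA) (a : A).
Local Notation rs := (rs A).

Record approx_unit (e : nat -> MA) : Prop := {
  au_in : forall n, exists a, e n = mult_in a;
  au_pos : forall n, pos (e n);
  au_le1 : forall n, pos (1 - e n);
  au_mono : forall n, pos (e n.+1 - e n);
  au_cvg : forall a, vanish (fun n => nm (a - lmul (e n) a))
}.

Lemma pos_trans b c d : pos (b - c) -> pos (c - d) -> pos (b - d).
Proof. move=> bc cd; have -> : b - d = (b - c) + (c - d) by zmod. exact: posD. Qed.

Lemma N_le1 b : pos b -> pos (1 - b) -> N b <= 1.
Proof. by move=> pb b1; apply: pos_le_N; rewrite ?rs1. Qed.

(** For a dense sequence (a_i), put D_n = n (a_0 a_0^* + ... + a_(n-1) a_(n-1)^* ) and e_n = 1 - (1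
    + D_n)^-1. Since D_n increases, [pos_inv_anti] makes e_n increase, and D_0 = 0 gives e_0 = 0. *)
Lemma approx_unit_exists : separable A -> exists2 e, approx_unit e & e 0%N = 0.
Proof.
move=> /(separable_sequence 0)[a da].
pose sq i : MA := mult_in (a i) * (mult_in (a i))^*s.
have psq i : pos (sq i) by rewrite /sq -{1}[mult_in (a i)]astarK; exact: pos_sqr.
pose S := fix S n : MA := if n is n'.+1 then S n' + sq n' else 0.
have pS n : pos (S n) by elim: n => [|n IH] /=; [exact: pos0|exact: posD].
have Ssq n i : (i < n)%N -> pos (S n - sq i).
  elim: n => // n IH; rewrite ltnS leq_eqVlt => /predU1P[->|/IH h] /=.
    by rewrite addrK.
  by rewrite addrAC; exact: posD.
pose D_ n := rs n%:R * S n.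
have pD n : pos (D_ n) by exact: pos_rsM.
have Dmono n : pos (D_ n.+1 - D_ n).
  have -> : D_ n.+1 - D_ n = rs n%:R * sq n + S n.+1.
    rewrite /D_ -[n.+1%:R]natr1 rsD rs1 mulrDl mul1r /= mulrDr; zmod.
  by apply: posD => //; exact: pos_rsM.
have Sin n : exists g, S n = mult_in g.
  elim: n => [|n [g gE]]; first by exists 0; rewrite (lin0 (@mult_in_linear R A)).
  exists (g + a n ⋅ (a n)^*s); rewrite (linD (@mult_in_linear R A)) -gE mult_inM.
  by rewrite mult_in_star.
have /choice[d dP] n := pos_inv (pD n).
exists (fun n => 1 - d n); last first.
  have [d1 _ _ _] := dP 0%N; move: d1.
  by rewrite /D_ rs0 mul0r addr0 mul1r => ->; rewrite subrr.
split.
- move=> n; have [d1 d2 pd p1d] := dP n; have [g gE] := Sin n.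
  exists (rmul (d n) (((n%:R : R)%:C)%C *: g)); rewrite mult_in_rmul.
  rewrite (linZ (@mult_in_linear R A)) -rsE -gE -/(D_ n).
  by rewrite -{1}d1 mulrDl mul1r addrAC subrr add0r.
- by move=> n; have [] := dP n.
- by move=> n; have [? ? pd _] := dP n; rewrite opprB addrC subrK.
- move=> n; have [d1 d2 pd p1d] := dP n; have [d1' d2' pd' p1d'] := dP n.+1.
  have -> : 1 - d n.+1 - (1 - d n) = d n - d n.+1 by zmod.
  exact: (@pos_inv_anti _ _ (D_ n) (D_ n.+1)).
- move=> c e e0.
  have [|i] := da (ball c (((e / 2)%:C)%C)) (ball_open _ _).
    by exists c; apply: ballxx; rewrite ltcR divr_gt0.
  rewrite -ball_normE /ball_/= -nm_lt => ci.
  (* With d the inverse of 1 + D_n and S = D_n / n, d = d^2 + n d S d gives d S d <= 1 / n, and S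
     dominates a_i a_i^* once i < n. *)
  have vN n : (i < n)%N -> N (d n * mult_in (a i)) ^+ 2 <= n%:R^-1.
    move=> ni; have [d1 d2 pd p1d] := dP n.
    have n0 : n%:R != 0 :> R by rewrite pnatr_eq0 -lt0n (leq_trans _ ni).
    rewrite -N_star -N_Cstar astarK.
    have -> : d n * mult_in (a i) * (d n * mult_in (a i))^*s = d n * sq i * d n.
      by rewrite mstarM (pos_herm pd) !mulrA.
    apply: pos_le_N; first by rewrite invr_ge0.
      exact: pos_conj_herm (pos_herm pd) (psq i).
    have dE : d n = d n * d n + rs n%:R * (d n * S n * d n).
      have -> : rs n%:R * (d n * S n * d n) = d n * D_ n * d n.
        by rewrite /D_ !mulrA rsC.
      by rewrite -{1}[d n]mul1r -{1}d2 mulrDr mulr1 mulrDl.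
    have -> : rs n%:R^-1 - d n * sq i * d n =
       rs n%:R^-1 * (1 - d n) + rs n%:R^-1 * (d n * d n) + d n * (S n - sq i) * d n.
      have e1 : rs n%:R^-1 * d n = rs n%:R^-1 * (d n * d n) + d n * S n * d n.
        by rewrite {1}dE mulrDr rsVK.
      rewrite [rs _ * (1 - _)]mulrBr mulr1 e1; ncring.
    apply: posD; first apply: posD.
    + by apply: pos_rsM; rewrite ?invr_ge0.
    + apply: pos_rsM; rewrite ?invr_ge0//; exact: pos_herm_sqr (pos_herm pd).
    + by apply: pos_conj_herm; [exact: pos_herm|exact: Ssq].
  have [n0 hn] := @vanish_invn R ((e / 2) ^+ 2) ltac:(by rewrite exprn_gt0// divr_gt0).
  exists (maxn n0.+1 i.+1) => n; rewrite geq_max => /andP[n0n ni].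
  have [d1 d2 pd p1d] := dP n.
  have -> : c - lmul (1 - d n) c = lmul (d n) c by rewrite /= opprB addrC subrK.
  have -> : lmul (d n) c = lmul (d n) (c - a i) + lmul (d n) (a i).
    by rewrite -lmulD subrK.
  rewrite (le_lt_trans (nmD _ _))// [e]splitr ltrD//.
    rewrite (le_lt_trans (N_lmul _ _))// (le_lt_trans _ ci)// ler_piMl ?nm_ge0//.
    exact: N_le1.
  rewrite -mult_inE mult_in_lmul -(ltr_pXn2r (n := 2))// ?nnegrE ?N_ge0 ?divr_ge0 ?(ltW e0)//.
  rewrite (le_lt_trans (vN n ni))//; case: n n0n {ni d1 d2 pd p1d} => // n /hn.
Qed.

Lemma prim_closed P (u : nat -> A) a : vanish (fun n => nm (a - u n)) ->
  (forall n, prim_ideal P (u n)) -> prim_ideal P a.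
Proof.
have [H [sg [rsg _ Psg _]]] := prim_extend P.
move=> ua Pu; apply/Psg => v; apply: nm0_eq0; apply/eqP; rewrite eq_le nm_ge0 andbT.
apply: (vanish_ge0 (f := fun n => nm (a - u n) * nm v)).
  by apply: vanishZr => //; exact: nm_ge0.
move=> n; have := Pu n; rewrite Psg => /(_ v) un.
have -> : sg (mult_in a) v = sg (mult_in (a - u n)) v.
  by rewrite (linB (@mult_in_linear R A)) (repBl rsg) un subr0.
by rewrite (le_trans (rep_contract rsg _ _))// mult_inE.
Qed.

Lemma pos_sqr_le b : pos b -> pos (1 - b) -> pos (b - b * b).
Proof.
move=> pb b1; have -> : b - b * b = b * (1 - b) by rewrite mulrBr mulr1.
by apply: pos_mul => //; rewrite mulrBr mulrBl mulr1 mul1r.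
Qed.

(** As b^2 <= b <= c, a^* b^2 a is dominated by a^* c a. Only an order bound on b is used, which
    suits the tails of a series. *)
Lemma nm_lmul_pos (b c : MA) a : pos b -> pos (1 - b) -> pos (c - b) ->
  nm (lmul b a) ^+ 2 <= nm a * nm (lmul c a).
Proof.
move=> pb b1 bc; rewrite -!mult_inE -N_Cstar mult_in_lmul mstarM (pos_herm pb).
have -> : (mult_in a)^*s * b * (b * mult_in a) = (mult_in a)^*s * (b * b) * mult_in a.
  by rewrite !mulrA.
apply: (@le_trans _ _ (N ((mult_in a)^*s * c * mult_in a))).
  apply: pos_mono_N; first exact/pos_conj/pos_herm_sqr/pos_herm.
  rewrite -mulrBl -mulrBr; apply: pos_conj; apply: pos_trans bc _; exact: pos_sqr_le.
by rewrite -mulrA (le_trans (NM _ _))// N_star mult_in_lmul.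
Qed.

(** For 0 <= T <= 1 the norm condition in [pos] holds with the common value t = 1, and it passes to
    the limit. *)
Lemma pos_strict_lim (T : nat -> MA) b (eps : A -> nat -> R) :
    (forall n, pos (T n) /\ pos (1 - T n)) -> (forall a, vanish (eps a)) ->
    (forall a n, nm (lmul b a - lmul (T n) a) <= eps a n /\
                 nm (rmul b a - rmul (T n) a) <= eps a n) ->
  pos b.
Proof.
move=> pT veps bT.
have null (u v : A) (w : nat -> A) (f g : nat -> R) : vanish f -> vanish g ->
    (forall n, nm (u - w n) <= f n) -> (forall n, nm (v - w n) <= g n) -> u = v.
  move=> vf vg uw vw; apply/eqP; rewrite -subr_eq0; apply/eqP/nm0_eq0/eqP.
  rewrite eq_le nm_ge0 andbT; apply: vanish_ge0 (vanishD vf vg) _ => n.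
  by rewrite (le_trans (nm_dist_tri (w n) _ _))// lerD// nmB.
have hT n (a : A) : (rmul (T n) a^*s)^*s = lmul (T n) a.
  by have [/pos_herm h _] := pT n; rewrite -[in RHS]h.
split.
  have e1 a : lmul b^*s a = lmul b a.
    apply: (null _ _ (fun n => lmul (T n) a) (eps a^*s) (eps a)) => // n; last first.
      by have [] := bT a n.
    by rewrite /= -hT -astarN -astarD nm_star; have [] := bT a^*s n.
  apply: multiplierP => a; first exact: e1.
  by rewrite -[RHS]astarK -[a in RHS]astarK -[(rmul b _)^*s]/(lmul b^*s a^*s) e1.
exists 1 => //; rewrite rs1; apply: N_le => // a; rewrite mul1r -subr_le0.
apply: vanish_ge0 (veps a) _ => n; rewrite lerBlDr.
have -> : lmul (1 - b) a = - (lmul b a - lmul (T n) a) + lmul (1 - T n) a by rewrite /=; zmod.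
have [pTn p1Tn] := pT n.
rewrite (le_trans (nmD _ _))// nmN lerD//; first by have [] := bT a n.
rewrite (le_trans (N_lmul _ _))// ler_piMl ?nm_ge0//; apply: N_le1 => //.
by have -> : 1 - (1 - T n) = T n by zmod.
Qed.

Lemma vanish_sqrt (f : nat -> R) : vanish f -> vanish (fun n => Num.sqrt (f n)).
Proof.
move=> vf e e0; have [n0 h] := vf (e ^+ 2) ltac:(by rewrite exprn_gt0).
exists n0 => n /h fe; rewrite -[e]ger0_norm ?(ltW e0)// -sqrtr_sqr ltr_sqrt//.
by rewrite exprn_gt0.
Qed.

End Constructions.

Section Series.
Variables (R : realType) (A : cstarAlgType R).
Notation MA := (multiplier A).
Implicit Types (P : prim A) (b : MA) (a : A).

Lemma au_mono_le (e : nat -> MA) n m : approx_unit e -> (n <= m)%N -> pos (e m - e n).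
Proof.
move=> au /subnKC <-; elim: (m - n)%N => [|j IH]; first by rewrite addn0 subrr; exact: pos0.
by rewrite addnS; apply: pos_trans IH; exact: au_mono.
Qed.

Lemma approx_unit_sub (e : nat -> MA) (g : nat -> nat) : approx_unit e ->
  (forall n, (g n < g n.+1)%N) -> approx_unit (e \o g).
Proof.
move=> au gS; have gn n : (n <= g n)%N.
  by elim: n => // n IH; exact: leq_ltn_trans IH (gS n).
split => /=.
- by move=> n; exact: au_in au _.
- by move=> n; exact: au_pos au _.
- by move=> n; exact: au_le1 au _.
- by move=> n; apply: au_mono_le; rewrite // ltnW.
- move=> a eps eps0; have [n0 h] := au_cvg au a eps0.
  by exists n0 => n n0n; apply: h; exact: leq_trans n0n (gn n).
Qed.

Variables (e r k : nat -> MA).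
Hypotheses (au : approx_unit e) (pr : forall i, pos (r i))
  (rr : forall i, r i * r i = e i.+1 - e i)
  (pk : forall i, pos (k i)) (k1 : forall i, pos (1 - k i)).

Definition partial m := \sum_(i < m) r i * k i * r i.

(** Each term r k r is dominated by r^2, and the squares telescope. *)
Let ptail n m : pos (partial (n + m) - partial n) /\
  pos (e (n + m)%N - e n - (partial (n + m) - partial n)).
Proof.
elim: m => [|m [IH1 IH2]]; first by rewrite addn0 !subrr; split; exact: pos0.
have -> : partial (n + m.+1) = partial (n + m) + r (n + m)%N * k (n + m)%N * r (n + m)%N.
  by rewrite addnS /partial big_ord_recr.
set i := (n + m)%N; split.
  have -> : partial i + r i * k i * r i - partial n = partial i - partial n + r i * k i * r i.
    by zmod.
  by apply: posD => //; apply: pos_conj_herm => //; exact: pos_herm.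
have -> : e (n + m.+1)%N - e n - (partial i + r i * k i * r i - partial n) =
    e i - e n - (partial i - partial n) + r i * (1 - k i) * r i.
  have -> : r i * (1 - k i) * r i = r i * r i - r i * k i * r i by ncring.
  by rewrite rr addnS -/i; zmod.
by apply: posD => //; apply: pos_conj_herm => //; exact: pos_herm.
Qed.

(** Tails lie between 0 and 1 - e_n, so [nm_lmul_pos] bounds their left action at a by the root of
    the norms of a and a - e_n a. The right action follows by taking adjoints, whence the sum in
    [eps]. *)
Lemma series_limit : exists b, (forall m, pos (b - partial m)) /\
  forall P, (forall i, tilde P (k i)) -> tilde P b.
Proof.
have tail1 n m : pos (1 - (partial (n + m) - partial n)).
  have [_ h] := ptail n m.
  have -> : 1 - (partial (n + m) - partial n) =
     (1 - e (n + m)%N) + e n + (e (n + m)%N - e n - (partial (n + m) - partial n)) by zmod.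
  by apply: posD => //; apply: posD; [exact: au_le1|exact: au_pos].
pose d a n := Num.sqrt (nm a * nm (a - lmul (e n) a)).
have dP a n m : nm (lmul (partial (n + m) - partial n) a) <= d a n.
  have [p1 p2] := ptail n m.
  rewrite -[leLHS]ger0_norm ?nm_ge0// -sqrtr_sqr ler_wsqrtr//.
  have -> : a - lmul (e n) a = lmul (1 - e n) a by [].
  apply: nm_lmul_pos => //.
  have -> : 1 - e n - (partial (n + m) - partial n) =
     (1 - e (n + m)%N) + (e (n + m)%N - e n - (partial (n + m) - partial n)) by zmod.
  by apply: posD => //; exact: au_le1.
have vd a : vanish (d a).
  by apply/vanish_sqrt/vanishZ; [exact: nm_ge0|exact: au_cvg].
pose eps a n := d a n + d a^*s n.
have veps a : vanish (eps a) by apply: vanishD.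
have Ceps a n m : (n <= m)%N -> nm (lmul (partial m) a - lmul (partial n) a) <= eps a n /\
    nm (rmul (partial m) a - rmul (partial n) a) <= eps a n.
  move=> /subnKC <-; set j := (m - n)%N; split.
    by rewrite (le_trans (dP a n j))// lerDl sqrtr_ge0.
  have [p1 p2] := ptail n j.
  have -> : rmul (partial (n + j)) a - rmul (partial n) a = (lmul (partial (n + j) - partial n) a^*s)^*s.
    by rewrite -[LHS]/(rmul (partial (n + j) - partial n) a) -{1}(pos_herm p1).
  by rewrite nm_star (le_trans (dP _ n j))// lerDr sqrtr_ge0.
have pS m : pos (partial m) /\ pos (1 - partial m).
  have := ptail 0 m; have := tail1 0%N m.
  have -> : partial 0 = 0 by rewrite /partial big_ord0.
  by rewrite add0n subr0 => ? [].
have [b bP] := mult_lim (fun n => N_le1 (pS n).1 (pS n).2) veps Ceps.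
exists b; split=> [m|P kP].
  apply: (@pos_strict_lim _ _ (fun n => partial (m + n) - partial m) _
    (fun a n => eps a (m + n)%N)).
  - by move=> n; split; [have [] := ptail m n|exact: tail1].
  - move=> a u u0; have [n0 h] := veps a u u0.
    by exists n0 => n n0n; apply: h; rewrite (leq_trans n0n) ?leq_addl.
  - move=> a n; have [h1 h2] := bP a (m + n)%N; split.
      by rewrite [X in nm X](_ : _ = lmul b a - lmul (partial (m + n)) a)//=; zmod.
    by rewrite [X in nm X](_ : _ = rmul b a - rmul (partial (m + n)) a)//=; zmod.
have tP m : tilde P (partial m).
  rewrite /partial; elim/big_ind: _ => [|u v|i _]; first exact: sideal0 (tilde_star_ideal P).
    exact: sidealD (tilde_star_ideal P) _ _.
  apply: (sidealMr (tilde_star_ideal P)); apply: (sidealMl (tilde_star_ideal P)); exact: kP.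
move=> a; split.
- apply: (@prim_closed _ _ P (fun n => lmul (partial n) a)); last by move=> n; have [] := tP n a.
  by apply: vanish_le (veps a) => n; have [] := bP a n.
- apply: (@prim_closed _ _ P (fun n => rmul (partial n) a)); last by move=> n; have [] := tP n a.
  by apply: vanish_le (veps a) => n; have [] := bP a n.
Qed.

End Series.

(** * Multipliers vanishing on a fibre *)

Section Separation.
Variables (R : realType) (A : cstarAlgType R).
Notation MA := (multiplier A).
Implicit Types (P : prim A) (Q : prim MA) (b c k q r : MA) (a : A) (t : R) (Y Z : set (prim A)).
Local Notation rs := (rs A).

Lemma nm_le_sqr (V : normedModType R[i]) (u v : V) t : 0 <= t -> nm u ^+ 2 <= t ^+ 2 * nm v ^+ 2 -> nm u <= t * nm v.
Proof.
by move=> t0 h; rewrite -(ler_pXn2r (n := 2))// ?nnegrE ?mulr_ge0 ?nm_ge0// exprMn.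
Qed.

Lemma prim_ideal_star_ideal Q : star_ideal (prim_ideal Q).
Proof.
by have [H [sg [rsg isg ->]]] := primP Q; exact: rep_ker_star_ideal.
Qed.

Lemma prim_ideal_sqr Q b : prim_ideal Q (b^*s * b) -> prim_ideal Q b.
Proof.
have [H [sg [rsg isg ->]]] := primP Q => bb v.
apply: nm0_eq0; apply/eqP; rewrite -sqrf_eq0 (rep_nm_sqr rsg); apply/eqP.
by rewrite [X in rin X]bb /rin inner0l.
Qed.

Lemma tilde_ker_closed Y P : closed Y -> (forall b, (forall P', Y P' -> tilde P' b) -> tilde P b) -> Y P.
Proof.
rewrite -openC /open/= => cY h; apply: contrapT => YP.
have := cY P; rewrite /hull_kernel_open setCK => /(_ _)/YP; apply.
move=> a ka; apply/tilde_in/h => P' YP'; apply/tilde_in; exact: ka.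
Qed.

Lemma tilde_bigcap Y : star_ideal [set b | forall P, Y P -> tilde P b].
Proof.
have T P := tilde_star_ideal P.
split.
- by move=> P _; exact: sideal0 (T P).
- by move=> b c Yb Yc P YP; apply: (sidealD (T P)); [exact: Yb|exact: Yc].
- by move=> b c Yc P YP; apply: (@sidealMl _ _ _ (T P) b c); exact: Yc.
- by move=> b c Yb P YP; apply: (@sidealMr _ _ _ (T P) b c); exact: Yb.
- by move=> b Yb P YP; apply: (sideal_star (T P)); exact: Yb.
Qed.

Lemma star_ideal_hp (K : set MA) b : star_ideal K -> K b -> K (hp b).
Proof.
move=> iK Kb; apply: (sidealMl iK); apply: (sidealD iK) => //; exact: (sideal_star iK).
Qed.

Lemma star_ideal_add (K L : set MA) : star_ideal K -> star_ideal L ->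
  star_ideal [set b | exists k l, [/\ K k, L l & b = k + l]].
Proof.
move=> iK iL; split.
- by exists 0, 0; split; [exact: sideal0|exact: sideal0|rewrite addr0].
- move=> _ _ [k [l [Kk Ll ->]]] [k' [l' [Kk' Ll' ->]]]; exists (k + k'), (l + l').
  by split; [exact: sidealD|exact: sidealD|zmod].
- move=> b _ [k [l [Kk Ll ->]]]; exists (b * k), (b * l).
  by split; [exact: sidealMl|exact: sidealMl|rewrite mulrDr].
- move=> _ b [k [l [Kk Ll ->]]]; exists (k * b), (l * b).
  by split; [exact: sidealMr|exact: sidealMr|rewrite mulrDl].
- move=> _ [k [l [Kk Ll ->]]]; exists k^*s, l^*s.
  by split; [exact: sideal_star|exact: sideal_star|rewrite mstarD].
Qed.

(* With [q = (1 + l^2 / t^2)^-1], the spectrum of [q l q] is bounded by [t / 2]. *)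
Lemma resolvent_bound (l : MA) t : l^*s = l -> 0 < t -> exists q,
  [/\ pos q, pos (1 - q), exists c, 1 - q = l * c & pos (rs (t / 2) - q * l * q)].
Proof.
move=> hl t0; have t2 : t != 0 by rewrite gt_eqF.
pose m := rs t^-1 * l.
have hm : m^*s = m by rewrite mstarZ hl.
have [q [q1 q2 pq p1q]] := pos_inv (pos_herm_sqr hm).
exists q; split => //.
- exists (rs t^-1 * (m * q)).
  have -> : l * (rs t^-1 * (m * q)) = m * m * q by rewrite rsCA /m !mulrA.
  by rewrite -{1}q1 mulrDl mul1r addrAC subrr add0r.
- have lE : l = rs t * m by rewrite /m rsK.
  have e : rs (t / 2) * ((1 - m) * (1 - m)) = rs (t / 2) * (1 + m * m) - l.
    have -> : (1 - m) * (1 - m) = 1 + m * m - (m + m) by rewrite mulrBl !mulrBr !mul1r !mulr1; zmod.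
    rewrite mulrBr; congr (_ - _).
    have -> : m + m = rs 2 * m by rewrite -[2]/(1 + 1) rsD rs1 mulrDl mul1r.
    by rewrite mulrA -rsM divfK// -lE.
  have -> : rs (t / 2) - q * l * q =
      rs (t / 2) * (1 - q) + q * (rs (t / 2) * ((1 - m) * (1 - m))) * q.
    have -> : q * (rs (t / 2) * ((1 - m) * (1 - m))) * q = rs (t / 2) * q - q * l * q.
      by rewrite e mulrBr mulrBl rsCA q2 mulr1.
    by rewrite mulrBr mulr1; zmod.
  have t20 : 0 <= t / 2 by rewrite divr_ge0// ltW.
  apply: posD; first exact: pos_rsM.
  apply: pos_conj_herm; first exact: pos_herm.
  by apply: pos_rsM => //; apply: pos_herm_sqr; rewrite mstarB mstar1 hm.
Qed.

(** No [tilde P] contains both the multipliers vanishing on Y and those vanishing on Z, and r^2 lies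
    in A; so [prim_quotient] yields r^2 <= t^2 / 2 + l + i with l vanishing on Z and i on Y. For the
    q of [resolvent_bound], k = 1 - q is a multiple of l and vanishes on Z, while q r^2 q <= t^2 on
    Y, so r k r loses at most t against r^2. *)
Lemma closed_separation Y Z r t : closed Y -> closed Z -> (forall P, Y P -> Z P -> False) ->
    pos r -> pos (1 - r) -> (exists a, r * r = mult_in a) -> 0 < t ->
  exists k, [/\ pos k, pos (1 - k), forall P, Z P -> tilde P k &
    forall P (H : hilbertType R) (sg : MA -> H -> H) v, Y P -> is_representation sg ->
      rep_ker sg = tilde P ->
      rin (sg (r * r) v) v - t * nm v ^+ 2 <= rin (sg (r * k * r) v) v].
Proof.
move=> cY cZ YZ pr r1 [a ra] t0; have hr := pos_herm pr.
have iYZ := star_ideal_add (tilde_bigcap Z) (tilde_bigcap Y).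
have s0 : 0 < t ^+ 2 / 2 by rewrite divr_gt0// exprn_gt0.
have [_ [[l0 [i0 [Zl0 Yi0 ->]]] plain]] : exists k, [set b | exists k l,
    [/\ [set b | forall P, Z P -> tilde P b] k, [set b | forall P, Y P -> tilde P b] l & b = k + l]] k /\
    pos (rs (t ^+ 2 / 2) - r^*s * r + k).
  apply: contrapT => h.
  have [|Q KQ Qr] := prim_quotient (b := r) iYZ s0; first by move=> k Kk pk; apply: h; exists k.
  have [QA|[P QP]] := prim_multiplier_cases Q.
    by apply/Qr/prim_ideal_sqr; rewrite hr ra.
  apply: (YZ P); apply: tilde_ker_closed => // b hb; rewrite -QP; apply: KQ.
    by exists 0, b; split=> //; [exact: sideal0 (tilde_bigcap Z)|rewrite add0r].
  by exists b, 0; split=> //; [exact: sideal0 (tilde_bigcap Y)|rewrite addr0].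
pose l := hp l0; pose i := hp i0.
have Zl : forall P, Z P -> tilde P l := star_ideal_hp (tilde_bigcap Z) Zl0.
have Yi : forall P, Y P -> tilde P i := star_ideal_hp (tilde_bigcap Y) Yi0.
have {plain}pli : pos (rs (t ^+ 2 / 2) - r * r + (l + i)).
  have := hp_herm (pos_herm plain); rewrite hpD hp_herm ?hpD => [e|].
    by rewrite -[X in X * r]hr e.
  by rewrite mstarB mstar_rs mstarM astarK.
(* Taken at t^2, so that q l q <= t^2 / 2; the other half of t^2 comes from the bound on r^2. *)
have [q [pq q1 [c qE] ql]] := resolvent_bound (hp_star l0) (exprn_gt0 2 t0).
exists (1 - q); split=> //.
- by have -> : 1 - (1 - q) = q by zmod.
- by move=> P ZP; rewrite qE; apply: (sidealMr (tilde_star_ideal P)); exact: Zl.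
move=> P H sg v YP rsg kersg.
have sm : small P (r * q) (t ^+ 2).
  exists (q * i * q).
    by apply: (sidealMr (tilde_star_ideal P)); apply: (sidealMl (tilde_star_ideal P)); exact: Yi.
  have -> : rs (t ^+ 2) - (r * q)^*s * (r * q) + q * i * q =
      rs (t ^+ 2 / 2) * (1 - q * q) + (rs (t ^+ 2 / 2) - q * l * q) +
      q * (rs (t ^+ 2 / 2) - r * r + (l + i)) * q.
    have -> : rs (t ^+ 2) = rs (t ^+ 2 / 2) + rs (t ^+ 2 / 2) by rewrite -rsD -splitr.
    rewrite mstarM hr (pos_herm pq).
    have -> : q * (rs (t ^+ 2 / 2) - r * r + (l + i)) * q =
        q * rs (t ^+ 2 / 2) * q - q * r * (r * q) + q * l * q + q * i * q by ncring.
    by rewrite -[q * rs _]rsC -[rs _ * q * q]mulrA [rs _ * (1 - _)]mulrBr mulr1; zmod.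
  apply: posD; first apply: posD => //.
    apply: pos_rsM; first exact: ltW.
    have -> : 1 - q * q = (1 - q) + (q - q * q) by zmod.
    by apply: posD => //; exact: pos_sqr_le.
  by apply: pos_conj_herm => //; exact: pos_herm.
have -> : r * (1 - q) * r = r * r - r * q * r by ncring.
rewrite (repBl rsg) rinDl rinNl lerD2l lerN2.
have -> : sg (r * q * r) v = sg (r * q) (sg r v) by rewrite -(rep_M rsg).
rewrite (le_trans (rin_cs _ _))//.
have h : nm (sg (r * q) (sg r v)) <= t * nm (sg r v).
  by apply: nm_le_sqr; [exact: ltW|apply: small_bound sm => //; exact: sqr_ge0].
have rv : nm (sg r v) <= nm v.
  by rewrite (le_trans (rep_contract rsg _ _))// ler_piMl ?nm_ge0//; exact: N_le1.
rewrite expr2 mulrA ler_wpM2r ?nm_ge0// (le_trans h)// ler_wpM2l// ltW//.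
Qed.

End Separation.

(** * A multiplier separating two disjoint closed sets *)

Section Witnesses.
Variables (R : realType) (A : cstarAlgType R).
Notation MA := (multiplier A).
Implicit Types (P : prim A) (b k r : MA) (a : A) (t : R) (Y Z : set (prim A)).

Lemma not_small_vector P b t s (H : hilbertType R) (sg : MA -> H -> H) v :
    is_representation sg -> rep_ker sg = tilde P -> 0 <= t -> 0 < s -> t < s ^+ 2 -> v != 0 ->
    s * nm v ^+ 2 <= rin (sg b v) v ->
  ~ small P b t.
Proof.
move=> rsg kersg t0 s0 ts v0 sv bt.
have nv : 0 < nm v by exact: nm_gt0.
have h1 := small_bound v t0 rsg kersg bt.
have h2 : s * nm v <= nm (sg b v).
  rewrite -(ler_pM2r nv) -mulrA -expr2 (le_trans sv)//; exact: rin_cs.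
have : (s * nm v) ^+ 2 <= t * nm v ^+ 2.
  by apply: le_trans h1; rewrite ler_pXn2r// ?nnegrE ?mulr_ge0 ?nm_ge0// ltW.
by rewrite exprMn ler_pM2r ?exprn_gt0// leNgt ts.
Qed.

(** The vector is taken in the range of A, where the e_n converge to the identity. *)
Lemma approx_unit_rep (e : nat -> MA) (H : hilbertType R) (sg : MA -> H -> H) a u :
    approx_unit e -> is_representation sg ->
  let v := sg (mult_in a) u in vanish (fun n => nm v ^+ 2 - rin (sg (e n) v) v).
Proof.
move=> au rsg v.
apply: (@vanish_le _ _ (fun n => nm (a - lmul (e n) a) * (nm u * nm v))); last first.
  by apply: vanishZr; [rewrite mulr_ge0 ?nm_ge0|exact: au_cvg].
move=> n; rewrite -rin_sqr -rinNl -rinDl mulrA (le_trans (rin_cs _ _))// ler_wpM2r ?nm_ge0//.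
have -> : v - sg (e n) v = sg (mult_in (a - lmul (e n) a)) u.
  by rewrite (linB (@mult_in_linear R A)) mult_in_lmul (repBl rsg) (rep_M rsg).
by rewrite (le_trans (rep_contract rsg _ _))// mult_inE.
Qed.

Lemma approx_unit_roots (e : nat -> MA) : approx_unit e -> exists r : nat -> MA,
  forall i, [/\ pos (r i), r i * r i = e i.+1 - e i, pos (1 - r i) &
                exists a, r i * r i = mult_in a].
Proof.
move=> au; suff /choice[r rP] i : exists r, [/\ pos r, r * r = e i.+1 - e i, pos (1 - r) &
    exists a, r * r = mult_in a] by exists r.
have [r [pr rr _]] := pos_sqrt (au_mono au i).
exists r; split => //.
- rewrite -(rs1 A); apply: N_pos_sub; first exact: pos_herm.
  rewrite -(ler_pXn2r (n := 2))// ?nnegrE ?N_ge0// -N_sqr_herm ?pos_herm// rr expr1n.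
  apply: N_le1; first exact: au_mono.
  have -> : 1 - (e i.+1 - e i) = (1 - e i.+1) + e i by zmod.
  by apply: posD; [exact: au_le1|exact: au_pos].
- have [a1 e1] := au_in au i.+1; have [a0 e0] := au_in au i.
  by exists (a1 - a0); rewrite rr e1 e0 (linB (@mult_in_linear R A)).
Qed.

Lemma disjoint_closed_witness Y Z : separable A -> closed Y -> closed Z ->
    (forall P, Y P -> Z P -> False) ->
  exists2 b, (forall P, Z P -> tilde P b) & forall P, Y P -> ~ small P b (1 / 8).
Proof.
move=> sepA cY cZ YZ; have [e au e0] := approx_unit_exists sepA.
have [r rP] := approx_unit_roots au.
(* The losses add up to 1/2, so the whole series stays above 1/2 on Y; the partial sum of m losses
   is 1/2 - (1/2)^(m+1). *)
pose eta i : R := (1 / 2) ^+ i.+2.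
have eta0 i : 0 < eta i by rewrite exprn_gt0.
have /choice[k kP] i : exists k, _ :=
  let: And4 h1 h2 h3 h4 := rP i in closed_separation cY cZ YZ h1 h3 h4 (eta0 i).
have [] := @series_limit _ _ e r k au.
- by move=> i; have [] := rP i.
- by move=> i; have [] := rP i.
- by move=> i; have [] := kP i.
- by move=> i; have [] := kP i.
move=> b [bS bP]; exists b => [P ZP|P YP].
  by apply: bP => i; have [_ _ + _] := kP i; exact.
have [H [sg [rsg isg Psg kersg]]] := prim_extend P.
have [a] := prim_proper P; rewrite Psg => /existsNP[u]; set v := sg _ u => /eqP v0.
have sum m : rin (sg (e m) v) v - (1 / 2 - (1 / 2) ^+ m.+1) * nm v ^+ 2 <=
    rin (sg (partial r k m) v) v.
  elim: m => [|m IH].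
    by rewrite e0 /partial big_ord0 (rep0l rsg) /rin inner0l expr1 subrr mul0r subr0.
  have [_ _ _ /(_ P H sg v YP rsg kersg)] := kP m; have [_ -> _ _] := rP m.
  rewrite (repBl rsg) /partial big_ord_recr/= -/(partial r k m) (repDl rsg).
  rewrite ![rin (_ + _) _]rinDl rinNl /eta ![_ ^+ _.+2]exprS ![_ ^+ _.+1]exprS; move: IH.
  rewrite ![_ ^+ _.+1]exprS.
  set X := nm v ^+ 2; set E := _ ^+ m; nra.
(* Any bound below (1/2)^2 would do in place of 1/8. *)
apply: (@not_small_vector P b _ (1 / 2) H sg v) => //; first lra.
rewrite -subr_le0; apply: vanish_ge0 (approx_unit_rep a u au rsg) _ => m; rewrite -/v.
have := sum m; have := rep_pos rsg v (bS m); rewrite (repBl rsg) rinDl rinNl.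
have : 0 <= (1 / 2 : R) ^+ m.+1 * nm v ^+ 2 by rewrite mulr_ge0 ?sqr_ge0// exprn_ge0.
set X := nm v ^+ 2; lra.
Qed.

End Witnesses.

(** * Failure of local modularity *)

Section NotLocallyModular.
Variables (R : realType) (A : cstarAlgType R).
Notation MA := (multiplier A).
Implicit Types (P Q : prim A) (b c k n p r : MA) (a : A) (t : R) (W Z : set (prim A)).
Local Notation rs := (rs A).

Lemma not_tilde_lmul P n : n^*s = n -> ~ tilde P n -> exists a, ~ prim_ideal P (lmul n a).
Proof.
move=> hn; apply: contra_notP => /forallNP h a; split; first exact: contrapT.
apply/tilde_in; rewrite mult_in_rmul -[_ * _]astarK mstarM hn -mult_in_star -mult_in_lmul.
by apply: (sideal_star (tilde_star_ideal P)); apply/tilde_in; exact: contrapT.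
Qed.

(** Modulo the ideals in V, 2 a = 1 + 2 p is invertible in M(A). With w its inverse, a (2 w) lies in
    A and is congruent to 1. *)
Lemma unital_quotient_cut (V : set (prim A)) a p n : mult_in a - rs (1 / 2) = p - n -> pos p ->
  (forall P, V P -> tilde P n) -> unital_quotient (ker_of V).
Proof.
move=> aE pp nV; have [|w [w1 w2 pw _]] := @pos_inv _ _ (rs 2 * p); first exact: pos_rsM.
pose u := rs 2 * w.
have r2 : rs 2 * rs (1 / 2) = 1 :> MA by rewrite -rsM mulrC divfK// rs1.
have aE2 : rs 2 * mult_in a = (1 + rs 2 * p) - rs 2 * n.
  have -> : mult_in a = rs (1 / 2) + p - n by rewrite -addrA -aE addrC subrK.
  by rewrite mulrBr mulrDr r2.
have e1 : mult_in (rmul u a) = 1 - n * u.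
  rewrite mult_in_rmul /u !rsCA mulrA aE2 mulrBl w1 -mulrA; congr (_ - _).
exists (rmul u a) => c; split => Q VQ; apply/tilde_in.
  rewrite (linB (@mult_in_linear R A)) mult_inM e1 mulrBl mul1r addrC addrA addNr sub0r.
  rewrite -mulrN -mulrA; apply: (sidealMr (tilde_star_ideal Q)); exact: nV.
rewrite (linB (@mult_in_linear R A)) mult_inM e1 mulrBr mulr1 addrC addrA addNr sub0r -mulNr.
apply: (sidealMl (tilde_star_ideal Q)); apply: (sidealMr (tilde_star_ideal Q)); exact: nV.
Qed.

Definition quarter_at b Q :=
  exists (H : hilbertType R) (sg : MA -> H -> H) v, [/\ is_representation sg, rep_ker sg = tilde Q,
    v != 0 & 1 / 4 * nm v ^+ 2 <= rin (sg b v) v].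

(** Where e_n0 >= 1/2, A is unital; so the negative part n of e_n0 - 1/2 survives at some Q. On a
    vector in the range of n, e_n0 is at most 1/2 while a late e_m exceeds 3/4, which leaves 1/4. *)
Lemma nonunital_stage (e : nat -> MA) Z P0 W (n0 : nat) : approx_unit e -> open W -> W P0 ->
    ~ interior Z P0 -> ~ unital_quotient (ker_of (W `\` interior Z)) ->
  exists m, (n0 < m)%N /\ exists Q, [/\ W Q, ~ Z Q & quarter_at (e m - e n0) Q].
Proof.
move=> au oW WP0 ZP0 nonunital; have [a aE] := au_in au n0.
have [p [n [pp pn pnE [pn0 np0] _]]] := positive_excess (1 / 2) (pos_herm (au_pos au n0)).
(* Q is wanted outside Z, not merely outside its interior: if n vanished on W off Z, a point of W
   where n survives would have a neighbourhood inside Z. *)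
have [Q [WQ ZQ Qn]] : exists Q, [/\ W Q, ~ Z Q & ~ tilde Q n].
  apply: contrapT => h; apply: nonunital; apply: (@unital_quotient_cut _ a p n) => //.
    by rewrite -aE.
  move=> P [WP ZP]; apply: contrapT => Pn; apply: ZP.
  have : nbhs P (W `&` [set P | ~ tilde P n]).
    by apply: open_nbhs_nbhs; split=> //; apply: openI => //; exact: open_not_tilde.
  apply: filterS => P' [WP' nP']; apply: contrapT => ZP'.
  by apply: h; exists P'.
have [H [sg [rsg isg Psg kersg]]] := prim_extend Q.
have [c] := not_tilde_lmul (pos_herm pn) Qn; rewrite Psg => /existsNP[u].
set v := sg _ u => /eqP v0.
have nv : 0 < nm v ^+ 2.
  by rewrite exprn_gt0// nm_gt0.
have [m0 hm] := approx_unit_rep (lmul n c) u au rsg (divr_gt0 nv (ltr0n _ 4)).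
exists (maxn m0 n0.+1); split; first by rewrite leq_max leqnn orbT.
exists Q; split=> //; exists H, sg, v; split=> //.
have := hm _ (leq_maxl m0 n0.+1); rewrite -/v; set m := maxn _ _ => {}hm.
have vE : v = sg n (sg (mult_in c) u) by rewrite /v mult_in_lmul (rep_M rsg).
have : rin (sg (e n0 - rs (1 / 2)) v) v <= 0.
  have -> : sg (e n0 - rs (1 / 2)) v = - sg n v.
    rewrite {1}vE -(rep_M rsg) pnE mulrBl pn0 sub0r (repNl rsg) (rep_M rsg) -vE//.
  by rewrite rinNl oppr_le0; exact: rep_pos.
rewrite !(repBl rsg) !rinDl !rinNl.
have -> : sg (rs (1 / 2)) v = ((1 / 2)%:C)%C *: v.
  by rewrite -[in RHS](rep_one rsg isg v) -(rep_rs rsg) mulr1.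
by rewrite rinZl rin_sqr; move: hm nv; set X := nm v ^+ 2; lra.
Qed.

(** The sets where a_i has norm above 1/2, for a dense sequence (a_i). If c vanishes off W and is
    large at P0, any a_i within 1/2 of c has norm at most 1/2 off W and remains large at P0. *)
Lemma countable_neighbourhoods P0 : separable A -> exists U : nat -> set (prim A),
  (forall i, open (U i)) /\ forall W, open W -> W P0 -> exists2 i, U i P0 & U i `<=` W.
Proof.
move=> /(separable_sequence 0)[a da]; exists (fun i => [set P | ~ small P (mult_in (a i)) (1 / 4)]); split.
  by move=> i; apply: open_not_small; lra.
move=> W oW WP0; have [c0 [P0c cW]] := prim_open_sep oW WP0.
have [H [sg [rsg isg Psg kersg]]] := prim_extend P0.
move: (P0c); rewrite Psg => /existsNP[v /eqP v0].
have nv0 : 0 < nm (sg (mult_in c0) v) by exact: nm_gt0.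
have v1 : v != 0 by apply: contra v0 => /eqP ->; rewrite (rep0 rsg).
have nv : 0 < nm v by exact: nm_gt0.
(* Scaled so that c stretches v by 2; a perturbation below 1/2 then still stretches v by more than
   1. *)
pose t := 2 * nm v / nm (sg (mult_in c0) v).
have t0 : 0 < t by rewrite divr_gt0// mulr_gt0.
pose c := (t%:C)%C *: c0.
have cE : mult_in c = rs t * mult_in c0 by rewrite rsE (linZ (@mult_in_linear R A)).
have [|i] := da (ball c (((1 / 2 : R)%:C)%C)) (ball_open _ _).
  by exists c; apply: ballxx; rewrite ltcR; lra.
rewrite -ball_normE /ball_/= -nm_lt => ci.
exists i => [/= sm|P /= Pi].
  have := small_bound v _ rsg kersg sm; move=> /(_ ltac:(lra)).
  have h : nm v < nm (sg (mult_in (a i)) v).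
    have e1 : sg (mult_in c) v = sg (mult_in (c - a i)) v + sg (mult_in (a i)) v.
      by rewrite -(repDl rsg) -(linD (@mult_in_linear R A)) subrK.
    have : nm (sg (mult_in c) v) = 2 * nm v.
      by rewrite cE (rep_rs rsg) nmZr gtr0_norm// /t divfK// gt_eqF.
    have := nmD (sg (mult_in (c - a i)) v) (sg (mult_in (a i)) v); rewrite -e1 => h1 h2.
    have := rep_contract rsg (mult_in (c - a i)) v; rewrite mult_inE => h3.
    have : nm (c - a i) * nm v <= 1 / 2 * nm v by rewrite ler_wpM2r ?nm_ge0// ltW.
    by move: h1 h2 h3 nv; lra.
  have : nm v ^+ 2 < nm (sg (mult_in (a i)) v) ^+ 2 by rewrite ltr_pXn2r// ?nnegrE ?nm_ge0.
  have : 0 <= nm v ^+ 2 by exact: sqr_ge0.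
  by move: (nm v ^+ 2) => X; lra.
apply: contrapT => WP; apply: Pi.
have Pc : tilde P (mult_in c).
  by rewrite cE; apply: (sidealMl (tilde_star_ideal P)); apply/tilde_in; exact: cW.
set ai := mult_in (a i); set d := mult_in (c - a i).
have dE : ai = mult_in c - d.
  by rewrite /d (linB (@mult_in_linear R A)) /ai; zmod.
have T := tilde_star_ideal P.
exists (ai^*s * ai - d^*s * d).
  have -> : ai^*s * ai - d^*s * d =
      (mult_in c)^*s * ai - d^*s * mult_in c.
    by rewrite {1}dE mstarB mulrBl {2}dE mulrBr; zmod.
  apply: (sidealD T); first by apply: (sidealMr T); exact: (sideal_star T).
  by rewrite -mulNr; exact: (sidealMl T).
have -> : rs (1 / 4) - ai^*s * ai + (ai^*s * ai - d^*s * d) = rs (1 / 4) - d^*s * d by zmod.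
apply: N_pos_sub; first exact/pos_herm/pos_sqr.
rewrite N_Cstar mult_inE.
have := nm_ge0 (c - a i); move: ci; set X := nm _; nra.
Qed.

(** Each term of the series is devoted to one point Q_i off the fibre, chosen in the i-th basic
    neighbourhood of P0: the block e_g(i+1) - e_g(i) is at least 1/4 on some vector there, and k_i
    separates the fibre of [phi (Q i)] from that of x. *)
Lemma nonunital_witness (X : topologicalType) (phi : prim A -> X) (x : X) P0 :
    separable A -> hausdorff_space X -> continuous phi -> phi P0 = x ->
    ~ interior (fibre phi x) P0 ->
    (forall W, open W -> W P0 -> ~ unital_quotient (ker_of (W `\` interior (fibre phi x)))) ->
  exists2 b, (forall P, phi P = x -> tilde P b) &
    forall W : set X, nbhs x W -> exists2 P, W (phi P) & ~ small P b (1 / 128).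
Proof.
move=> sepA hX cphi P0x P0i nonunital; have [e au _] := approx_unit_exists sepA.
have [U [oU UP0]] := countable_neighbourhoods P0 sepA.
(* U i if it contains P0, and everything otherwise, so that each V i is an open neighbourhood of
   P0. *)
pose V i := [set P | U i P0 -> U i P].
have oV i : open (V i).
  have [h|h] := pselect (U i P0).
    by have -> : V i = U i; [apply/seteqP; split => P hP; [exact: hP|move=> _]|exact: oU].
  by have -> : V i = setT; [apply/seteqP; split => // P _ /h|exact: openT].
have VP0 i : V i P0 by [].
have clX (y : X) : closed (phi @^-1` [set y]).
  by apply: closed_comp => [P _|]; [exact: cphi|exact/accessible_closed_set1/hausdorff_accessible].
have /choice[M MP] (p : nat * nat) := nonunital_stage p.2 au (oV p.1) (VP0 p.1) P0i (nonunital _ (oV p.1) (VP0 p.1)).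
pose g := fix g i := if i is i'.+1 then M (i', g i') else 0%N.
have gP i := MP (i, g i).
have aug : approx_unit (e \o g) by apply: approx_unit_sub => // i; have [] := gP i.
have [r rP] := approx_unit_roots aug.
have /choice[Q QP] i := (gP i).2.
have QZ i P : (phi @^-1` [set phi (Q i)]) P -> fibre phi x P -> False.
  by have [_ Qx _] := QP i => PQ Px; apply: Qx; rewrite /fibre /= -PQ.
(* A constant error suffices because only the i-th term is estimated at Q_i; the earlier terms are
   positive. *)
have e8 : 0 < 1 / 8 :> R by lra.
have /choice[k kP] i : exists k, _ := let: And4 h1 h2 h3 h4 := rP i in
  closed_separation (clX (phi (Q i))) (clX x) (QZ i) h1 h3 h4 e8.
have [] := @series_limit _ _ (e \o g) r k aug.
- by move=> i; have [] := rP i.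
- by move=> i; have [] := rP i.
- by move=> i; have [] := kP i.
- by move=> i; have [] := kP i.
move=> b [bS bP]; exists b => [P Px|W xW].
  by apply: bP => i; have [_ _ + _] := kP i; exact.
have [|i UiP0 UiW] := UP0 _ (open_comp (fun P _ => cphi P) (open_interior W)).
  by rewrite /= P0x.
have [VQ Qx [H [sg [v [rsg kersg v0 hv]]]]] := QP i.
exists (Q i); first exact: interior_subset (UiW _ (VQ UiP0)).
(* The lower bound is 1/4 - 1/8 = 1/8, and 1/128 < (1/8)^2. *)
apply: (@not_small_vector _ _ _ _ _ (1 / 8) H sg v) => //; try lra.
have [_ rr _ _] := rP i; have [pk _ _ /(_ (Q i) H sg v erefl rsg kersg)] := kP i.
rewrite rr /= -[M (i, g i)]/(g i.+1) => hk.
have := rep_pos rsg v (bS i.+1); rewrite (repBl rsg) rinDl rinNl.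
have : 0 <= rin (sg (partial r k i) v) v.
  apply: (rep_pos rsg); rewrite /partial; elim/big_ind: _ => [|c d|j _]; first exact: pos0.
    exact: posD.
  by apply: pos_conj_herm; [have [/pos_herm] := rP j|have [] := kP j].
rewrite [partial r k i.+1]/partial big_ord_recr/= -/(partial r k i) (repDl rsg) rinDl.
by move: hv hk => /=; set Y := nm v ^+ 2; lra.
Qed.

End NotLocallyModular.

(** * The strict topology and the ideal over a point *)

(** The embedding into the one-point compactification extends to the Stone-Cech compactification,
    and the preimage of the open copy of the interior of W is the required open set. *)
Lemma stone_cech_embedding (X bX : topologicalType) (iota : X -> bX) (x : X) W :
    locally_compact [set: X] -> hausdorff_space X -> is_stone_cech iota -> nbhs x W ->
  exists O, [/\ open O, O (iota x) & iota @^-1` O `<=` W].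
Proof.
move=> lX hX [_ _ _ univ] xW.
have [g [[cg gE] _]] := univ (one_point_compactification X) Some one_point_compactification_compact
  (one_point_compactification_hausdorff lX hX) one_point_compactification_some_continuous.
have gS y : g (iota y) = Some y by have := congr1 (fun h : X -> one_point_compactification X => h y) gE.
exists (g @^-1` (Some @` interior W)); split.
- apply: open_comp => [y _|]; first exact: cg.
  exact/one_point_compactification_open_some/open_interior.
- by exists x => //; rewrite gS.
- by move=> y [z Wz]; rewrite gS => -[<-]; exact: interior_subset.
Qed.

Lemma stone_cech_inj (X bX : topologicalType) (iota : X -> bX) :
  locally_compact [set: X] -> hausdorff_space X -> is_stone_cech iota -> injective iota.
Proof.
move=> lX hX sc x y xy; apply: (hX) => V W xV yW.
have [G [_ Gx GV]] := stone_cech_embedding lX hX sc xV.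
by exists y; split; [apply: GV; rewrite /preimage /= -xy|exact: nbhs_singleton].
Qed.

Section StrictTopology.
Variables (R : realType) (A : cstarAlgType R).
Notation MA := (multiplier A).
Implicit Types (P : prim A) (b c : MA) (a : A) (t : R).

Lemma not_prim_near P a : ~ prim_ideal P a -> exists2 t : R, 0 < t &
  forall c : A, nm (c - a) < t -> ~ prim_ideal P c.
Proof.
have [H [sg [rsg _ Psg _]]] := prim_extend P.
rewrite Psg => /existsNP[v /eqP av].
have av0 : 0 < nm (sg (mult_in a) v) by exact: nm_gt0.
have v0 : 0 < nm v.
  apply: nm_gt0; apply: contra av => /eqP ->.
  by rewrite (rep0 rsg).
exists (nm (sg (mult_in a) v) / nm v); first exact: divr_gt0.
move=> c; rewrite ltr_pdivlMr// => ca; rewrite Psg => /(_ v) cv.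
have := rep_contract rsg (mult_in (c - a)) v; rewrite mult_inE.
by rewrite (linB (@mult_in_linear R A)) (repBl rsg) cv sub0r nmN leNgt ca.
Qed.

Lemma tilde_strictly_closed P : strictly_closed (tilde P).
Proof.
suff oP : strict_open (~` tilde P) by rewrite /strictly_closed -openC.
move=> b /existsNP[a] /not_andP h.
suff [t t0 tP] : exists2 t : R, 0 < t &
    forall c, nm (lmul c a - lmul b a) < t -> nm (rmul c a - rmul b a) < t -> ~ tilde P c.
  exists [:: a], t; split=> // c ct.
  have [h1 h2] := ct a (mem_head _ _); rewrite -!nm_lt in h1 h2.
  exact: tP.
case: h => /not_prim_near[t t0 tP]; exists t => // c h1 h2 /(_ a)[c1 c2].
- exact: tP c1.
- exact: tP c2.
Qed.

Lemma strictly_closed_bigcap (I : Type) (D : set I) (F : I -> set MA) :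
  (forall i, D i -> strictly_closed (F i)) -> strictly_closed (\bigcap_(i in D) F i).
Proof. by move=> cF; apply: (@closed_bigI (strict A)). Qed.

Lemma au_cvgr (e : nat -> MA) a : approx_unit e -> vanish (fun n => nm (a - rmul (e n) a)).
Proof.
move=> au; apply: vanish_le (au_cvg au a^*s) => n.
rewrite -[leLHS]nm_star astarD astarN.
by rewrite -{1}(pos_herm (au_pos au n)) /= astarK.
Qed.

(** The products e_n b converge strictly to b: on the left e_n acts on [lmul b a], and on the right
    continuity of [rmul b] is used. A basic strict neighbourhood involves finitely many a. *)
Lemma strict_closed_approx (S : set MA) (e : nat -> MA) b : strictly_closed S -> approx_unit e ->
  (forall n, S (e n * b)) -> S b.
Proof.
move=> cS au Sb; apply: contrapT => nSb.
have oS : @open (strict A) (~` S) by rewrite openC.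
have [s [t [t0 st]]] := oS b nSb.
have near (a : A) : exists n0, forall n, (n0 <= n)%N ->
    nm (lmul (e n * b) a - lmul b a) < t /\ nm (rmul (e n * b) a - rmul b a) < t.
  have [C C0 hC] := linear_cont_bounded (rmul_linear b) (@rmul_continuous _ _ b).
  have [n1 h1] := au_cvg au (lmul b a) t0.
  have [n2 h2] := vanishZ C0 (au_cvgr a au) t0.
  exists (maxn n1 n2) => n; rewrite geq_max => /andP[n1n n2n]; split.
    by rewrite -nmN opprB; exact: h1.
  rewrite -nmN opprB (le_lt_trans _ (h2 n n2n))//.
  have -> : rmul b a - rmul (e n * b) a = rmul b (a - rmul (e n) a).
    by rewrite (linB (@rmul_linear _ _ b)).
  exact: hC.
have [n0 hn] : exists n0, forall a, a \in s -> forall n, (n0 <= n)%N ->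
    nm (lmul (e n * b) a - lmul b a) < t /\ nm (rmul (e n * b) a - rmul b a) < t.
  elim: s {st} => [|a s [n1 IH]]; first by exists 0%N.
  have [n2 h2] := near a; exists (maxn n1 n2) => c; rewrite inE => ch n.
  by rewrite geq_max => /andP[n1n n2n]; case/predU1P: ch => [->|cs]; [exact: h2|exact: IH].
apply: (st (e n0 * b)) => //= a /hn/(_ n0 (leqnn _))[h1 h2].
by rewrite -!nm_lt.
Qed.

End StrictTopology.

(** * The criterion at a point of X *)

Section Criterion.
Variables (R : realType) (A : cstarAlgType R) (X : topologicalType) (phi : prim A -> X).
Variables (bX : topologicalType) (iota : X -> bX) (phibar : prim (multiplier A) -> bX) (x : X).
Notation MA := (multiplier A).
Implicit Types (P : prim A) (b c k n p : MA) (a : A) (t : R) (W Y : set (prim A)).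
Local Notation rs := (rs A).
Hypotheses (sepA : separable A) (Aphi : is_C0_algebra phi).
Hypotheses (sc : is_stone_cech iota) (ext : is_base_extension iota phi phibar).

Let lX : locally_compact [set: X]. Proof. by case: Aphi. Qed.
Let hX : hausdorff_space X. Proof. by case: Aphi. Qed.
Let cphi : continuous phi. Proof. by case: Aphi. Qed.
Let tilde_fibre : set MA := \bigcap_(P in fibre phi x) tilde P.

Lemma H_ideal_sub_tilde : H_ideal x iota phibar `<=` tilde_fibre.
Proof.
move=> b Hb P Px; have [Q QP _] := tilde_prim P; rewrite -QP; apply: Hb.
by rewrite /preimage /= (ext.2 P Q QP) Px.
Qed.

Lemma H_strictly_closedP : strictly_closed (H_ideal x iota phibar) <->
  tilde_fibre `<=` H_ideal x iota phibar.
Proof.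
split=> [cH b bP|sub]; last first.
  have -> : H_ideal x iota phibar = tilde_fibre.
    by apply/seteqP; split=> //; exact: H_ideal_sub_tilde.
  by apply: strictly_closed_bigcap => P _; exact: tilde_strictly_closed.
have [e au _] := approx_unit_exists sepA.
apply: (strict_closed_approx cH au) => n Q /= Qx; have [g ->] := au_in au n.
(* Since e_n b lies in A, a Q containing A is no obstacle. Any other Q is a [tilde P], and
   injectivity of [iota] puts P over x. *)
have [QA|[P QP]] := prim_multiplier_cases Q; first by rewrite -mult_in_rmul; exact: QA.
rewrite QP; apply: (sidealMl (tilde_star_ideal P)); apply: bP.
by apply: (stone_cech_inj lX hX sc); rewrite -(ext.2 P Q QP).
Qed.

Lemma not_small_H b t : 0 < t -> (forall W : set X, nbhs x W -> exists2 P, W (phi P) & ~ small P b t) ->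
  ~ H_ideal x iota phibar b.
Proof.
move=> t0 bt Hb; have [Q gQ Qb] := not_small_near t0 bt.
have [_ hbX ciota _] := sc.
by apply/Qb/Hb; exact: germ_sub_beta gQ.
Qed.

(** A closed Y violating the condition is disjoint from the closed fibre of x; a multiplier that
    vanishes on the fibre and is bounded below on Y is then outside H_x. *)
Lemma tilde_sub_H_locally_closed : tilde_fibre `<=` H_ideal x iota phibar -> locally_closed_at phi x.
Proof.
move=> sub Y cY clY; apply: contrapT => nY.
have cF : closed (fibre phi x).
  by apply: closed_comp => [P _|]; [exact: cphi|exact/accessible_closed_set1/hausdorff_accessible].
have [|b bF bY] := disjoint_closed_witness sepA cY cF.
  by move=> P YP Px; apply: nY; exists P.
apply: (@not_small_H b (1 / 8)); [lra| |by apply: sub => P; exact: bF].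
by move=> W /clY[_ [[P YP <-] WP]]; exists P => //; exact: bY.
Qed.

Lemma tilde_sub_H_locally_modular : tilde_fibre `<=` H_ideal x iota phibar -> J_locally_modular phi x.
Proof.
move=> sub P [clP intP]; apply: contrapT => nV.
have cF : closed (fibre phi x).
  by apply: closed_comp => [P' _|]; [exact: cphi|exact/accessible_closed_set1/hausdorff_accessible].
have [|W oW WP unitalW|b bF bW] := nonunital_witness sepA hX cphi _ intP.
- by move: clP; rewrite -(closure_id _).1.
- apply: nV; exists (W `\` interior (fibre phi x)); split => //; exists W => //.
by apply: (not_small_H (t := 1 / 128) _ bW); [lra|apply: sub => Q; exact: bF].
Qed.

Lemma small_mod P b c t : 0 <= t -> tilde P (b - c) -> small P c t -> small P b t.
Proof.
move=> t0 bc [k Pk pk]; have T := tilde_star_ideal P.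
exists (k + (b^*s * b - c^*s * c)).
  apply: (sidealD T) => //.
  have -> : b^*s * b - c^*s * c = b^*s * (b - c) + (b - c)^*s * c.
    by rewrite mstarB mulrBr mulrBl; zmod.
  apply: (sidealD T); first exact: (sidealMl T).
  by apply: (sidealMr T); exact: (sideal_star T).
by have -> : rs t - b^*s * b + (k + (b^*s * b - c^*s * c)) = rs t - c^*s * c + k by zmod.
Qed.

Lemma tilde_small P b t : 0 <= t -> tilde P b -> small P b t.
Proof.
move=> t0 Pb; exists (b^*s * b); first exact: (sidealMl (tilde_star_ideal P)).
by rewrite subrK; exact: pos_rs.
Qed.

Lemma prim_open_tilde (U : set (prim MA)) Q : open U -> U Q -> exists P Q', prim_ideal Q' = tilde P /\ U Q'.
Proof.
move=> oU UQ; have [c [Qc cU]] := prim_open_sep oU UQ.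
have [P nP] : exists P, ~ tilde P c.
  apply/existsNP => h; apply: Qc; rewrite (tilde_inter0 h).
  exact: sideal0 (prim_ideal_star_ideal Q).
have [Q' Q'E _] := tilde_prim P; exists P, Q'; split=> //.
by apply: contrapT => /cU; rewrite Q'E.
Qed.

(** The threshold t is half of the ratio of the squared norms of b v and v for a vector v that b
    does not kill, so the positive part of b^* b - t cannot vanish there. *)
Lemma prim_excess Q b : ~ prim_ideal Q b -> exists t p n, [/\ 0 < t, pos p, pos n,
  b^*s * b - rs t = p - n /\ p * n = 0 & ~ prim_ideal Q p].
Proof.
have [H [sg [rsg isg QE]]] := primP Q; rewrite QE => /existsNP[v /eqP bv].
have bv0 : 0 < nm (sg b v) by exact: nm_gt0.
have v0 : 0 < nm v.
  by apply: nm_gt0; apply: contra bv => /eqP ->; rewrite (rep0 rsg).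
pose t := nm (sg b v) ^+ 2 / (2 * nm v ^+ 2).
have t0 : 0 < t by rewrite divr_gt0 ?mulr_gt0 ?exprn_gt0.
have [p [n [pp pn bE [pn0 _] _]]] := positive_excess t (pos_herm (pos_sqr b)).
exists t, p, n; split=> // pv.
have : rin (sg (b^*s * b - rs t) v) v <= 0.
  by rewrite bE (repBl rsg) pv sub0r rinNl oppr_le0; exact: rep_pos.
rewrite (repBl rsg) rinDl rinNl -(rep_nm_sqr rsg).
have -> : sg (rs t) v = (t%:C)%C *: v by rewrite -[in RHS](rep_one rsg isg v) -(rep_rs rsg) mulr1.
rewrite rinZl rin_sqr; have -> : t * nm v ^+ 2 = nm (sg b v) ^+ 2 / 2.
  by rewrite /t; field; rewrite gt_eqF.
have : 0 < nm (sg b v) ^+ 2 by rewrite exprn_gt0.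
by move: (nm (sg b v) ^+ 2) => u; lra.
Qed.

Lemma unital_quotient_one (V : set (prim A)) : unital_quotient (ker_of V) ->
  exists a, forall P, V P -> tilde P (1 - mult_in a).
Proof.
move=> [a aV]; exists a => P VP; rewrite -[_ - _]opprB -mulN1r.
by apply: (sidealMl (tilde_star_ideal P)) => c; have [h1 h2] := aV c; split; [exact: h1|exact: h2].
Qed.

Lemma modular_closed_tilde_sub_H : J_locally_modular phi x -> locally_closed_at phi x ->
  tilde_fibre `<=` H_ideal x iota phibar.
Proof.
move=> modular lclosed b bF Q0 /= Q0x; apply: contrapT => Q0b.
have [t [p [n [t0 pp pn [bE pn0] Q0p]]]] := prim_excess Q0b.
have sP P : small P b t <-> tilde P p by exact: small_excess (ltW t0) pp pn bE pn0.
pose Y := [set P | ~ tilde P p].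
have YF P : Y P -> ~ fibre phi x P.
  by move=> YP FP; apply/YP/sP/tilde_small; [exact: ltW|exact: bF].
(* The conditions p not in Q and [phibar Q] in G define an open set around Q0, which contains some
   [tilde P] by density; P is then in Y, with [phi P] close to x. *)
have clY : closure (phi @` closure Y) x.
  move=> W xW; have [G [oG Gx GW]] := stone_cech_embedding lX hX sc xW.
  have [||P [Q [QP [/= Qp GQ]]]] :=
    @prim_open_tilde ([set Q | ~ prim_ideal Q p] `&` phibar @^-1` G) Q0.
  - apply: openI; first exact: prim_open_ideal.
    by apply: open_comp => // Q _; exact: ext.1.
  - by split=> //=; rewrite Q0x.
  exists (phi P); split; last by apply: GW; rewrite /preimage /= -(ext.2 P Q QP).
  by exists P => //; apply: subset_closure; rewrite /Y /= -QP.
have [P clP Px] := lclosed _ (@closed_closure _ Y) clY.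
(* P is a boundary point of the fibre of x: it lies over x and is a limit of Y, which misses the
   fibre. *)
have [|V [[W oW VE] VP unitalV]] := modular P.
  split; first exact: subset_closure.
  by move=> /clP[P' [YP' FP']]; exact: YF FP'.
have [e eV] := unital_quotient_one unitalV.
(* On V the element e of A acts as the identity, so b agrees there with a = b e, which lies in J_x
   and is therefore small near x. *)
pose a := lmul b e.
have aF P' : phi P' = x -> prim_ideal P' a by move=> FP'; have [] := bF P' FP' e.
have [N xN aN] := fibre_small cphi hX t0 aF.
have [P' [YP' [WP' NP']]] : (Y `&` (W `&` phi @^-1` N)) !=set0.
  apply: clP; apply: filterI; last by apply: cphi; rewrite Px.
  by apply: open_nbhs_nbhs; split=> //; move: VP; rewrite VE => -[].
have VP' : V P'.
  by rewrite VE; split=> // /interior_subset; exact: YF.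
apply/YP'/sP; apply: small_mod (aN _ NP'); first exact: ltW.
have -> : b - mult_in a = b * (1 - mult_in e) by rewrite mult_in_lmul mulrBr mulr1.
by apply: (sidealMl (tilde_star_ideal P')); exact: eV.
Qed.

End Criterion.

Theorem corollary3p10 (R : realType) (A : cstarAlgType R)
    (X : topologicalType) (phi : prim A -> X)
    (betaX : topologicalType) (iota : X -> betaX)
    (phibar : prim (multiplier A) -> betaX) (x : X)
    (hsep : separable A)
    (hphi : is_C0_algebra phi)
    (hbeta : is_stone_cech iota)
    (hphibar : is_base_extension iota phi phibar)
    (hx : range phi x) :
  strictly_closed (H_ideal x iota phibar) <->
  J_locally_modular phi x /\ locally_closed_at phi x.
Proof.
rewrite (H_strictly_closedP x hsep hphi hbeta hphibar); split=> [sub|[mod cl]].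
  split; first exact: tilde_sub_H_locally_modular sub.
  exact: tilde_sub_H_locally_closed sub.
exact: modular_closed_tilde_sub_H.
Qed.
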